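(* Assume that the operator $S$ satisfies the $L_2$ Carleson estimate $\|Sf\|_{L_2(\mathbb{R}^n)}\lesssim \|Cf\|_{L_2(\mathbb{R}^n)}$ and that, for some $\delta>0$, the kernel $k$ satisfies the $x$-regularity estimate $$|k(t+s,x+z;y)-k(t,x;y)|\lesssim \frac{|(s,z)|^\delta}{|(t,x)-(0,y)|^{n+\delta}}\quad\text{for } |(s,z)|\le |(t,x)-(0,y)|/2,$$ and the $y$-regularity estimate $$|k(t,x;y+z)-k(t,x;y)|\lesssim \frac{|z|^\delta}{|(t,x)-(0,y)|^{n+\delta}}\quad\text{for } |z|\le |(t,x)-(0,y)|/2,$$ where $s,t>0$ and $x,y,z\in\mathbb{R}^n$. Fix $0<\eta<1$. Then for any $f\in L_1(\mathbb{R}^{1+n}_+)$ with bounded support, there exists an $\eta$-sparse family $\mathcal{D}_f\subset\mathcal{D}$ of dyadic cubes such that $$|Sf(y)|\lesssim \sum_{Q\in\mathcal{D}_f,\, Q\ni y}\frac{1}{|Q|}\iint_{\widehat{3Q}}|f(t,x)|\,dt\,dx,\qquad\text{for a.e. } y\in\mathbb{R}^n,$$ where the implicit constant is independent of $f$ and $y$ (it may depend on $\eta$).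
   Context: $\mathbb{R}^{1+n}_+=\{(t,x): t>0,\ x\in\mathbb{R}^n\}$. $X\lesssim Y$ means $X\le cY$ for a constant $c<\infty$ independent of the relevant variables (functions and points), possibly depending on parameters such as $n$, $\delta$, $\eta$ and the constants in the hypotheses. Fixed is a kernel function $k:\mathbb{R}^{1+2n}\to\mathbb{R}$, $(t,x,y)\mapsto k(t,x;y)$, and $S$ is the operator mapping functions on $\mathbb{R}^{1+n}_+$ to functions on $\mathbb{R}^n$ given by $$Sf(y)=\iint_{\mathbb{R}^{1+n}_+}k(t,x;y)f(t,x)\,dt\,dx,\qquad y\in\mathbb{R}^n.$$ For a cube $Q\subset\mathbb{R}^n$, $\ell(Q)$ is its side length, $|Q|$ its Lebesgue measure in $\mathbb{R}^n$, $cQ$ ($c>0$) the cube with the same center and side length $c\,\ell(Q)$, and $\widehat Q=(0,\ell(Q))\times Q\subset\mathbb{R}^{1+n}_+$ is the Carleson box above $Q$. The Carleson functional is $$Cf(z)=\sup_{Q\ni z}\frac1{|Q|}\iint_{\widehat Q}|f(t,x)|\,dt\,dx,\qquad z\in\mathbb{R}^n,$$ the sup being over all (not necessarily dyadic) cubes $Q\subset\mathbb{R}^n$ containing $z$. $\mathcal{D}=\bigcup_{j\in\mathbb{Z}}\mathcal{D}^j$ is a fixed system of dyadic cubes in $\mathbb{R}^n$, where $\mathcal{D}^j$ are the cubes of side length $2^{-j}$, such that $\mathcal{D}$ forms a connected tree under inclusion (in particular any two dyadic cubes are contained in a common dyadic cube). A collection $\widetilde{\mathcal{D}}\subset\mathcal{D}$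 is called $\eta$-sparse, $\eta>0$, if each $Q\in\widetilde{\mathcal{D}}$ contains a subset $E_Q\subset Q$ such that $|E_Q|\ge\eta|Q|$ and $E_R\cap E_Q=\emptyset$ whenever $R\neq Q$, $Q,R\in\widetilde{\mathcal{D}}$. *)

(* Defs.v *)
From HB Require Import structures.
From mathcomp Require Import all_boot all_order all_algebra.
From mathcomp Require Import all_classical all_reals all_analysis.

Set Implicit Arguments.
Unset Strict Implicit.
Unset Printing Implicit Defensive.
Import Order.TTheory GRing.Theory Num.Theory.
Import numFieldNormedType.Exports.

Local Open Scope classical_set_scope.
Local Open Scope ring_scope.

(* R^n, with the product (Borel) sigma-algebra of tuples. *)
Notation Rn R n := (n.-tuple (measurableTypeR R)).

(* R^(1+n) is represented by the pairs (t, x). *)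
Notation R1n R n := (measurableTypeR R * Rn R n)%type.

Definition addRn (R : realType) (n : nat) (x z : Rn R n) : Rn R n :=
  [tuple (tnth x i : R) + tnth z i | i < n].

Definition subRn (R : realType) (n : nat) (x z : Rn R n) : Rn R n :=
  [tuple (tnth x i : R) - tnth z i | i < n].

Definition norm_Rn (R : realType) (n : nat) (x : Rn R n) : R :=
  Num.sqrt (\sum_(i < n) (tnth x i : R) ^+ 2).

Definition norm_R1n (R : realType) (n : nat) (t : R) (x : Rn R n) : R :=
  Num.sqrt (t ^+ 2 + \sum_(i < n) (tnth x i : R) ^+ 2).

(* Lebesgue measure on R^n, as the iterated product of the Lebesgue measure
   on R, transported along R * R^n ~ R^(n+1). *)
Section cons_measure.
Context (R : realType) (n : nat).
Variable m : {sigma_finite_measure set (Rn R n) -> \bar R}.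
Local Open Scope ereal_scope.

Definition cons_Rn (p : R1n R n) : Rn R n.+1 :=
  [the n.+1.-tuple (measurableTypeR R) of p.1 :: p.2].

Lemma measurable_cons_Rn : measurable_fun setT cons_Rn.
Proof. exact: measurable_cons. Qed.

Definition cons_measure : set (Rn R n.+1) -> \bar R :=
  pushforward (@lebesgue_measure R \x m) cons_Rn.

Let cons_measure0 : cons_measure set0 = 0.
Proof. by rewrite /cons_measure /pushforward preimage_set0 measure0. Qed.

Let cons_measure_ge0 A : 0 <= cons_measure A.
Proof. by rewrite /cons_measure /pushforward; exact: measure_ge0. Qed.

Let cons_measure_sigma_additive : semi_sigma_additive cons_measure.
Proof.
have mf (A : set (Rn R n.+1)) : measurable A -> measurable (cons_Rn @^-1` A).
  by move=> mA; rewrite -[X in measurable X]setTI; exact: measurable_cons_Rn.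
move=> F mF tF mUF; rewrite /cons_measure /pushforward preimage_bigcup.
apply: measure_semi_sigma_additive.
- by move=> k; exact: mf.
- apply/trivIsetP => /= i j _ _ ij; rewrite -preimage_setI.
  by move/trivIsetP : tF => /(_ _ _ _ _ ij) ->//; rewrite preimage_set0.
- by rewrite -preimage_bigcup; exact: mf.
Qed.

HB.instance Definition _ := isMeasure.Build _ _ _ cons_measure
  cons_measure0 cons_measure_ge0 cons_measure_sigma_additive.

Let cons_measure_sigma_finite : sigma_finite setT cons_measure.
Proof.
have /sigma_finiteP[G [TG ndG Goo]] := sigma_finiteT m.
have /sigma_finiteP[{}F [TF ndF Foo]] :=
  sigma_finiteT (@lebesgue_measure R).
pose tl (x : Rn R n.+1) : Rn R n := [tuple of behead x].
pose hd (x : Rn R n.+1) : measurableTypeR R := tnth x ord0.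
exists (fun k => hd @^-1` F k `&` tl @^-1` G k).
  apply/esym; rewrite -subTset => x _.
  have : setT (hd x) by []. rewrite TF => -[i _ Fi].
  have : setT (tl x) by []. rewrite TG => -[j _ Gj].
  exists (maxn i j) => //; split.
  - have /subsetPset FS := ndF _ _ (leq_maxl i j); exact: FS.
  - have /subsetPset GS := ndG _ _ (leq_maxr i j); exact: GS.
move=> k; have [mF Fk] := Foo k; have [mG Gk] := Goo k; split.
  apply: measurableI; rewrite -[X in measurable X]setTI.
    exact: measurable_tnth.
  exact: measurable_behead.
rewrite /cons_measure /pushforward.
rewrite (_ : _ @^-1` _ = F k `*` G k).
  by rewrite product_measure1E// lte_mul_pinfty// ge0_fin_numE.
have tlE (p : R1n R n) : tl (cons_Rn p) = p.2 by apply/val_inj.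
by apply/seteqP; split=> p; rewrite /preimage /= tlE.
Qed.

HB.instance Definition _ := @Measure_isSigmaFinite.Build _ _ _ cons_measure
  cons_measure_sigma_finite.

End cons_measure.

Fixpoint lebesgue_Rn (R : realType) (n : nat) :
    {sigma_finite_measure set (Rn R n) -> \bar R} :=
  match n with
  | 0 => [the {sigma_finite_measure set (Rn R 0) -> \bar R} of
           dirac ([tuple] : Rn R 0)]
  | m.+1 => [the {sigma_finite_measure set (Rn R m.+1) -> \bar R} of
           cons_measure (lebesgue_Rn R m)]
  end.

Definition lebesgue_R1n (R : realType) (n : nat) :
    {measure set (R1n R n) -> \bar R} :=
  [the {measure set (R1n R n) -> \bar R} of
    (@lebesgue_measure R \x lebesgue_Rn R n)%E].

Definition halfspace (R : realType) (n : nat) : set (R1n R n) :=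
  [set p | (0 : R) < p.1].

(* A cube with sides parallel to the axes, given by its center and its side
   length; its point set is taken half-open, so that dyadic cubes of the same
   generation can partition R^n. *)
Definition cube (R : realType) (n : nat) := (Rn R n * {posnum R})%type.

Definition side (R : realType) (n : nat) (Q : cube R n) : R := Q.2%:num.

Definition cube_set (R : realType) (n : nat) (Q : cube R n) : set (Rn R n) :=
  [set x | forall i : 'I_n,
     (tnth Q.1 i : R) - side Q / 2 <= (tnth x i : R)
     < (tnth Q.1 i : R) + side Q / 2].

Definition dilate (R : realType) (n : nat) (c : {posnum R}) (Q : cube R n) :
  cube R n := (Q.1, (c%:num * Q.2%:num)%:pos).

Definition carleson_box (R : realType) (n : nat) (Q : cube R n) :
    set (R1n R n) :=
  [set p | (0 : R) < p.1 < side Q /\ cube_set Q p.2].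

Definition cube_volume (R : realType) (n : nat) (Q : cube R n) : R :=
  fine (lebesgue_Rn R n (cube_set Q)).

(* |Q|^-1 times the integral of |f| over the Carleson box of P. *)
Definition box_mean (R : realType) (n : nat) (f : R1n R n -> R)
    (Q P : cube R n) : \bar R :=
  ((cube_volume Q)^-1%:E *
   \int[lebesgue_R1n R n]_(p in carleson_box P) `|f p|%:E)%E.

Definition carleson (R : realType) (n : nat) (f : R1n R n -> R) (z : Rn R n) :
    \bar R :=
  ereal_sup [set box_mean f Q Q | Q in [set Q | cube_set Q z]].

Definition kernel_fun (R : realType) (n : nat) := R -> Rn R n -> Rn R n -> R.

(* The integral defining S f y converges absolutely. *)
Definition S_converges (R : realType) (n : nat) (k : kernel_fun R n)
    (f : R1n R n -> R) (y : Rn R n) : Prop :=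
  (lebesgue_R1n R n).-integrable (@halfspace R n)
    (fun p => (k p.1 p.2 y * f p)%:E).

Definition S_op (R : realType) (n : nat) (k : kernel_fun R n)
    (f : R1n R n -> R) (y : Rn R n) : R :=
  \int[lebesgue_R1n R n]_(p in @halfspace R n) (k p.1 p.2 y * f p).

Definition L1_halfspace (R : realType) (n : nat) (f : R1n R n -> R) : Prop :=
  (lebesgue_R1n R n).-integrable (@halfspace R n) (EFin \o f).

(* g is (a version of) S f for f in L_1.  For a general f in L_1 the integral
   S_op k f y may diverge on a set of y of positive measure, as the kernel
   only satisfies |k(t,x;y)| <~ |(t,x) - (0,y)|^-n; as for any singular
   integral, S f is then the limit of S (f_ j) for f_ j --> f in L_1, where
   the integrals S (f_ j) converge.  When S f itself converges almost
   everywhere, g := S_op k f is allowed, see S_value_integral. *)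
Definition S_value (R : realType) (n : nat) (k : kernel_fun R n)
    (f : R1n R n -> R) (g : Rn R n -> R) : Prop :=
  exists f_ : nat -> R1n R n -> R,
    [/\ forall j, L1_halfspace (f_ j),
        forall j, {ae lebesgue_Rn R n, forall y, S_converges k (f_ j) y},
        (fun j => \int[lebesgue_R1n R n]_(p in @halfspace R n)
                     `|f_ j p - f p|%:E)%E @ \oo --> 0%E
      & {ae lebesgue_Rn R n, forall y,
           (fun j => S_op k (f_ j) y) @ \oo --> g y}].

Lemma S_value_integral (R : realType) (n : nat) (k : kernel_fun R n)
    (f : R1n R n -> R) :
  L1_halfspace f ->
  {ae lebesgue_Rn R n, forall y, S_converges k f y} ->
  S_value k f (S_op k f).
Proof.
move=> f1 fS; exists (fun=> f); split => //.
  under eq_fun do under eq_integral do rewrite subrr normr0.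
  by under eq_fun do rewrite integral0; exact: cvg_cst.
by apply: aeW => y; exact: cvg_cst.
Qed.

(* Only functions f for which S f is given by its integral are tested. *)
Definition L2_carleson_estimate (R : realType) (n : nat) (k : kernel_fun R n)
    (C : R) : Prop :=
  forall f : R1n R n -> R,
    measurable_fun (@halfspace R n) f ->
    {ae lebesgue_Rn R n, forall y, S_converges k f y} ->
    ('N[lebesgue_Rn R n]_2%:E [EFin \o S_op k f]
     <= C%:E * 'N[lebesgue_Rn R n]_2%:E [carleson f])%E.

Definition x_regularity (R : realType) (n : nat) (k : kernel_fun R n)
    (delta C : R) : Prop :=
  forall (s t : R) (x y z : Rn R n), 0 < s -> 0 < t ->
    norm_R1n s z <= norm_R1n t (subRn x y) / 2 ->
    `|k (t + s) (addRn x z) y - k t x y|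
      <= C * (norm_R1n s z `^ delta
              / norm_R1n t (subRn x y) `^ (n%:R + delta)).

Definition y_regularity (R : realType) (n : nat) (k : kernel_fun R n)
    (delta C : R) : Prop :=
  forall (t : R) (x y z : Rn R n), 0 < t ->
    norm_Rn z <= norm_R1n t (subRn x y) / 2 ->
    `|k t x (addRn y z) - k t x y|
      <= C * (norm_Rn z `^ delta
              / norm_R1n t (subRn x y) `^ (n%:R + delta)).

Definition bounded_support (R : realType) (n : nat) (f : R1n R n -> R) : Prop :=
  exists M : R, forall p : R1n R n,
    halfspace p -> f p != 0 -> norm_R1n p.1 p.2 <= M.

Record dyadic_system (R : realType) (n : nat) (D : int -> set (cube R n)) :
    Prop := DyadicSystem {
  dyadic_side : forall j Q, D j Q -> side Q = 2 ^ (- j) ;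
  dyadic_partition : forall j x, exists! Q, D j Q /\ cube_set Q x ;
  dyadic_parent : forall j Q, D (j + 1) Q ->
    exists2 P, D j P & cube_set Q `<=` cube_set P ;
  dyadic_connected : forall i j Q P, D i Q -> D j P ->
    exists l T, [/\ D l T, cube_set Q `<=` cube_set T
                  & cube_set P `<=` cube_set T] }.

Definition dyadic_cubes (R : realType) (n : nat) (D : int -> set (cube R n)) :
  set (cube R n) := \bigcup_j D j.

Definition sparse (R : realType) (n : nat) (eta : R) (F : set (cube R n)) :
    Prop :=
  exists E : cube R n -> set (Rn R n),
    (forall Q, F Q ->
      [/\ measurable (E Q), E Q `<=` cube_set Q
        & (eta%:E * lebesgue_Rn R n (cube_set Q)
            <= lebesgue_Rn R n (E Q))%E]) /\
    (forall Q P, F Q -> F P -> P <> Q -> E P `&` E Q = set0).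

(* Main.v *)
Require Import Defs.
From HB Require Import structures.
From mathcomp Require Import all_boot all_order all_algebra.
From mathcomp Require Import all_classical all_reals all_analysis.
From mathcomp Require Import measurable_realfun ring lra zify.

Set Implicit Arguments.
Unset Strict Implicit.
Unset Printing Implicit Defensive.
Import Order.TTheory GRing.Theory Num.Theory.
Import numFieldNormedType.Exports.

Local Open Scope classical_set_scope.
Local Open Scope ring_scope.

(** The proof is a stopping-time argument on dyadic cubes, driven by two facts
about S: a weak type bound and a local oscillation bound.

Write f_Q for the restriction of f to the Carleson box of 3Q, and m_Q for the
mass of f on that box divided by the volume of Q. By the weak type bound for S
and for the Carleson functional, S f_Q and C f_Q are at most a constant times
m_Q off an open set Om_Q whose measure is a small multiple of the volume of Q
(exceptional_set). The children of Q are the maximal dyadic cubes P in Q in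
which Om_Q has density above a fixed threshold; together they fill at most the
fraction 1 - eta of Q (children_measure). On Q minus the children, Om_Q being
open, S f_Q is at most a constant times m_Q. On a child P, the function
f_Q - f_P vanishes on the box of 3P, so S (f_Q - f_P) oscillates on P by at
most a constant times C f_Q at any point of P (oscillation). By maximality Om_Q
does not fill P, and neither does Om_P, so some point of P lies outside both;
comparing with that point gives |S f_Q| <= |S f_P| + c m_Q on P (child_step).
Iterating, almost every point leaves the selected cubes after finitely many
steps (gen_terminates), and the accumulated bound is the sparse sum
(gen_pointwise). The sets Q minus the children of Q witness sparseness
(gen_sparse). Starting from a partition of space into dyadic cubes whose
threefold boxes contain the support of f (initial_cubes), f_Q equals f for each
starting cube, which gives the theorem.

The weak type bound is a Calderon-Zygmund decomposition on Carleson boxes. The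
mass of f in the box above each maximal heavy dyadic cube is moved to the upper
half of that box. The resulting function has bounded dyadic box means, so the
square of its Carleson functional has integral at most a multiple of the level
times the mass (carleson_L2), and the L2 estimate applies. The rest has mean
zero on each box and is handled with x-regularity (weak_type).

The L2 estimate only concerns functions on which the integral defining S
converges, and nothing is assumed about the size of the kernel. Testing it on
indicators of small boxes, where by regularity the kernel is nearly constant,
bounds the kernel by the distance to its pole to the power -n (kernel_size).
Hence the integral converges for functions supported away from the boundary, to
which the two bounds above are first restricted. For f in L1 one truncates
towards the boundary: the weak type bound makes fast truncations converge
almost everywhere, with a limit that satisfies the same bounds
(S_value_exists, S_value_osc) and does not depend on the approximation
(S_value_unique). *)

(** * Sums over countable families *)

Section countable_families.
Local Open Scope ereal_scope.

(** Values in option T let finite and countably infinite families be handled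
alike; the empty slots contribute 0 to sums and the empty set to unions. *)
Definition enumerates (T : Type) (A : set T) (e : nat -> option T) :=
  [/\ forall k i, e k = Some i -> A i,
      forall i, A i -> exists k, e k = Some i
    & forall k l i, e k = Some i -> e l = Some i -> k = l].

Lemma countable_enum (T : Type) (A : set T) : countable A ->
  exists e, enumerates A e.
Proof.
move=> /countable_injP[f finj].
exists (fun k => if pselect (exists i, A i /\ f i = k) is left H
                 then Some (projT1 (cid H)) else None); split.
- move=> k i; case: pselect => // H [<-]; by case: (cid H) => j [].
- move=> i Ai; exists (f i); case: pselect => [H|]; last by case; exists i.
  case: (cid H) => j [Aj fj] /=; congr Some.
  by apply: finj => //; exact/mem_set.
- move=> k l i; case: pselect => // H [iE]; case: pselect => // H' [iE'].
  have [_ <-] := projT2 (cid H); have [_ <-] := projT2 (cid H').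
  by congr f; move: iE iE' => /= -> ->.
Qed.

Context (R : realType) (T : choiceType) (A : set T).

Lemma esum_enum (a : T -> \bar R) (e : nat -> option T) :
  enumerates A e -> (forall i, A i -> 0 <= a i) ->
  \esum_(i in A) a i = \sum_(0 <= k <oo) oapp a 0 (e k).
Proof.
move=> [e1 e2 e3] a0.
have e0 k : 0 <= oapp a 0 (e k).
  by case E : (e k) => [i|] //=; apply: a0; exact: e1 E.
rewrite nneseries_esumT//.
have [A0|/set0P[i0 Ai0]] := eqVneq A set0.
  rewrite A0 esum_set0 esum1// => k _; case E : (e k) => [i|] //=.
  by have := e1 _ _ E; rewrite A0.
rewrite (@reindex_esum _ _ _ [set k | e k] A (fun k => odflt i0 (e k))).
  rewrite esum_mkcond; apply: eq_esum => k _.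
  case: ifPn; first by move/set_mem => /=; case: (e k).
  by move/negP => H; case E : (e k) => [i|] //=; case: H; apply/mem_set; rewrite /= E.
split.
- by move=> k /=; case E : (e k) => [i|] //= _; exact: e1 E.
- move=> k l /set_mem /= + /set_mem /=; case E : (e k) => [i|] //= _.
  by case F : (e l) => [j|] //= _ ij; apply: (e3 _ _ i) => //; rewrite F ij.
- by move=> i /e2[k ek]; exists k => /=; rewrite ek.
Qed.

Lemma esum_subset (B : set T) (a : T -> \bar R) : A `<=` B ->
  \esum_(i in A) a i <= \esum_(i in B) a i.
Proof.
move=> AB; apply: ge_ereal_sup => _ [Y [fY YA] <-]; apply: esum_ge.
by exists Y => //; split => //; exact: subset_trans AB.
Qed.

Lemma esumZl (a : T -> \bar R) (c : R) : countable A ->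
  (forall i, A i -> 0 <= a i) -> (0 <= c)%R ->
  \esum_(i in A) (c%:E * a i) = c%:E * \esum_(i in A) a i.
Proof.
move=> /countable_enum[e eA] a0 c0; rewrite !(esum_enum eA)//; last first.
  by move=> i Ai; rewrite mule_ge0 ?lee_fin ?a0.
rewrite -nneseriesZl; last first.
  move=> k _; case E : (e k) => [i|] //=; apply: a0.
  by case: eA => /(_ _ _ E).
by apply: eq_eseriesr => k _; case: (e k) => //=; rewrite mule0.
Qed.

Context d (X : measurableType d) (m : {measure set X -> \bar R}).

Let G (F : T -> set X) (e : nat -> option T) k := oapp F set0 (e k).

Let bigcupG F e : enumerates A e -> \bigcup_(i in A) F i = \bigcup_k G F e k.
Proof.
move=> [e1 e2 _]; apply/seteqP; split=> x.
  by move=> [i /e2[k ek] Fx]; exists k => //; rewrite /G ek.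
by move=> [k _]; rewrite /G; case E : (e k) => [i|] //= Fx; exists i => //; exact: e1 E.
Qed.

Let measurableG F e : enumerates A e -> (forall i, A i -> measurable (F i)) ->
  forall k, measurable (G F e k).
Proof. by move=> [e1 _ _] mF k; rewrite /G; case E : (e k) => [i|] //=; apply: mF; exact: e1 E. Qed.

Let trivG F e : enumerates A e -> trivIset A F -> trivIset setT (G F e).
Proof.
move=> [e1 e2 e3] tF k l _ _ [x]; rewrite /G.
case E : (e k) => [i|] [] //=; case E' : (e l) => [j|] //= Fi Fj.
have ij : i = j by apply: tF; [exact: e1 E|exact: e1 E'|exists x].
by apply: (e3 _ _ i) => //; rewrite E' ij.
Qed.

Lemma countable_bigcup_measurable (F : T -> set X) : countable A ->
  (forall i, A i -> measurable (F i)) -> measurable (\bigcup_(i in A) F i).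
Proof.
move=> /countable_enum[e eA] mF; rewrite (bigcupG _ eA).
exact/bigcupT_measurable/measurableG.
Qed.

Lemma measure_countable_bigcup (F : T -> set X) : countable A ->
  (forall i, A i -> measurable (F i)) -> trivIset A F ->
  m (\bigcup_(i in A) F i) = \esum_(i in A) m (F i).
Proof.
move=> /countable_enum[e eA] mF tF; rewrite (bigcupG _ eA) (esum_enum eA)//.
rewrite measure_bigcup//; [|by move=> ? _; exact: measurableG|exact: trivG].
rewrite [RHS](@eq_eseriesl _ _ (fun k => k \in [set: nat])) //; last first.
  by move=> k; rewrite in_setT.
apply: eq_eseriesr => k _; rewrite /G.
by case: (e k) => //=; rewrite measure0.
Qed.

Lemma measure_countable_le (F : T -> set X) : countable A ->
  (forall i, A i -> measurable (F i)) ->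
  m (\bigcup_(i in A) F i) <= \esum_(i in A) m (F i).
Proof.
move=> /countable_enum[e eA] mF; rewrite (bigcupG _ eA) (esum_enum eA)//.
apply: le_trans (measure_sigma_subadditive m (measurableG eA mF) _ _) _ => //.
  exact/bigcupT_measurable/measurableG.
apply: lee_nneseries => [//|k _]; rewrite /G.
by case: (e k) => //=; rewrite measure0.
Qed.

Lemma ge0_integral_countable_bigcup (F : T -> set X) (f : X -> \bar R) :
  countable A -> (forall i, A i -> measurable (F i)) -> trivIset A F ->
  measurable_fun (\bigcup_(i in A) F i) f ->
  (forall x, (\bigcup_(i in A) F i) x -> 0 <= f x) ->
  \int[m]_(x in \bigcup_(i in A) F i) f x =
  \esum_(i in A) \int[m]_(x in F i) f x.
Proof.
move=> /countable_enum[e eA] mF tF; rewrite (bigcupG _ eA) => mf f0.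
rewrite (esum_enum eA); last first.
  move=> i Ai; apply: integral_ge0 => x Fx; apply: f0.
  by case: eA => _ /(_ _ Ai)[k ek] _; exists k => //; rewrite /G ek.
rewrite ge0_integral_bigcup//; [|exact: measurableG|exact: trivG].
apply: eq_eseriesr => k _; rewrite /G.
by case: (e k) => //=; rewrite integral_set0.
Qed.

Lemma abse_integral_countable_bigcup (F : T -> set X) (f : X -> \bar R) :
  countable A -> (forall i, A i -> measurable (F i)) -> trivIset A F ->
  m.-integrable (\bigcup_(i in A) F i) f ->
  `|\int[m]_(x in \bigcup_(i in A) F i) f x| <=
  \esum_(i in A) `|\int[m]_(x in F i) f x|.
Proof.
move=> /countable_enum[e eA] mF tF; rewrite (bigcupG _ eA) => mf.
rewrite integral_bigcup//; [|exact: trivG|exact: measurableG].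
rewrite (esum_enum eA); last by move=> *; exact: abse_ge0.
have smf := integrable_summable (trivG eA tF) (measurableG eA mF) mf.
have -> : \sum_(0 <= k <oo) oapp (fun i => `|\int[m]_(x in F i) f x|) 0 (e k) =
   \sum_(0 <= k <oo) `|\int[m]_(x in G F e k) f x|.
  apply: eq_eseriesr => k _; rewrite /G.
  by case: (e k) => //=; rewrite integral_set0 abse0.
have smf' : summable (fun k : nat => xpredT k)
    (fun k => \int[m]_(x in G F e k) f x).
  by move: smf; congr (is_true (summable _ _)); apply/seteqP; split.
rewrite (summable_eseries smf') (le_trans (lee_abs_sub _ _))//.
rewrite !gee0_abs; try by apply: nneseries_ge0 => k _ _.
rewrite -nneseriesD//; apply: lee_nneseries => k _ //.
  by rewrite adde_ge0.
by have /(congr1 (fun h => h k)) /= -> := fune_abse (fun k => \int[m]_(x in G F e k) f x).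
Qed.

Lemma ge0_integral_esum (D : set X) (f : T -> X -> \bar R) :
  countable A -> measurable D -> (forall i, A i -> measurable_fun D (f i)) ->
  (forall i x, A i -> 0 <= f i x) ->
  measurable_fun D (fun x => \esum_(i in A) f i x) /\
  \int[m]_(x in D) (\esum_(i in A) f i x) =
  \esum_(i in A) \int[m]_(x in D) f i x.
Proof.
move=> /countable_enum[e eA] mD mf f0.
have [e1 e2 e3] := eA.
have fE x : \esum_(i in A) f i x = \sum_(0 <= k <oo) oapp (f ^~ x) 0 (e k).
  by apply: esum_enum => // i Ai; exact: f0.
have f0' k x : 0 <= oapp (f ^~ x) 0 (e k).
  by case E : (e k) => [i|] //=; apply: f0; exact: e1 E.
have mf' k : measurable_fun D (fun x => oapp (f ^~ x) 0 (e k)).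
  by case E : (e k) => [i|] //=; apply: mf; exact: e1 E.
split.
  under eq_fun do rewrite fE.
  exact: ge0_emeasurable_sum.
under eq_integral do rewrite fE.
rewrite integral_nneseries// (esum_enum eA); last first.
  by move=> i Ai; apply: integral_ge0 => x _; exact: f0.
apply: eq_eseriesr => k _.
case: (e k) => //=; exact: integral0.
Qed.

End countable_families.

Lemma measurable_fun_countable_bigcup (T : choiceType) (A : set T)
    d d' (X : measurableType d) (Y : measurableType d') (F : T -> set X)
    (f : X -> Y) : countable A -> (forall i, A i -> measurable (F i)) ->
  (forall i, A i -> measurable_fun (F i) f) ->
  measurable_fun (\bigcup_(i in A) F i) f.
Proof.
move=> cA mF mf mU Y0 mY0.
rewrite setI_bigcupl; apply: countable_bigcup_measurable => // i Ai.
by apply: mf => //; exact: mF.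
Qed.

Section integral_tools.
Local Open Scope ereal_scope.
Context (R : realType).

(** The integral of a nonnegative function is a supremum over the simple
functions below it, hence monotone even for functions that are not
measurable. *)
Lemma ge0_le_integralW d (X : measurableType d) (m : {measure set X -> \bar R})
    (f g : X -> \bar R) :
  (forall x, 0 <= f x) -> (forall x, f x <= g x) ->
  \int[m]_x f x <= \int[m]_x g x.
Proof.
move=> f0 fg; have g0 x : 0 <= g x by exact: le_trans (fg x).
rewrite !ge0_integralTE//; apply: ereal_sup_le => _ [h hf <-].
by exists h => //= x; exact: le_trans (fg x).
Qed.

Lemma nneseries_le (a : nat -> \bar R) (M : \bar R) :
  (forall k, 0 <= a k) -> (forall N, \sum_(0 <= k < N) a k <= M) ->
  \sum_(0 <= k <oo) a k <= M.
Proof.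
move=> a0 aM; apply: lime_le; first exact: is_cvg_nneseries.
exact: nearW.
Qed.

Lemma nneseries_geometric_le (a q : R) : (0 <= a)%R -> (0 < q < 1)%R ->
  \sum_(0 <= k <oo) (a * q ^+ k)%:E <= (a / (1 - q))%:E.
Proof.
move=> a0 /andP[q0 q1]; apply: nneseries_le.
  by move=> k; rewrite lee_fin mulr_ge0// exprn_ge0// ltW.
move=> N; rewrite sumEFin lee_fin.
have q1' : (`|q| < 1)%R by rewrite gtr0_norm.
exact: (@geometric_le_lim R N a q a0 q0 q1').
Qed.

Lemma nneseries_ge_term (a : nat -> \bar R) k :
  (forall k, 0 <= a k) -> a k <= \sum_(0 <= k <oo) a k.
Proof.
move=> a0; apply: le_trans (nneseries_lim_ge k.+1 _) => //.
by rewrite big_nat_recr//= leeDr// sume_ge0.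
Qed.

End integral_tools.

(** * Lebesgue measure of cubes, and measurability of open sets *)

Section boxes.
Context (R : realType).

Definition coordset n (A : 'I_n -> set R) : set (Rn R n) :=
  [set x | forall i, A i (tnth x i)].

Lemma measurable_coordset n (A : 'I_n -> set R) :
  (forall i, measurable (A i : set (measurableTypeR R))) ->
  measurable (coordset A).
Proof.
move=> mA.
have -> : coordset A =
    \bigcap_(i in [set: 'I_n]) ((fun x : Rn R n => tnth x i) @^-1` A i).
  by apply/seteqP; split=> [x xA i _|x xA i]; [exact: xA|exact: (xA i I)].
apply: fin_bigcap_measurable => // i _.
by rewrite -[X in measurable X]setTI; exact: measurable_tnth.
Qed.

Lemma lebesgue_coordset n (A : 'I_n -> set R) (r : R) :
  (forall i, measurable (A i : set (measurableTypeR R))) ->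
  (forall i, lebesgue_measure (A i) = r%:E) ->
  lebesgue_Rn R n (coordset A) = (r ^+ n)%:E.
Proof.
elim: n A => [|n IH] A mA Ar /=.
  rewrite diracE expr0 mem_set//; by move=> [].
rewrite /cons_measure /pushforward.
have -> : @cons_Rn R n @^-1` coordset A =
    A ord0 `*` coordset (fun i => A (lift ord0 i)).
  apply/seteqP; split=> -[t x] /=.
    move=> H; split; first by have := H ord0; rewrite (tnth_nth t).
    by move=> i; have := H (lift ord0 i); rewrite !(tnth_nth t).
  move=> [tA xA] i; case: (unliftP ord0 i) => [j ->|->].
    by have := xA j; rewrite !(tnth_nth t).
  by rewrite (tnth_nth t).
rewrite product_measure1E; [|exact: mA|by apply: measurable_coordset].
rewrite exprS EFinM; congr (_ * _)%E; first exact: Ar.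
by apply: IH => i; [exact: mA|exact: Ar].
Qed.

End boxes.

Section cubes.
Context (R : realType) (n : nat).
Implicit Types (Q P : cube R n) (x y z c : Rn R n).
Local Notation mu := (lebesgue_Rn R n).
Local Notation nu := (lebesgue_R1n R n).

Definition open_cube (c : Rn R n) (r : R) : set (Rn R n) :=
  [set x | forall i, `|tnth x i - tnth c i : R| < r].

Lemma side_gt0 Q : 0 < side Q. Proof. by rewrite /side. Qed.

Lemma measurable_cube Q : measurable (cube_set Q).
Proof.
apply: (@measurable_coordset R n
  (fun i => `[tnth Q.1 i - side Q / 2, tnth Q.1 i + side Q / 2[%classic)).
by move=> i; exact: measurable_itv.
Qed.

Lemma lebesgue_cube Q : mu (cube_set Q) = (side Q ^+ n)%:E.
Proof.
have := side_gt0 Q; set l := side Q => l0.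
apply: (@lebesgue_coordset R n
  (fun i => `[(tnth Q.1 i : R) - l / 2, (tnth Q.1 i : R) + l / 2[%classic)).
  by move=> i; exact: measurable_itv.
move=> i; rewrite lebesgue_measure_itv /= lte_fin ifT; last by lra.
by rewrite -EFinB; congr EFin; lra.
Qed.

Lemma cube_volumeE Q : cube_volume Q = side Q ^+ n.
Proof. by rewrite /cube_volume lebesgue_cube. Qed.

Lemma measurable_open_cube c r : measurable (open_cube c r).
Proof.
have -> : open_cube c r = coordset
    (fun i => `](tnth c i : R) - r, (tnth c i : R) + r[%classic).
  by apply/seteqP; split=> x xc i; have := xc i; rewrite /= in_itv /= ltr_distl.
by apply: measurable_coordset => i; exact: measurable_itv.
Qed.

Lemma lebesgue_open_cube c r : 0 < r -> mu (open_cube c r) = ((2 * r) ^+ n)%:E.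
Proof.
move=> r0.
have -> : open_cube c r = coordset
    (fun i => `](tnth c i : R) - r, (tnth c i : R) + r[%classic).
  by apply/seteqP; split=> x xc i; have := xc i; rewrite /= in_itv /= ltr_distl.
apply: lebesgue_coordset => i; first exact: measurable_itv.
rewrite lebesgue_measure_itv /= lte_fin ifT; last by lra.
by rewrite -EFinB; congr EFin; lra.
Qed.

Definition open_Rn (U : set (Rn R n)) :=
  forall x, U x -> exists2 r, 0 < r & open_cube x r `<=` U.

Lemma open_open_cube c r : open_Rn (open_cube c r).
Proof.
move=> x xc.
have : exists2 e, 0 < e & forall i, `|tnth x i - tnth c i : R| + e <= r.
  pose g i := r - `|tnth x i - tnth c i : R|.
  exists (\big[Num.min/1]_(i < n) g i).
    by apply: lt_bigmin => // i _; rewrite subr_gt0; exact: xc.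
  move=> i; rewrite -lerBrDl; exact: bigmin_le_cond.
move=> [e e0 xe]; exists e => // y yx i.
have := yx i; have := xe i => h1 h2.
have -> : (tnth y i : R) - tnth c i =
  ((tnth y i : R) - tnth x i) + ((tnth x i : R) - tnth c i) by lra.
by rewrite (le_lt_trans (ler_normD _ _))// (lt_le_trans _ h1)// addrC ltrD2l.
Qed.

Lemma open_bigcup I (A : set I) (F : I -> set (Rn R n)) :
  (forall i, A i -> open_Rn (F i)) -> open_Rn (\bigcup_(i in A) F i).
Proof.
move=> oF x [i Ai Fx]; have [r r0 rF] := oF i Ai x Fx.
by exists r => // y /rF Fy; exists i.
Qed.

Lemma open_setU U V : open_Rn U -> open_Rn V -> open_Rn (U `|` V).
Proof.
move=> oU oV x [/oU|/oV] [r r0 rU]; exists r => // y /rU; by [left|right].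
Qed.

Definition open_R1n (U : set (R1n R n)) :=
  forall p, U p -> exists2 r, 0 < r &
    forall q, `|q.1 - p.1 : R| < r -> open_cube p.2 r q.2 -> U q.

(** An open set is the union of the countably many rational boxes it
contains. *)
Lemma measurable_open_R1n U : open_R1n U -> measurable U.
Proof.
move=> oU.
pose c (b : rat * n.-tuple rat * rat) : R1n R n :=
  (ratr b.1.1, [tuple ratr (tnth b.1.2 i) | i < n]).
pose B (b : rat * n.-tuple rat * rat) : set (R1n R n) :=
  (`](c b).1 - ratr b.2, (c b).1 + ratr b.2[%classic) `*`
  open_cube (c b).2 (ratr b.2).
have -> : U = \bigcup_(b in [set b | B b `<=` U]) B b.
  apply/seteqP; split; last by move=> p [b bU bp]; exact: bU.
  move=> p /oU[r r0 rU].
  have [e] : exists e : rat, ratr e \in `]0, r / 2[.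
    by apply: rat_in_itvoo; rewrite divr_gt0.
  rewrite in_itv /= => /andP[e0 er].
  have ap (a : R) : exists q : rat, `|a - ratr q : R| < ratr e.
    have [q] : exists q : rat, ratr q \in `]a - ratr e, a + ratr e[.
      by apply: rat_in_itvoo; lra.
    by rewrite in_itv /= => H; exists q; rewrite distrC ltr_distl.
  have [q0 q0p] := ap p.1.
  have [q1 q1p] := choice (fun i : 'I_n => ap (tnth p.2 i)).
  exists (q0, [tuple q1 i | i < n], e) => /=.
    move=> [s x] [/=]; rewrite in_itv /= => sq xq; apply: rU => /=.
      have : `|s - ratr q0 : R| < ratr e by rewrite ltr_distl.
      have -> : s - p.1 = (s - ratr q0) - (p.1 - ratr q0) by lra.
      move=> h; rewrite (le_lt_trans (ler_normB _ _))//; lra.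
    move=> i; have := xq i; rewrite !tnth_mktuple => h.
    have h' := q1p i.
    have -> : (tnth x i : R) - tnth p.2 i =
      ((tnth x i : R) - ratr (q1 i)) - ((tnth p.2 i : R) - ratr (q1 i)) by lra.
    rewrite (le_lt_trans (ler_normB _ _))//; lra.
  split=> /=; first by rewrite in_itv /= -ltr_distl.
  by move=> i; rewrite !tnth_mktuple; exact: q1p.
apply: countable_bigcup_measurable.
  exact: countableP.
move=> b _; apply: measurableX; first exact: measurable_itv.
exact: measurable_open_cube.
Qed.

Lemma measurable_open_Rn U : open_Rn U -> measurable U.
Proof.
move=> oU.
have mU : measurable ([set p | U p.2] : set (R1n R n)).
  apply: measurable_open_R1n => p /oU[r r0 rU]; exists r => // q _; exact: rU.
have := @pair1_measurable _ _ (measurableTypeR R) (Rn R n) (0 : R).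
by move=> /(_ measurableT _ mU); rewrite setTI.
Qed.

End cubes.

(** * Dyadic systems *)

Lemma dyadic_scale (R : realType) (l : R) : 0 < l ->
  exists j : int, l <= 2 ^ (- j) < 2 * l.
Proof.
move=> l0.
have [N HN] : exists N : nat, (2 : R) ^- N < l.
  exists (Num.Def.archi_bound l^-1); rewrite invf_plt ?posrE ?exprn_gt0//.
  exact: upper_nthrootP.
have ex : exists m : nat, l <= 2 ^- N * 2 ^+ m.
  exists (Num.Def.archi_bound (l * 2 ^+ N)).
  rewrite -ler_pdivrMl ?invr_gt0 ?exprn_gt0// invrK mulrC.
  exact/ltW/upper_nthrootP.
case: (ex_minnP ex) => m lm mmin.
have pw k : (2 : R) ^- N * 2 ^+ k = 2 ^ (- (N%:Z - k%:Z)).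
  by rewrite opprB addrC expfzDr ?pnatr_eq0// -exprnN.
exists (N%:Z - m%:Z); rewrite -pw lm /=.
case: m lm mmin => [|m] lm mmin.
  by rewrite expr0 mulr1; lra.
rewrite exprS mulrCA ltr_pM2l// ltNge; apply/negP => /mmin.
by rewrite ltnn.
Qed.

Section cube_geometry.
Context (R : realType) (n : nat) (n_gt0 : (0 < n)%N).
Implicit Types (P Q : cube R n).
Local Notation mu := (lebesgue_Rn R n).

Lemma cube_center Q : cube_set Q Q.1.
Proof. by move=> i; have := side_gt0 Q; lra. Qed.

Lemma cube_set_side P Q : cube_set P `<=` cube_set Q -> side P <= side Q.
Proof.
move=> PQ; rewrite -(@ler_pXn2r _ n)// ?nnegrE ?(ltW (side_gt0 _))//.
rewrite -lee_fin -!lebesgue_cube; apply: le_measure => //;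
  by rewrite inE; exact: measurable_cube.
Qed.

Lemma cube_dist P x y i : cube_set P x -> cube_set P y ->
  `|tnth x i - tnth y i : R| < side P.
Proof.
move=> /(_ i) Px /(_ i) Py; rewrite ltr_norml; lra.
Qed.

End cube_geometry.

Section dyadic.
Context (R : realType) (n : nat) (n_gt0 : (0 < n)%N).
Context (D : int -> set (cube R n)) (HD : dyadic_system D).
Implicit Types (P Q : cube R n) (x : Rn R n) (i j : int) (m : nat).
Local Notation mu := (lebesgue_Rn R n).
Local Notation dy := (dyadic_cubes D).

Lemma dyadic_cover j x : exists2 Q, D j Q & cube_set Q x.
Proof. by have [Q [[DQ Qx] _]] := dyadic_partition HD j x; exists Q. Qed.

Lemma dyadic_unique j P Q x :
  D j P -> D j Q -> cube_set P x -> cube_set Q x -> P = Q.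
Proof.
move=> DP DQ Px Qx; have [T [_ TU]] := dyadic_partition HD j x.
by rewrite -(TU P)// -(TU Q).
Qed.

Lemma dyadic_ancestor j Q m : D j Q ->
  exists2 P, D (j - m%:Z) P & cube_set Q `<=` cube_set P.
Proof.
elim: m => [|m IH] DQ; first by exists Q; rewrite ?subr0.
have [P DP QP] := IH DQ.
have jm : j - m%:Z = j - m.+1%:Z + 1 by lia.
rewrite jm in DP; have [T DT PT] := dyadic_parent HD DP.
by exists T => // x /QP /PT.
Qed.

(** The ancestor of Q in the generation of P meets P, so it is P. *)
Lemma dyadic_nested i j P Q : D i P -> D j Q -> i <= j ->
  cube_set P `&` cube_set Q !=set0 -> cube_set Q `<=` cube_set P.
Proof.
move=> DP DQ ij [x [Px Qx]].
have [T] := dyadic_ancestor `|j - i|%N DQ.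
have -> : j - `|j - i|%:Z = i by lia.
move=> DT QT; suff -> : P = T by [].
by apply: (dyadic_unique DP DT Px); exact: QT.
Qed.

Lemma dyadic_side_le i j P Q : D i P -> D j Q -> (side Q <= side P) = (i <= j).
Proof.
move=> DP DQ; rewrite (dyadic_side HD DP) (dyadic_side HD DQ).
by rewrite ler_eXz2l ?lerN2// ltr1n.
Qed.

Lemma dyadic_eq P Q : dy P -> dy Q -> cube_set P = cube_set Q -> P = Q.
Proof.
move=> [i _ DP] [j _ DQ] PQ.
have ij : i = j.
  apply/eqP; rewrite eq_le -(dyadic_side_le DP DQ) -(dyadic_side_le DQ DP).
  by rewrite !cube_set_side// PQ.
rewrite ij in DP; apply: (dyadic_unique DP DQ (cube_center P)).
by rewrite -PQ; exact: cube_center.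
Qed.

Lemma dyadic_nestedW P Q : dy P -> dy Q -> cube_set P `&` cube_set Q !=set0 ->
  cube_set Q `<=` cube_set P \/ cube_set P `<=` cube_set Q.
Proof.
move=> [i _ DP] [j _ DQ] PQ; have [ij|ij] := leP i j.
  by left; exact: dyadic_nested DP DQ ij PQ.
by right; rewrite setIC in PQ; exact: dyadic_nested DQ DP (ltW ij) PQ.
Qed.

Lemma dyadic_proper_side P Q : dy P -> dy Q ->
  cube_set Q `<=` cube_set P -> Q <> P -> 2 * side Q <= side P.
Proof.
move=> [i _ DP] [j _ DQ] QP nQP.
have := cube_set_side n_gt0 QP; rewrite (dyadic_side_le DP DQ) => ij.
have [ij'|ij'] := eqVneq i j.
  subst j; exfalso; apply: nQP; apply: (dyadic_unique DQ DP (cube_center Q)).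
  by apply: QP; exact: cube_center.
have {}ij : i < j by rewrite lt_neqAle ij'.
have [T DT QT] := dyadic_ancestor 1 DQ.
have -> : 2 * side Q = side T.
  by rewrite (dyadic_side HD DQ) (dyadic_side HD DT) opprB expfzDr ?pnatr_eq0//.
by rewrite (dyadic_side_le DP DT); lia.
Qed.

Lemma countable_dyadic : countable dy.
Proof.
apply: bigcup_countable; first exact: countableP.
move=> j _; apply/countable_injP.
have ap P : exists q : n.-tuple rat, cube_set P [tuple ratr (tnth q i) | i < n].
  have H (i : 'I_n) : exists q : rat, ratr q \in
      `](tnth P.1 i : R) - side P / 2, (tnth P.1 i : R) + side P / 2[.
    by apply: rat_in_itvoo; have := side_gt0 P; lra.
  have [q qP] := choice H; exists [tuple q i | i < n] => i.
  rewrite !tnth_mktuple; have := qP i; rewrite in_itv /=.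
  by move=> /andP[/ltW -> ->].
have [q qP] := choice ap.
exists (fun P => pickle (q P)) => P Q /set_mem DP /set_mem DQ.
move=> /(pcan_inj pickleK) qq.
by apply: (dyadic_unique DP DQ (qP P)); rewrite qq; exact: qP.
Qed.

Lemma dyadic_small j0 U x : open_Rn U -> U x ->
  exists j P, [/\ j0 <= j, D j P, cube_set P x & cube_set P `<=` U].
Proof.
move=> oU /oU[r r0 rU].
have [j1 /andP[_ j1r]] := @dyadic_scale R (r / 2) (divr_gt0 r0 (ltr0Sn _ _)).
pose j := Num.max j0 j1.
have [P DP Px] := dyadic_cover j x.
exists j, P; split => //; first by rewrite le_max lexx.
move=> y Py; apply: rU => i; rewrite (lt_trans (cube_dist i Py Px))//.
rewrite (dyadic_side HD DP); apply: (@le_lt_trans _ _ (2 ^ (- j1))); last by lra.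
by rewrite ler_weXz2l ?ler1n// lerN2 le_max lexx orbT.
Qed.

(** Among dyadic cubes this is maximality for inclusion, because two of them
are nested as soon as they meet; in this form the maximal cubes are visibly
disjoint. *)
Definition maximal_cube (B : set (cube R n)) P :=
  B P /\ forall Q, B Q -> cube_set P `&` cube_set Q !=set0 ->
    cube_set Q `<=` cube_set P.

(** A bound on the sides leaves finitely many generations above a given cube,
so its largest ancestor in the family exists. *)
Lemma maximal_cube_exists (B : set (cube R n)) M : B `<=` dy ->
  (forall P, B P -> side P <= M) -> forall P, B P ->
  exists2 Q, maximal_cube B Q & cube_set P `<=` cube_set Q.
Proof.
move=> Bdy BM P BP; have [j _ DP] := Bdy P BP.
pose p (m : nat) := `[< exists Q, [/\ B Q, D (j - m%:Z) Q
  & cube_set P `<=` cube_set Q] >].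
have p0 : exists m, p m by exists 0%N; apply/asboolP; exists P; split; rewrite ?subr0.
have pM m : p m -> (m <= Num.Def.archi_bound (M / side P))%N.
  move=> /asboolP[Q [BQ DQ PQ]].
  rewrite leqNgt; apply/negP => /ltnW /upper_nthrootP.
  rewrite ltNge => /negP; apply; rewrite ler_pdivlMr ?side_gt0//.
  have := BM Q BQ.
  by rewrite (dyadic_side HD DP) (dyadic_side HD DQ) opprB expfzDr ?pnatr_eq0.
case: (ex_maxnP p0 pM) => m /asboolP[Q [BQ DQ PQ]] mmax.
exists Q => //; split => // T BT QT; have [i _ DT] := Bdy T BT.
have [ij|ij] := leP (j - m%:Z) i; first exact: dyadic_nested DQ DT ij QT.
exfalso.
have QT' : cube_set Q `<=` cube_set T.
  by rewrite setIC in QT; exact: dyadic_nested DT DQ (ltW ij) QT.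
have : p `|j - i|%N.
  apply/asboolP; exists T; split => //; last by move=> x /PQ /QT'.
  by have -> : j - `|j - i|%:Z = i by lia.
by move=> /mmax; lia.
Qed.

Lemma maximal_cube_inj (B : set (cube R n)) P Q : B `<=` dy ->
  maximal_cube B P -> maximal_cube B Q ->
  cube_set P `&` cube_set Q !=set0 -> P = Q.
Proof.
move=> Bdy [BP mP] [BQ mQ] PQ; apply: dyadic_eq; [exact: Bdy|exact: Bdy|].
apply/seteqP; split; last exact: mP.
by apply: mQ => //; rewrite setIC.
Qed.

Lemma trivIset_maximal_cube (B : set (cube R n)) : B `<=` dy ->
  trivIset (maximal_cube B) (@cube_set R n).
Proof. by move=> Bdy P Q mP mQ; exact: (maximal_cube_inj Bdy). Qed.

Lemma countable_maximal_cube (B : set (cube R n)) : B `<=` dy ->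
  countable (maximal_cube B).
Proof.
move=> Bdy; apply: (@sub_countable _ _ _ dy); last exact: countable_dyadic.
by apply: subset_card_le => P [BP _]; exact: Bdy.
Qed.

(** The corners of a box decide whether a cube contains it, so two of the
ancestors of a fixed cube suffice to swallow a bounded set. *)
Lemma dyadic_contains_box (M : R) : exists j0 : int, forall j, j <= j0 ->
  exists2 Q, D j Q & forall x, (forall i : 'I_n, `|tnth x i : R| <= M) -> cube_set Q x.
Proof.
pose a (r : R) : Rn R n := [tuple r | _ < n].
have [P1 D1 P1a] := dyadic_cover 0 (a (- M)).
have [P2 D2 P2a] := dyadic_cover 0 (a M).
have [l [T [DT P1T P2T]]] := dyadic_connected HD D1 D2.
exists l => j jl.
have [Q DQ TQ] := dyadic_ancestor `|l - j|%N DT.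
have {}DQ : D j Q by move: DQ; have -> : l - `|l - j|%:Z = j by lia.
exists Q => // x xM i.
have := TQ _ (P1T _ P1a) i; have := TQ _ (P2T _ P2a) i.
rewrite !tnth_mktuple => /andP[_ h1] /andP[h2 _].
have := xM i; rewrite ler_norml => /andP[h3 h4].
by rewrite (le_trans h2 h3) (le_lt_trans h4 h1).
Qed.

End dyadic.

(** * The Carleson functional *)

Section carleson_functional.
Context (R : realType) (n : nat) (n_gt0 : (0 < n)%N).
Implicit Types (P Q : cube R n) (x y z : Rn R n) (f : R1n R n -> R).
Local Notation mu := (lebesgue_Rn R n).
Local Notation nu := (lebesgue_R1n R n).
Local Notation H := (@halfspace R n).

Lemma measurable_halfspace : measurable H.
Proof.
have -> : H = `]0%R, +oo[%classic `*` setT.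
  by apply/seteqP; split=> -[t x] /=; rewrite in_itv /= andbT // => -[].
by apply: measurableX => //; exact: measurable_itv.
Qed.

Lemma measurable_carleson_box Q : measurable (carleson_box Q).
Proof.
have -> : carleson_box Q = `]0%R, side Q[%classic `*` cube_set Q.
  by apply/seteqP; split=> -[t x] /=; rewrite in_itv.
apply: measurableX; first exact: measurable_itv.
exact: measurable_cube.
Qed.

Lemma carleson_box_halfspace Q : carleson_box Q `<=` H.
Proof. by move=> p [/andP[]]. Qed.

Lemma carleson_boxS P Q : cube_set P `<=` cube_set Q ->
  carleson_box P `<=` carleson_box Q.
Proof.
move=> PQ p [/andP[p0 pP] Pp]; split; last exact: PQ.
by rewrite p0 (lt_le_trans pP)// cube_set_side.
Qed.

Definition mass f (A : set (R1n R n)) : \bar R :=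
  (\int[nu]_(p in A) `|f p|%:E)%E.

Local Open Scope ereal_scope.

Lemma mass_ge0 f A : 0 <= mass f A.
Proof. by apply: integral_ge0 => p _; rewrite lee_fin. Qed.

Lemma measurable_normE f A : measurable A -> A `<=` H -> measurable_fun H f ->
  measurable_fun A (fun p => `|f p|%:E).
Proof.
move=> mA AH mf; apply/measurable_EFinP.
apply: measurableT_comp => //.
by apply: measurable_funS mf => //; exact: measurable_halfspace.
Qed.

Lemma le_mass f A B : measurable A -> measurable B -> B `<=` H ->
  measurable_fun H f -> A `<=` B -> mass f A <= mass f B.
Proof.
move=> mA mB BH mf AB; apply: ge0_subset_integral => //.
exact: measurable_normE.
Qed.

Lemma mass_countable_bigcup (T : choiceType) (I : set T) (F : T -> set (R1n R n))
    f : countable I -> (forall i, I i -> measurable (F i)) ->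
  (forall i, I i -> F i `<=` H) -> trivIset I F -> measurable_fun H f ->
  mass f (\bigcup_(i in I) F i) = \esum_(i in I) mass f (F i).
Proof.
move=> cI mF FH tF mf; apply: ge0_integral_countable_bigcup => //.
apply: measurable_normE => //.
- exact: countable_bigcup_measurable.
- by move=> p [i Ii]; exact: FH.
Qed.

Lemma trivIset_carleson_box (I : set (cube R n)) :
  trivIset I (@cube_set R n) -> trivIset I (@carleson_box R n).
Proof.
by move=> tI P Q IP IQ [p [[_ Pp] [_ Qp]]]; apply: tI => //; exists p.2.
Qed.

Lemma carleson_ge0 f z : 0 <= carleson f z.
Proof.
have [Q Qz] : exists Q, cube_set Q z.
  by exists (z, 1%:pos%R); exact: (@cube_center R n (z, 1%:pos%R)).
apply: le_trans (ereal_sup_ubound _); last by exists Q.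
rewrite mule_ge0 ?mass_ge0// lee_fin invr_ge0 cube_volumeE.
by rewrite exprn_ge0// ltW// side_gt0.
Qed.

Lemma mass_le_carleson f Q z : cube_set Q z ->
  mass f (carleson_box Q) <= (side Q ^+ n)%:E * carleson f z.
Proof.
move=> Qz; have s0 : (0 < side Q ^+ n)%R by rewrite exprn_gt0// side_gt0.
rewrite muleC -lee_pdivrMr// muleC.
apply: ereal_sup_ubound; exists Q => //.
by rewrite /box_mean cube_volumeE.
Qed.

Section dyadic_test.
Context (D : int -> set (cube R n)) (HD : dyadic_system D).
Local Notation dy := (dyadic_cubes D).

(** A cube of side l that contains z is covered by the dyadic cubes meeting it
whose side lies in [l, 2l); these contain z in their threefold dilates and
fit into a concentric cube of side 5l. *)
Lemma carleson_le f z (s : R) : measurable_fun H f -> (0 <= s)%R ->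
  (forall P, dy P -> cube_set (dilate 3%:pos%R P) z ->
    mass f (carleson_box P) <= (s * side P ^+ n)%:E) ->
  carleson f z <= (5 ^+ n * s)%:E.
Proof.
move=> mf s0 fs; apply: ge_ereal_sup => _ [Q Qz <-].
have lQ := side_gt0 Q; rewrite /box_mean cube_volumeE.
rewrite muleC lee_pdivrMr ?exprn_gt0//.
have [j /andP[lj jl]] := dyadic_scale lQ.
pose I := [set P | D j P /\ cube_set P `&` cube_set Q !=set0].
have sI P : I P -> side P = (2 ^ (- j))%R by move=> [DP _]; exact: (dyadic_side HD DP).
have Idy : I `<=` dy by move=> P [DP _]; exists j.
have cI : countable I.
  by apply: sub_countable (countable_dyadic HD); exact: subset_card_le.
have tI : trivIset I (@cube_set R n).
  by move=> P P' [DP _] [DP' _] [x [Px P'x]]; exact: (dyadic_unique HD DP DP' Px).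
apply: (@le_trans _ _ (mass f (\bigcup_(P in I) carleson_box P))).
  apply: le_mass => //.
  - exact: measurable_carleson_box.
  - apply: countable_bigcup_measurable => // P _.
    exact: measurable_carleson_box.
  - by move=> p [P _]; exact: carleson_box_halfspace.
  - move=> p [/andP[p0 pQ] Qp]; have [P DP Pp] := dyadic_cover HD j p.2.
    have IP : I P by split => //; exists p.2.
    by exists P => //; split => //; rewrite p0 (sI P IP) (lt_le_trans pQ).
rewrite mass_countable_bigcup//; last 3 first.
- by move=> P _; exact: measurable_carleson_box.
- by move=> P _; exact: carleson_box_halfspace.
- exact: trivIset_carleson_box.
have near_z P : I P -> cube_set (dilate 3%:pos%R P) z.
  move=> IP; have [_ [w [Pw Qw]]] := IP => i.
  have := Pw i; have := Qw i; have := Qz i; rewrite /= (sI P IP).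
  have -> : side (dilate 3%:pos%R P) = (3 * (2 ^ (- j)))%R.
    by rewrite -(sI P)//.
  move=> /andP[h1 h2] /andP[h3 h4] /andP[h5 h6]; apply/andP; split; lra.
apply: (@le_trans _ _ (\esum_(P in I) (s%:E * mu (cube_set P)))).
  apply: le_esum => P IP; rewrite lebesgue_cube -EFinM.
  by apply: fs; [exact: Idy|exact: near_z].
rewrite esumZl// -measure_countable_bigcup//; last first.
  by move=> P _; exact: measurable_cube.
rewrite -EFinM mulrAC -exprMn mulrC EFinM lee_wpmul2l ?lee_fin//.
have -> : (5 * side Q = 2 * (5 / 2 * side Q))%R by lra.
rewrite -(@lebesgue_open_cube _ _ Q.1) ?mulr_gt0//.
apply: le_measure; rewrite ?inE.
- apply: countable_bigcup_measurable => // P _; exact: measurable_cube.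
- exact: measurable_open_cube.
- move=> x [P IP Px] i; have [_ [w [Pw Qw]]] := IP.
  have := cube_dist i Px Pw; have := Qw i; rewrite (sI P IP).
  rewrite !ltr_norml => /andP[h1 h2] /andP[h3 h4].
  apply/andP; split; lra.
Qed.

Definition heavy_cubes f (s : R) : set (cube R n) :=
  [set P | dy P /\ (s * side P ^+ n)%:E < mass f (carleson_box P)].

(** The open fourfold dilates of the heavy cubes: they contain the threefold
dilates, where the dyadic test for the Carleson functional fails. *)
Definition heavy_set f s : set (Rn R n) :=
  \bigcup_(P in heavy_cubes f s) open_cube P.1 (2 * side P).

Lemma open_heavy_set f s : open_Rn (heavy_set f s).
Proof. by apply: open_bigcup => P _; exact: open_open_cube. Qed.

Lemma carleson_le_heavy f z (s : R) : measurable_fun H f -> (0 <= s)%R ->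
  ~ heavy_set f s z -> carleson f z <= (5 ^+ n * s)%:E.
Proof.
move=> mf s0 fz; apply: carleson_le => // P dP Pz.
rewrite leNgt; apply/negP => hP; apply: fz; exists P; first by split.
move=> i; have := Pz i; have := side_gt0 P.
have -> : side (dilate 3%:pos%R P) = (3 * side P)%R by [].
rewrite ltr_norml /= => h1 /andP[h2 h3]; apply/andP; split; lra.
Qed.

Lemma heavy_cubes_side f s N : measurable_fun H f -> (0 < s)%R ->
  mass f H <= N%:E -> forall P, heavy_cubes f s P -> (side P <= 1 + N / s)%R.
Proof.
move=> mf s0 fN P [dP hP].
have N0 : (0 <= N)%R by rewrite -lee_fin (le_trans (mass_ge0 f H)).
have [l1|l1] := lerP (side P) 1.
  by rewrite (le_trans l1)// lerDl divr_ge0// ltW.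
have : (s * side P ^+ n)%:E < N%:E.
  apply: (lt_le_trans hP); apply: le_trans fN; apply: le_mass => //.
  - exact: measurable_carleson_box.
  - exact: measurable_halfspace.
  - exact: carleson_box_halfspace.
rewrite lte_fin mulrC -ltr_pdivlMr// => h.
apply: (@le_trans _ _ (side P ^+ n)%R); last by lra.
by rewrite -[leLHS]expr1 ler_weXn2l// ltW.
Qed.

Lemma esum_heavy_cubes_le f s N : measurable_fun H f -> (0 < s)%R ->
  mass f H <= N%:E ->
  \esum_(P in maximal_cube (heavy_cubes f s)) mu (cube_set P) <= (N / s)%:E.
Proof.
move=> mf s0 fN.
have hdy : heavy_cubes f s `<=` dy by move=> P [].
have cI := countable_maximal_cube HD hdy.
have tI := trivIset_maximal_cube n_gt0 HD hdy.
rewrite mulrC EFinM lee_pdivlMl// -esumZl//; last exact: ltW.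
apply: (@le_trans _ _
    (\esum_(P in maximal_cube (heavy_cubes f s)) mass f (carleson_box P))).
  by apply: le_esum => P [[_ /ltW hP] _]; rewrite lebesgue_cube -EFinM.
rewrite -mass_countable_bigcup//; last 3 first.
- by move=> P _; exact: measurable_carleson_box.
- by move=> P _; exact: carleson_box_halfspace.
- exact: trivIset_carleson_box.
apply: le_trans fN; apply: le_mass => //.
- apply: countable_bigcup_measurable => // P _.
  exact: measurable_carleson_box.
- exact: measurable_halfspace.
- by move=> p [P _]; exact: carleson_box_halfspace.
Qed.

(** Maximal heavy cubes suffice to cover the set; they are disjoint, so the
masses that make them heavy add up to at most the total mass. *)
Lemma heavy_set_le f s N : measurable_fun H f -> (0 < s)%R ->
  mass f H <= N%:E -> mu (heavy_set f s) <= (4 ^+ n * (N / s))%:E.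
Proof.
move=> mf s0 fN.
have hdy : heavy_cubes f s `<=` dy by move=> P [].
have cI := countable_maximal_cube HD hdy.
apply: (@le_trans _ _ (mu (\bigcup_(P in maximal_cube (heavy_cubes f s))
    open_cube P.1 (2 * side P)))).
  apply: le_measure; rewrite ?inE.
  - by apply: measurable_open_Rn; exact: open_heavy_set.
  - apply: countable_bigcup_measurable => // P _; exact: measurable_open_cube.
  - move=> x [P hP Px].
    have [Q mQ PQ] := maximal_cube_exists n_gt0 HD hdy (heavy_cubes_side mf s0 fN) hP.
    exists Q => // i.
    have [<-|nPQ] := pselect (P = Q); first exact: Px.
    have := dyadic_proper_side n_gt0 HD (hdy _ mQ.1) (hdy _ hP) PQ nPQ.
    have := Px i; have := PQ _ (cube_center P) i; have := side_gt0 P.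
    rewrite !ltr_norml => h0 /andP[h1 h2] /andP[h3 h4] h5.
    apply/andP; split; lra.
apply: (le_trans (measure_countable_le _ cI _)).
  by move=> P _; exact: measurable_open_cube.
apply: (@le_trans _ _ (\esum_(P in maximal_cube (heavy_cubes f s))
    ((4 ^+ n)%:E * mu (cube_set P)))).
  apply: le_esum => P _; have l0 := side_gt0 P.
  rewrite [leLHS](_ : _ = ((2 * (2 * side P)) ^+ n)%:E); last first.
    by apply: lebesgue_open_cube; rewrite mulr_gt0.
  rewrite lebesgue_cube -EFinM -exprMn.
  by rewrite mulrA; have -> : (2 * 2 = 4 :> R)%R by lra.
rewrite esumZl ?exprn_ge0//.
by rewrite EFinM lee_wpmul2l ?lee_fin ?exprn_ge0// esum_heavy_cubes_le.
Qed.

(** Layer cake over the dyadic levels L 2^-m: the bound L on the means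
cuts off the high levels, the weak type bound sums the low ones. *)
Lemma carleson_L2 f (L N : R) : measurable_fun H f -> (0 < L)%R ->
  mass f H <= N%:E ->
  (forall P, dy P -> mass f (carleson_box P) <= (L * side P ^+ n)%:E) ->
  \int[mu]_y (carleson f y * carleson f y) <= (4 * 100 ^+ n * (L * N))%:E.
Proof.
move=> mf L0 fN fL.
have N0 : (0 <= N)%R by rewrite -lee_fin (le_trans (mass_ge0 f H)).
pose K : R := (5 ^+ n * L)%R.
have K0 : (0 < K)%R by rewrite mulr_gt0// exprn_gt0.
pose V m := heavy_set f (L * 2 ^- m.+1).
have mV m : measurable (V m) by apply: measurable_open_Rn; exact: open_heavy_set.
pose psi m (y : Rn R n) : \bar R := ((K * 2 ^- m) ^+ 2 * \1_(V m) y)%:E.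
have psi0 m y : 0 <= psi m y by rewrite lee_fin mulr_ge0// sqr_ge0.
apply: (@le_trans _ _ (\int[mu]_y \sum_(0 <= m <oo) psi m y)).
  apply: ge0_le_integralW => y; first by rewrite mule_ge0// carleson_ge0.
  have fy : carleson f y <= K%:E.
    by apply: carleson_le => //; [exact: ltW|move=> P dP _; exact: fL].
  have fy0 := carleson_ge0 f y.
  have [c cE] : exists c : R, carleson f y = c%:E.
    exists (fine (carleson f y)); rewrite fineK// ge0_fin_numE//.
    exact: (le_lt_trans fy (ltry _)).
  rewrite cE in fy fy0 *; rewrite lee_fin in fy; rewrite lee_fin in fy0.
  have [->|c0] := eqVneq c 0%R.
    by rewrite mul0e; apply: nneseries_ge0.
  have {c0}fy0 : (0 < c)%R by rewrite lt_def c0.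
  have ex : exists m : nat, (K * 2 ^- m.+1 < c)%R.
    exists (Num.Def.archi_bound (K / c)).
    rewrite ltr_pdivrMr ?exprn_gt0// mulrC -ltr_pdivrMr//.
    apply: upper_nthrootP; exact: leqnSn.
  case: (ex_minnP ex) => m cm mmin.
  have cm' : (c <= K * 2 ^- m)%R.
    case: m cm mmin => [|m] cm mmin; first by rewrite expr0 invr1 mulr1.
    by rewrite leNgt; apply/negP => /mmin; rewrite ltnn.
  apply: le_trans (nneseries_ge_term m (psi0 ^~ y)).
  have yV : V m y.
    apply: contrapT => /(carleson_le_heavy mf) h.
    have : carleson f y <= (5 ^+ n * (L * 2 ^- m.+1))%:E.
      by apply: h; rewrite mulr_ge0// ?ltW// invr_ge0 exprn_ge0.
    by rewrite cE lee_fin mulrA leNgt cm.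
  rewrite /psi indicE mem_set// mulr1 -EFinM lee_fin -expr2.
  by rewrite ler_pXn2r// nnegrE ltW//; exact: lt_le_trans cm'.
rewrite integral_nneseries//; last first.
  move=> m; apply/measurable_EFinP; apply: measurable_funM => //.
apply: (@le_trans _ _ (\sum_(0 <= m <oo)
    (2 * 100 ^+ n * (L * N) * 2^-1 ^+ m)%:E)).
  apply: lee_nneseries => [m _|m _].
    by move=> _; apply: integral_ge0 => y _; exact: psi0.
  rewrite /psi; under eq_integral do rewrite EFinM.
  rewrite ge0_integralZl_EFin ?sqr_ge0//; last exact/measurable_EFinP.
  rewrite integral_indic// setIT.
  have Lm : (0 < L * 2 ^- m.+1)%R by rewrite mulr_gt0// invr_gt0 exprn_gt0.
  apply: (@le_trans _ _ (((K * 2 ^- m) ^+ 2)%:E *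
     (4 ^+ n * (N / (L * 2 ^- m.+1)))%:E)).
    by apply: lee_wpmul2l; [rewrite lee_fin sqr_ge0|exact: heavy_set_le].
  rewrite -EFinM lee_fin le_eqVlt; apply/orP; left; apply/eqP.
  have -> : (100 ^+ n = 5 ^+ n * 5 ^+ n * 4 ^+ n :> R)%R.
    by rewrite -!exprMn; congr (_ ^+ _)%R; lra.
  rewrite exprVn (exprS _ m) expr2 /K.
  have ? : ((2 : R) ^+ m != 0)%R by rewrite expf_neq0// pnatr_eq0.
  have ? : (L != 0)%R by rewrite gt_eqF.
  by field; do ?[apply/andP; split].
apply: (le_trans (nneseries_geometric_le _ _)).
- by rewrite !mulr_ge0// ?exprn_ge0// ltW.
- by apply/andP; split; lra.
- rewrite lee_fin; have -> : (1 - 2^-1 = 2^-1 :> R)%R by lra.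
  rewrite invrK; lra.
Qed.

End dyadic_test.
End carleson_functional.

(** * Kernel regularity *)

Section norms.
Context (R : realType) (n : nat).
Implicit Types (x y z : Rn R n).

Lemma sum_sqr_ge0 x : 0 <= \sum_(i < n) (tnth x i : R) ^+ 2.
Proof. by apply: sumr_ge0 => i _; exact: sqr_ge0. Qed.

Lemma coord_sqr_le x i : (tnth x i : R) ^+ 2 <= \sum_(i < n) (tnth x i : R) ^+ 2.
Proof.
by rewrite (bigD1 i)//= lerDl sumr_ge0// => j _; exact: sqr_ge0.
Qed.

Lemma sum_sqr_le x r : 0 <= r -> (forall i, `|tnth x i : R| <= r) ->
  \sum_(i < n) (tnth x i : R) ^+ 2 <= (n%:R * r) ^+ 2.
Proof.
move=> r0 xr.
apply: (@le_trans _ _ (\sum_(i < n) r ^+ 2)).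
  apply: ler_sum => i _; rewrite -real_normK ?num_real//.
  by rewrite ler_pXn2r ?nnegrE.
rewrite sumr_const card_ord exprMn -[leLHS]mulr_natl.
apply: ler_wpM2r; first exact: sqr_ge0.
by case: (n) => [|m]; rewrite ?expr0n//= expr2 ler_peMr// ler1n.
Qed.

Lemma norm_Rn_le z r : 0 <= r -> (forall i, `|tnth z i : R| <= r) ->
  norm_Rn z <= n%:R * r.
Proof.
move=> r0 zr; rewrite /norm_Rn -[leRHS]ger0_norm ?mulr_ge0// -sqrtr_sqr.
by rewrite ler_wsqrtr// sum_sqr_le.
Qed.

Lemma norm_R1n_le t x r : 0 <= t -> 0 <= r -> (forall i, `|tnth x i : R| <= r) ->
  norm_R1n t x <= t + n%:R * r.
Proof.
move=> t0 r0 xr; have nr : 0 <= n%:R * r by rewrite mulr_ge0.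
rewrite /norm_R1n -[leRHS]ger0_norm ?addr_ge0// -sqrtr_sqr ler_wsqrtr//.
by have := sum_sqr_le r0 xr; nra.
Qed.

Lemma norm_R1n_ge_t t x : t <= norm_R1n t x.
Proof.
apply: (le_trans (ler_norm _)); rewrite -sqrtr_sqr ler_wsqrtr//.
by rewrite lerDl sum_sqr_ge0.
Qed.

Lemma norm_R1n_ge_coord t x i : `|tnth x i : R| <= norm_R1n t x.
Proof.
rewrite -sqrtr_sqr ler_wsqrtr// (le_trans (coord_sqr_le x i))//.
by rewrite lerDr sqr_ge0.
Qed.

Lemma norm_R1n_ge0 t x : 0 <= norm_R1n t x.
Proof. exact: sqrtr_ge0. Qed.

Lemma norm_Rn_ge0 x : 0 <= norm_Rn x.
Proof. exact: sqrtr_ge0. Qed.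

Lemma addRn_subRn x z : addRn x (subRn z x) = z.
Proof. by apply/eq_from_tnth => i; rewrite !tnth_mktuple; lra. Qed.

End norms.

Section powR_tools.
Context (R : realType).

Lemma powR_ratio_le (a a' b b' d : R) (n : nat) : 0 < d ->
  0 <= a' <= a -> 0 < b <= b' ->
  a' `^ d / b' `^ (n%:R + d) <= (a / b) `^ d / b ^+ n.
Proof.
move=> d0 /andP[a'0 a'a] /andP[b0 bb'].
have b'0 : 0 < b' by exact: lt_le_trans bb'.
have a0 : 0 <= a by exact: le_trans a'a.
have -> : (a / b) `^ d / b ^+ n = a `^ d / b `^ (n%:R + d).
  have bd0 : b `^ d != 0 by rewrite gt_eqF// powR_gt0.
  have bn0 : b ^+ n != 0 by rewrite gt_eqF// exprn_gt0.
  have -> : a `^ d = (a / b) `^ d * b `^ d.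
    by rewrite -powRM ?divfK ?gt_eqF// ?divr_ge0// ltW.
  rewrite powRD ?(gt_eqF b0) ?implybT// powR_mulrn ?(ltW b0)//.
  by field; rewrite bd0.
apply: ler_pM; rewrite ?powR_ge0 ?invr_ge0 ?powR_ge0//.
  by apply: ge0_ler_powR; rewrite ?nnegrE ?(ltW d0)//.
rewrite lef_pV2 ?posrE ?powR_gt0//.
by apply: ge0_ler_powR; rewrite ?nnegrE ?addr_ge0 ?(ltW d0) ?(ltW b0) ?(ltW b'0).
Qed.

Lemma powR_small (d e : R) : 0 < d -> 0 < e ->
  exists2 u, 0 < u & forall v, 0 <= v <= u -> v `^ d <= e.
Proof.
move=> d0 e0; exists (e `^ d^-1); first exact: powR_gt0.
move=> v /andP[v0 vu].
have -> : e = (e `^ d^-1) `^ d.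
  by rewrite -powRrM mulVf ?gt_eqF// powRr1// ltW.
by apply: ge0_ler_powR; rewrite ?nnegrE ?powR_ge0 ?(ltW d0).
Qed.

Lemma powR_le1 (v d : R) : 0 < d -> 0 <= v <= 1 -> v `^ d <= 1.
Proof.
move=> d0 /andP[v0 v1]; have -> : (1 : R) = 1 `^ d by rewrite powR1.
by apply: ge0_ler_powR; rewrite ?nnegrE ?(ltW d0).
Qed.

End powR_tools.

Section regular_kernel.
Context (R : realType) (n : nat) (delta C : R).
Context (delta_gt0 : 0 < delta) (C_ge0 : 0 <= C) (k : kernel_fun R n).
Implicit Types (x y z : Rn R n).
Local Notation H := (@halfspace R n).

(** The estimate only gets weaker when the displacement is replaced by a larger
number a and the distance to the pole by a smaller number b. *)
Lemma x_regularity_le t t' x x' y a b : x_regularity k delta C ->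
  0 < t -> t < t' -> norm_R1n (t' - t) (subRn x' x) <= a ->
  0 < b <= norm_R1n t (subRn x y) -> a <= b / 2 ->
  `|k t' x' y - k t x y| <= C * ((a / b) `^ delta / b ^+ n).
Proof.
move=> kx t0 tt' na /andP[b0 nb] ab.
have := kx (t' - t) t x y (subRn x' x).
have -> : t + (t' - t) = t' by lra.
rewrite addRn_subRn subr_gt0 => h.
apply: (le_trans (h tt' t0 _)).
  by rewrite (le_trans na)// (le_trans ab)// ler_pM2r.
rewrite ler_wpM2l// powR_ratio_le//; last by rewrite b0.
by rewrite na norm_R1n_ge0.
Qed.

Lemma y_regularity_le t x y y' a b : y_regularity k delta C ->
  0 < t -> norm_Rn (subRn y' y) <= a ->
  0 < b <= norm_R1n t (subRn x y) -> a <= b / 2 ->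
  `|k t x y' - k t x y| <= C * ((a / b) `^ delta / b ^+ n).
Proof.
move=> ky t0 na /andP[b0 nb] ab.
have := ky t x y (subRn y' y) t0; rewrite addRn_subRn => h.
apply: (le_trans (h _)).
  by rewrite (le_trans na)// (le_trans ab)// ler_pM2r.
rewrite ler_wpM2l// powR_ratio_le//; last by rewrite b0.
by rewrite na norm_Rn_ge0.
Qed.

Lemma x_regularity_continuous y p (e : R) : x_regularity k delta C ->
  H p -> 0 < e -> exists2 r, 0 < r & forall q, `|q.1 - p.1 : R| < r ->
    open_cube p.2 r q.2 -> H q /\ `|k q.1 q.2 y - k p.1 p.2 y| < e.
Proof.
move=> kx Hp e0; case: p Hp => t x; rewrite /halfspace /= => t0.
pose b := t / 2; have b0 : 0 < b by rewrite divr_gt0.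
have bn0 : 0 < b ^+ n by rewrite exprn_gt0.
have n20 : 0 < 2 + n%:R :> R by rewrite ltr_pwDl.
have e'0 : 0 < e * b ^+ n / (4 * (C + 1)).
  by rewrite divr_gt0 ?mulr_gt0// ltr_wpDl.
have [u u0 uP] := powR_small delta_gt0 e'0.
pose r := Num.min (b / 2) (u * b) / (2 + n%:R).
have r0 : 0 < r by rewrite divr_gt0// lt_min divr_gt0// mulr_gt0.
have ar : (2 + n%:R) * r = Num.min (b / 2) (u * b).
  by rewrite mulrC /r divfK// gt_eqF.
have arb : (2 + n%:R) * r <= b / 2 by rewrite ar ge_min lexx.
have aru : (2 + n%:R) * r <= u * b by rewrite ar ge_min lexx orbT.
have nr0 : 0 <= n%:R * r by rewrite mulr_ge0// ltW.
have rb : r <= b / 4 by nra.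
(* Regularity compares two points only when the second one lies higher, so
   both points are compared with a common base point below them. *)
have near_base (s : R) (w : Rn R n) : `|s - t| < r -> open_cube x r w ->
    `|k s w y - k (t - r) x y| <= e / 4.
  move=> st xw; move: (st); rewrite ltr_norml => /andP[st1 st2].
  apply: (le_trans (@x_regularity_le _ _ _ _ y ((2 + n%:R) * r) b kx _ _ _ _ _)).
  - rewrite /b in b0 rb *; lra.
  - lra.
  - apply: (le_trans (@norm_R1n_le _ _ _ _ r _ _ _)); try lra.
    by move=> i; rewrite tnth_mktuple ltW//; exact: xw.
  - rewrite b0 /=; apply: (le_trans _ (norm_R1n_ge_t _ _)).
    rewrite /b in b0 rb *; lra.
  - exact: arb.
  apply: (@le_trans _ _ (C * (e * b ^+ n / (4 * (C + 1)) / b ^+ n))).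
    rewrite ler_wpM2l// ler_pM2r ?invr_gt0//; apply: uP.
    apply/andP; split; last by rewrite ler_pdivrMr.
    by rewrite divr_ge0 ?(ltW b0)// mulr_ge0// ?(ltW r0)// ltW.
  have -> : C * (e * b ^+ n / (4 * (C + 1)) / b ^+ n) = e / 4 * (C / (C + 1)).
    have c1 : C + 1 != 0 by rewrite gt_eqF// ltr_wpDl.
    by field; rewrite c1 ?(gt_eqF b0) ?(gt_eqF bn0).
  rewrite ler_piMr ?divr_ge0 ?(ltW e0)//.
  by rewrite ler_pdivrMr ?mul1r ?lerDl// ltr_wpDl.
exists r => // -[s w] /= st xw; split.
  by move: st; rewrite ltr_norml /b in rb * => /andP[h _]; rewrite /halfspace /=; lra.
have -> : k s w y - k t x y =
  (k s w y - k (t - r) x y) - (k t x y - k (t - r) x y) by lra.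
apply: (le_lt_trans (ler_normB _ _)).
have h1 := near_base _ _ st xw.
have h2 : `|k t x y - k (t - r) x y| <= e / 4.
  by apply: near_base; rewrite ?subrr ?normr0// => i; rewrite subrr normr0.
lra.
Qed.

Lemma measurable_kernel y : x_regularity k delta C ->
  measurable_fun H (fun p => k p.1 p.2 y).
Proof.
move=> kx mH; apply: (measurability _ (RGenOInfty.measurableE R)) => //.
move=> /= _ [_ [a ->] <-]; apply: measurable_open_R1n => p [Hp].
rewrite /= in_itv /= andbT => ap.
have ap' : 0 < k p.1 p.2 y - a by rewrite subr_gt0.
have [r r0 rP] := x_regularity_continuous y kx Hp ap'.
exists r => // q q1 q2; have [Hq kq] := rP q q1 q2; split => //=.
by rewrite in_itv /= andbT; move: kq; rewrite ltr_norml; lra.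
Qed.

End regular_kernel.

Lemma x_regularity_mono (R : realType) (n : nat) (k : kernel_fun R n)
    (delta C C' : R) : C <= C' -> x_regularity k delta C -> x_regularity k delta C'.
Proof.
move=> CC' kx s t x y z s0 t0 h; apply: (le_trans (kx s t x y z s0 t0 h)).
by rewrite ler_wpM2r// divr_ge0 ?powR_ge0.
Qed.

Lemma y_regularity_mono (R : realType) (n : nat) (k : kernel_fun R n)
    (delta C C' : R) : C <= C' -> y_regularity k delta C -> y_regularity k delta C'.
Proof.
move=> CC' ky t x y z t0 h; apply: (le_trans (ky t x y z t0 h)).
by rewrite ler_wpM2r// divr_ge0 ?powR_ge0.
Qed.

(** * The size of the kernel *)

Section halfspace_integrals.
Context (R : realType) (n : nat).
Implicit Types (f g : R1n R n -> R) (F G : R1n R n -> R).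
Local Notation mu := (lebesgue_Rn R n).
Local Notation nu := (lebesgue_R1n R n).
Local Notation H := (@halfspace R n).
Let mH : measurable H := @measurable_halfspace R n.

Lemma L1_halfspaceP f :
  L1_halfspace f <-> measurable_fun H f /\ (mass f H < +oo)%E.
Proof.
split.
- by move=> /integrableP[mf fi]; split; [exact/measurable_EFinP|exact: fi].
- by move=> [mf fi]; apply/integrableP; split; [exact/measurable_EFinP|exact: fi].
Qed.

Lemma mass_fine f : L1_halfspace f -> mass f H = (fine (mass f H))%:E.
Proof.
move=> /L1_halfspaceP[_ fi]; rewrite fineK// ge0_fin_numE//; exact: mass_ge0.
Qed.

Lemma L1_halfspaceS f g : measurable_fun H f ->
  (forall p, H p -> `|f p| <= `|g p|) -> L1_halfspace g -> L1_halfspace f.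
Proof.
move=> mf fg; apply: le_integrable; [exact: mH|exact/measurable_EFinP|].
by move=> p Hp; rewrite /= lee_fin fg.
Qed.

Lemma normr_Rintegral_le F G : measurable_fun H F ->
  (forall p, H p -> `|F p| <= G p) -> nu.-integrable H (EFin \o G) ->
  nu.-integrable H (EFin \o F) /\
  `|\int[nu]_(p in H) F p| <= \int[nu]_(p in H) G p.
Proof.
move=> mF FG iG.
have iF : nu.-integrable H (EFin \o F).
  apply: le_integrable iG; [exact: mH|exact/measurable_EFinP|].
  move=> p Hp; rewrite /= lee_fin (le_trans (FG p Hp))//; exact: ler_norm.
split => //; apply: (le_trans (le_normr_Rintegral mH iF)).
apply: le_Rintegral => //; exact: integrable_norm iF.
Qed.

Lemma L1_halfspaceB f g : L1_halfspace f -> L1_halfspace g ->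
  L1_halfspace (fun p => f p - g p).
Proof. by move=> f1 g1; exact: (integrableB mH f1 g1). Qed.

Lemma mass_Rintegral f : L1_halfspace f ->
  mass f H = (\int[nu]_(p in H) `|f p|)%:E.
Proof.
by move=> f1; rewrite /Rintegral -/(mass f H) -mass_fine.
Qed.

End halfspace_integrals.

Section L2_estimate.
Context (R : realType) (n : nat) (k : kernel_fun R n) (C1 : R).
Local Notation mu := (lebesgue_Rn R n).
Local Notation H := (@halfspace R n).
Local Open Scope ereal_scope.

Lemma poweR2 (x : \bar R) : 0 <= x -> x `^ 2 = x * x.
Proof.
move=> x0; rewrite -[in RHS](poweRe1 x0); case: x x0 => [r r0|_|//].
- by rewrite !poweR_EFin powRr1// -EFinM -expr2 -powR_mulrn.
- by rewrite !poweRyr// mulyy.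
Qed.

(** Chebyshev's inequality applied to the hypothesis on S. *)
Lemma L2_carleson_estimate_le (f : R1n R n -> R) (A : set (Rn R n)) (a M : R) :
  L2_carleson_estimate k C1 -> measurable_fun H f ->
  (forall y, S_converges k f y) ->
  \int[mu]_y (carleson f y * carleson f y) <= M%:E ->
  measurable A -> (0 <= a)%R -> (forall y, A y -> (a <= `|S_op k f y|)%R) ->
  (a ^+ 2)%:E * mu A <= (C1 ^+ 2 * M)%:E.
Proof.
move=> kL2 mf fS fM mA a0 aS.
have hS := kL2 f mf (aeW _ fS).
set NS := 'N[mu]_2%:E [_] in hS; set NC := 'N[mu]_2%:E [_] in hS.
have NS0 : 0 <= NS by exact: Lnorm_ge0.
have NC0 : 0 <= NC by exact: Lnorm_ge0.
have {}hS : NS <= `|C1|%:E * NC.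
  by apply: (le_trans hS); rewrite lee_wpmul2r// lee_fin ler_norm.
have C10 : 0 <= `|C1|%:E by rewrite lee_fin.
have hS2 : NS `^ 2 <= (C1 ^+ 2)%:E * NC `^ 2.
  have -> : (C1 ^+ 2)%:E = `|C1|%:E `^ 2.
    by rewrite poweR2// -EFinM -expr2 real_normK// num_real.
  rewrite -poweRM//; apply: gt0_ler_poweR; rewrite ?in_itv//= ?leey ?andbT//.
  by rewrite mule_ge0.
have two0 : (2 != 0 :> R)%R by rewrite pnatr_eq0.
apply: (@le_trans _ _ (NS `^ 2)); last first.
  apply: (le_trans hS2); rewrite [(C1 ^+ 2 * M)%:E]EFinM lee_wpmul2l ?lee_fin ?sqr_ge0//.
  apply: le_trans fM; rewrite poweR_Lnorm//.
  rewrite le_eqVlt; apply/orP; left; apply/eqP; apply: eq_integral => y _.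
  by rewrite poweR2// gee0_abs// carleson_ge0.
rewrite poweR_Lnorm//.
have -> : (a ^+ 2)%:E * mu A = \int[mu]_y ((a ^+ 2)%:E * (\1_A y)%:E).
  rewrite ge0_integralZl_EFin ?sqr_ge0//; last exact/measurable_EFinP.
  by rewrite integral_indic// setIT.
apply: ge0_le_integralW => y; first by rewrite -EFinM lee_fin mulr_ge0 ?sqr_ge0.
rewrite poweR2// indicE; have [yA|yA] := boolP (y \in A); last first.
  by rewrite mule0 mule_ge0.
rewrite mule1 /= -EFinM lee_fin -expr2 ler_pXn2r ?nnegrE//.
by apply: aS; exact/set_mem.
Qed.

End L2_estimate.

Section size_bound.
Context (R : realType) (n : nat) (n_gt0 : (0 < n)%N) (delta C1 C2 C3 : R).
Context (delta_gt0 : 0 < delta) (C2_ge0 : 0 <= C2) (C3_ge0 : 0 <= C3).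
Context (D : int -> set (cube R n)) (HD : dyadic_system D) (k : kernel_fun R n).
Context (kL2 : L2_carleson_estimate k C1).
Context (kx : x_regularity k delta C2) (ky : y_regularity k delta C3).
Local Notation mu := (lebesgue_Rn R n).
Local Notation nu := (lebesgue_R1n R n).
Local Notation H := (@halfspace R n).
Let mH : measurable H := @measurable_halfspace R n.

Definition Whitney_box (t : R) (x : Rn R n) (h : R) : set (R1n R n) :=
  `]t, t + h[%classic `*` open_cube x h.

Let measurable_Whitney_box t x h : measurable (Whitney_box t x h).
Proof.
apply: measurableX; first exact: measurable_itv.
exact: measurable_open_cube.
Qed.

Let lebesgue_Whitney_box t x h : 0 < h ->
  nu (Whitney_box t x h) = (h * (2 * h) ^+ n)%:E.
Proof.
move=> h0; rewrite /lebesgue_R1n /= product_measure1E.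
- rewrite EFinM; congr (_ * _)%E; last exact: lebesgue_open_cube.
  transitivity (lebesgue_measure (`]t, t + h[%classic : set R)) => //.
  rewrite lebesgue_measure_itv /= lte_fin ltrDl h0 -EFinB.
  by congr EFin; lra.
- exact: measurable_itv.
- exact: measurable_open_cube.
Qed.

(** On a box whose size is a small multiple of r the kernel is nearly constant,
also when the pole moves by a small multiple of r. So S applied to the
indicator of the box is about the volume of the box times the kernel on a
whole cube of poles, and the L2 estimate bounds it by the Carleson functional
of the indicator. *)
Lemma kernel_size_lifted t x y r : 0 < r -> r / 2 <= t ->
  `|k t x y| <= (2 * (C2 + C3) * 2 ^+ n +
    (1 + 16 * (C1 ^+ 2) * (400 * (n%:R + 1)) ^+ n)) / r ^+ n.
Proof.
move=> r0 rt.
have t0 : 0 < t by apply: lt_le_trans rt; rewrite divr_gt0.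
pose h := r / (4 * (n%:R + 1)).
have n10 : 0 < n%:R + 1 :> R by rewrite ltr_wpDl.
have h0 : 0 < h by rewrite divr_gt0// mulr_gt0.
have hr : (n%:R + 1) * h = r / 4.
  by rewrite /h; field; rewrite gt_eqF.
have nh : n%:R * h <= r / 4 by rewrite -hr; nra.
pose B := Whitney_box t x h.
pose f : R1n R n -> R := \1_B.
pose e := (C2 + C3) * 2 ^+ n / r ^+ n.
have rn0 : 0 < r ^+ n by rewrite exprn_gt0.
have e0 : 0 <= e by rewrite divr_ge0 ?mulr_ge0 ?addr_ge0 ?exprn_ge0// ltW.
have half1 : ((r / 4) / (r / 2)) `^ delta / (r / 2) ^+ n <= 2 ^+ n / r ^+ n.
  have -> : (r / 4) / (r / 2) = 2^-1 by field; rewrite gt_eqF.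
  rewrite expr_div_n invf_div ler_piMl//.
    by rewrite divr_ge0 ?exprn_ge0// ltW.
  by apply: powR_le1 => //; lra.
have kB p y' : B p -> `|k p.1 p.2 y' - k t x y'| <= C2 * (2 ^+ n / r ^+ n).
  case: p => s w [/=]; rewrite in_itv /= => /andP[ts st] xw.
  apply: (le_trans (@x_regularity_le _ _ _ _ delta_gt0 C2_ge0 _ _ _ _ _ y'
    (r / 4) (r / 2) kx _ _ _ _ _)) => //.
  - apply: (le_trans (@norm_R1n_le _ _ _ _ h _ _ _)); try lra.
    by move=> i; rewrite tnth_mktuple ltW//; exact: xw.
  - rewrite divr_gt0//=; exact: (le_trans rt (norm_R1n_ge_t _ _)).
  - lra.
  - by rewrite ler_wpM2l.
have kY y' : open_cube y h y' -> `|k t x y' - k t x y| <= C3 * (2 ^+ n / r ^+ n).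
  move=> yy'.
  apply: (le_trans (@y_regularity_le _ _ _ _ delta_gt0 C3_ge0 _ _ _ y y'
    (r / 4) (r / 2) ky _ _ _ _)) => //.
  - apply: (le_trans (@norm_Rn_le _ _ _ h _ _)) => //; first exact: ltW.
    by move=> i; rewrite tnth_mktuple ltW//; exact: yy'.
  - rewrite divr_gt0//=; exact: (le_trans rt (norm_R1n_ge_t _ _)).
  - lra.
  - by rewrite ler_wpM2l.
have mB : measurable B by exact: measurable_Whitney_box.
have mf : measurable_fun H f by exact/measurable_funTS/measurable_indic.
have BH : B `<=` H.
  by move=> p [/=]; rewrite in_itv /= => /andP[tp _] _; exact: lt_trans tp.
pose beta := h * (2 * h) ^+ n.
have beta0 : 0 < beta by rewrite mulr_gt0// exprn_gt0// mulr_gt0.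
have fbeta : mass f H = beta%:E.
  rewrite /mass; under eq_integral do rewrite ger0_norm//.
  by rewrite integral_indic// setIidl// lebesgue_Whitney_box.
have f1 : L1_halfspace f by apply/L1_halfspaceP; rewrite fbeta ltry.
have iM (M : R) : nu.-integrable H (EFin \o (fun p => M * f p)).
  exact: (integrableZl mH M f1).
have fM (M : R) : \int[nu]_(p in H) (M * f p) = M * beta.
  rewrite RintegralZl//; congr (_ * _).
  apply: EFin_inj; rewrite -fbeta mass_Rintegral//; congr EFin.
  by apply: eq_Rintegral => p _; rewrite ger0_norm.
have mk y' : measurable_fun H (fun p => k p.1 p.2 y' * f p).
  apply: measurable_funM => //; exact: (measurable_kernel delta_gt0 C2_ge0).
have kconv y' : S_converges k f y'.
  apply: (normr_Rintegral_le (G := fun p => (`|k t x y'| + C2 * (2 ^+ n / r ^+ n)) * f p) _ _ _).1 => //.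
  move=> p _; rewrite normrM [`|f p|]ger0_norm// /f indicE.
  have [/set_mem Bp|_] := boolP (p \in B); last by rewrite !mulr0.
  rewrite !mulr1 -[k p.1 p.2 y'](subrK (k t x y')) addrC.
  by rewrite (le_trans (ler_normD _ _))// lerD2l kB.
have Sclose y' : open_cube y h y' -> `|S_op k f y' - k t x y * beta| <= e * beta.
  move=> yy'; rewrite -!fM /S_op -(RintegralB mH (kconv y') (iM (k t x y))).
  apply: (normr_Rintegral_le (G := fun p => e * f p) _ _ _).2 => //.
    by apply: measurable_funB => //; exact: measurable_funM.
  move=> p _; rewrite -mulrBl normrM [`|f p|]ger0_norm// /f indicE.
  have [/set_mem Bp|_] := boolP (p \in B); last by rewrite !mulr0.
  rewrite !mulr1.
  have -> : k p.1 p.2 y' - k t x y =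
    (k p.1 p.2 y' - k t x y') + (k t x y' - k t x y) by lra.
  rewrite (le_trans (ler_normD _ _))//.
  have -> : e = C2 * (2 ^+ n / r ^+ n) + C3 * (2 ^+ n / r ^+ n) by rewrite /e; lra.
  by rewrite lerD// ?kB ?kY.
set K := `|k t x y|.
set X := 16 * C1 ^+ 2 * _.
rewrite [leRHS](_ : _ = 2 * e + (1 + X) / r ^+ n); last by rewrite /e; lra.
have X0 : 0 <= X.
  rewrite /X; apply: mulr_ge0; first by rewrite mulr_ge0 // sqr_ge0.
  by rewrite exprn_ge0 // mulr_ge0 // ltW.
have Xr0 : 0 <= (1 + X) / r ^+ n by rewrite divr_ge0 ?addr_ge0// ltW.
have [Ke|eK] := lerP K (2 * e).
  by rewrite (le_trans Ke)// lerDl.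
have Sbig y' : open_cube y h y' -> K / 2 * beta <= `|S_op k f y'|.
  move=> /Sclose; rewrite distrC => hS.
  have := ler_normD (k t x y * beta - S_op k f y') (S_op k f y').
  rewrite subrK normrM (gtr0_norm beta0) -/K => hK.
  have : K * beta <= e * beta + `|S_op k f y'| by apply: le_trans hK _; rewrite lerD2r.
  nra.
pose L := beta * (2 / r) ^+ n.
have L0 : 0 < L by rewrite mulr_gt0// exprn_gt0// divr_gt0.
have fL P : dyadic_cubes D P -> (mass f (carleson_box P) <= (L * side P ^+ n)%:E)%E.
  move=> _; have l0 := side_gt0 P; have [lt|tl] := lerP (side P) t.
    rewrite /mass (eq_integral (fun=> 0%E)).
      by rewrite integral0 lee_fin mulr_ge0 ?exprn_ge0// ltW.
    move=> p /set_mem[/andP[_ pP] _]; rewrite /f indicE memNset ?normr0// => -[/=].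
    by rewrite in_itv /= => /andP[tp _] _; lra.
  apply: (@le_trans _ _ (mass f H)).
    apply: le_mass => //; first exact: measurable_carleson_box.
    exact: carleson_box_halfspace.
  rewrite fbeta lee_fin /L -mulrA -exprMn ler_peMr ?(ltW beta0)// exprn_ege1//.
  by rewrite mulrAC ler_pdivlMr// mul1r; lra.
have fbeta' : (mass f H <= beta%:E)%E by rewrite fbeta.
have := L2_carleson_estimate_le kL2 mf kconv
  (carleson_L2 n_gt0 HD mf L0 fbeta' fL) (@measurable_open_cube _ _ y h)
  _ Sbig.
have K0 : 0 <= K by exact: normr_ge0.
have K2 : 0 <= K / 2 * beta by rewrite mulr_ge0 ?divr_ge0 ?(ltW beta0).
rewrite lebesgue_open_cube// -EFinM lee_fin => /(_ K2).
have -> : (K / 2 * beta) ^+ 2 * (2 * h) ^+ n =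
    (K * r ^+ n) ^+ 2 * (beta ^+ 2 * h ^+ n * 2 ^+ n / (4 * (r ^+ n) ^+ 2)).
  by rewrite [(2 * h) ^+ n]exprMn; field; rewrite gt_eqF.
have hn : r ^+ n = (4 * (n%:R + 1)) ^+ n * h ^+ n.
  by rewrite -exprMn; congr (_ ^+ _); rewrite -mulrA hr; lra.
have -> : C1 ^+ 2 * (4 * 100 ^+ n * (L * beta)) =
    X * (beta ^+ 2 * h ^+ n * 2 ^+ n / (4 * (r ^+ n) ^+ 2)).
  rewrite /L /X expr_div_n.
  have -> : (400 * (n%:R + 1)) ^+ n = 100 ^+ n * (4 * (n%:R + 1)) ^+ n :> R.
    by rewrite -exprMn; congr (_ ^+ _); lra.
  rewrite hn; field.
  by apply/andP; split; apply: expf_neq0; apply: lt0r_neq0 => //; exact: mulr_gt0.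
rewrite ler_pM2r; last first.
  apply: divr_gt0; last by apply: mulr_gt0 => //; exact: exprn_gt0.
  by apply: mulr_gt0; [apply: mulr_gt0|]; exact: exprn_gt0.
move=> KX; apply: (@le_trans _ _ ((1 + X) / r ^+ n)); last by rewrite lerDr mulr_ge0.
rewrite ler_pdivlMr// -(@ler_pXn2r _ 2)// ?nnegrE ?mulr_ge0 ?addr_ge0 ?(ltW rn0)//.
by rewrite (le_trans KX)//; nra.
Qed.

(** Points close to the boundary are compared with points above them: moving up from (t, x) by half its distance
to the pole changes the kernel by an admissible amount. *)
Lemma kernel_size t x y : 0 < t ->
  `|k t x y| <= (C2 + (2 * (C2 + C3) * 2 ^+ n +
    (1 + 16 * (C1 ^+ 2) * (400 * (n%:R + 1)) ^+ n)))
    / norm_R1n t (subRn x y) ^+ n.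
Proof.
move=> t0; set r := norm_R1n _ _.
have tr : t <= r by exact: norm_R1n_ge_t.
have r0 : 0 < r by exact: lt_le_trans tr.
have rn0 : 0 < r ^+ n by rewrite exprn_gt0.
have h1 : `|k (t + r / 2) x y - k t x y| <= C2 / r ^+ n.
  apply: (le_trans (@x_regularity_le _ _ _ _ delta_gt0 C2_ge0 _ _ _ _ _ y
    (r / 2) r kx t0 _ _ _ _)) => //.
  - by rewrite ltrDl divr_gt0.
  - apply: (le_trans (@norm_R1n_le _ _ _ _ 0 _ _ _)); try lra.
    by move=> i; rewrite tnth_mktuple subrr normr0.
  - by rewrite r0 lexx.
  - rewrite ler_wpM2l// ler_piMl ?invr_ge0 ?(ltW rn0)//.
    have -> : r / 2 / r = 2^-1 by field; rewrite gt_eqF.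
    by apply: powR_le1 => //; lra.
have h2 := @kernel_size_lifted (t + r / 2) x y r r0 _.
rewrite mulrDl; apply: (@le_trans _ _ (`|k (t + r / 2) x y - k t x y| + `|k (t + r / 2) x y|)).
  rewrite -[leLHS]normrN [X in `|X| <= _](_ : _ =
    (k (t + r / 2) x y - k t x y) - k (t + r / 2) x y); last by lra.
  exact: ler_normB.
by rewrite lerD// h2// lerDr ltW.
Qed.

End size_bound.

(** * The operator on functions supported away from the boundary *)

Section lifted_functions.
Context (R : realType) (n : nat) (n_gt0 : (0 < n)%N) (delta C2 C3 B : R).
Context (delta_gt0 : 0 < delta) (C2_ge0 : 0 <= C2) (C3_ge0 : 0 <= C3)
  (B_ge0 : 0 <= B).
Context (k : kernel_fun R n).
Context (kx : x_regularity k delta C2) (ky : y_regularity k delta C3).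
Context (ksize : forall (t : R) x y, 0 < t ->
  `|k t x y| <= B / norm_R1n t (subRn x y) ^+ n).
Implicit Types (e l a c : R) (f g : R1n R n -> R) (P Q : cube R n) (x y z : Rn R n).
Local Notation mu := (lebesgue_Rn R n).
Local Notation nu := (lebesgue_R1n R n).
Local Notation H := (@halfspace R n).
Let mH : measurable H := @measurable_halfspace R n.

(** The functions on which the defining integral converges at every point, since
away from the boundary the size bound makes the kernel bounded. *)
Definition lifted (e : R) f :=
  L1_halfspace f /\ forall p, H p -> p.1 <= e -> f p = 0.

Lemma lifted_measurable e f : lifted e f -> measurable_fun H f.
Proof. by move=> [/L1_halfspaceP[]]. Qed.

Lemma measurable_integrand f y : measurable_fun H f ->
  measurable_fun H (fun p => k p.1 p.2 y * f p).
Proof.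
move=> mf; apply: measurable_funM => //.
exact: (measurable_kernel delta_gt0 C2_ge0).
Qed.

Lemma lifted_converges e f y : 0 < e -> lifted e f -> S_converges k f y.
Proof.
move=> e0 fe; have mf := lifted_measurable fe; have [f1 f0] := fe.
apply: (L1_halfspaceS (g := fun p => B / e ^+ n * f p)).
- exact: measurable_integrand.
- move=> p Hp; rewrite [leLHS]normrM [leRHS]normrM; have [pe|ep] := leP p.1 e.
    by rewrite f0// normr0 !mulr0.
  rewrite ler_wpM2r// [leRHS]ger0_norm ?divr_ge0 ?exprn_ge0 ?(ltW e0)//.
  rewrite (le_trans (ksize _ _ Hp))// ler_wpM2l// lef_pV2 ?posrE ?exprn_gt0//.
    by rewrite ler_pXn2r ?nnegrE ?norm_R1n_ge0 ?(ltW e0)// (le_trans (ltW ep))// norm_R1n_ge_t.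
  by rewrite (lt_le_trans _ (norm_R1n_ge_t _ _)).
- exact: (integrableZl mH _ f1).
Qed.

Lemma S_opB f g y : S_converges k f y -> S_converges k g y ->
  S_converges k (fun p => f p - g p) y /\
  S_op k (fun p => f p - g p) y = S_op k f y - S_op k g y.
Proof.
move=> fy gy; split; last first.
  rewrite /S_op -(RintegralB mH fy gy).
  by apply: eq_Rintegral => p _; rewrite mulrBr.
have := integrableB mH fy gy; apply: eq_integrable => // p _.
by rewrite mulrBr EFinB.
Qed.

Lemma S_op_diff_le f y y' : S_converges k f y -> S_converges k f y' ->
  (`|S_op k f y - S_op k f y'|%:E <=
   \int[nu]_(p in H) (`|k p.1 p.2 y - k p.1 p.2 y'| * `|f p|)%:E)%E.
Proof.
move=> fy fy'; rewrite /S_op -(RintegralB mH fy fy').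
have iF : nu.-integrable H (EFin \o (fun p => k p.1 p.2 y * f p - k p.1 p.2 y' * f p)).
  exact: (integrableB mH fy fy').
rewrite EFin_normr_Rintegral//.
apply: le_trans (le_abse_integral _ _ _) _ => //; first exact: measurable_int iF.
rewrite le_eqVlt; apply/orP; left; apply/eqP; apply: eq_integral => p _ /=.
by rewrite -mulrBl normrM.
Qed.

Lemma lifted_y_close e f y y' a : 0 < e -> lifted e f ->
  norm_Rn (subRn y' y) <= a -> a <= e / 2 ->
  `|S_op k f y' - S_op k f y| <=
  C3 * ((a / e) `^ delta / e ^+ n) * fine (mass f H).
Proof.
move=> e0 fe ya ae; have [f1 f0] := fe; have mf := lifted_measurable fe.
set c := C3 * _.
have c0 : 0 <= c.
  by rewrite mulr_ge0// divr_ge0 ?powR_ge0// exprn_ge0// ltW.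
rewrite -lee_fin EFinM -mass_fine//.
apply: (le_trans (S_op_diff_le (lifted_converges _ e0 fe) (lifted_converges _ e0 fe))).
rewrite /mass -ge0_integralZl_EFin//; last exact: measurable_normE.
apply: ge0_le_integral => //.
- apply/measurable_EFinP; apply: measurable_funM.
    apply: measurableT_comp => //; apply: measurable_funB;
    exact: (measurable_kernel delta_gt0 C2_ge0).
  exact: measurableT_comp.
- by apply/measurable_EFinP; apply: measurable_funM => //; exact: measurableT_comp.
move=> p Hp; rewrite -EFinM lee_fin; have [pe|ep] := leP p.1 e.
  by rewrite f0// normr0 !mulr0.
rewrite ler_wpM2r// (@y_regularity_le _ _ _ _ delta_gt0 C3_ge0 _ _ _ y y' a e)//.
by rewrite e0 (le_trans (ltW ep))// norm_R1n_ge_t.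
Qed.

(** The image of a lifted function is continuous, by y-regularity. *)
Lemma open_S_op e f l : 0 < e -> lifted e f ->
  open_Rn [set y | l < `|S_op k f y|].
Proof.
move=> e0 fe y /= ly.
set m := fine (mass f H).
have m0 : 0 <= m by rewrite fine_ge0// mass_ge0.
have en0 : 0 < e ^+ n by rewrite exprn_gt0.
pose d := (`|S_op k f y| - l) / 2.
have d0 : 0 < d by rewrite divr_gt0// subr_gt0.
have Cm0 : 0 < C3 * m + 1 by rewrite ltr_wpDl// mulr_ge0.
have [u u0 uP] := powR_small delta_gt0 (divr_gt0 (mulr_gt0 d0 en0) Cm0).
have n0 : 0 < n%:R :> R by rewrite ltr0n.
pose r := Num.min (e / 2) (u * e) / n%:R.
have r0 : 0 < r by rewrite divr_gt0// lt_min divr_gt0// mulr_gt0.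
have nr : n%:R * r = Num.min (e / 2) (u * e) by rewrite mulrC divfK// gt_eqF.
exists r => // y' yy' /=.
have ya : norm_Rn (subRn y' y) <= n%:R * r.
  apply: norm_Rn_le; first exact: ltW.
  by move=> i; rewrite tnth_mktuple ltW//; exact: yy'.
have ae : n%:R * r <= e / 2 by rewrite nr ge_min lexx.
have := lifted_y_close e0 fe ya ae.
have : ((n%:R * r) / e) `^ delta <= d * e ^+ n / (C3 * m + 1).
  apply: uP; apply/andP; split.
    by apply: divr_ge0; [apply: mulr_ge0|]; exact: ltW.
  by rewrite ler_pdivrMr// nr ge_min lexx orbT.
set v := _ `^ _ => vd.
have : C3 * (v / e ^+ n) * m <= d.
  have -> : C3 * (v / e ^+ n) * m = (C3 * m) * v / e ^+ n by lra.
  rewrite ler_pdivrMr// (le_trans (ler_wpM2l _ vd)) ?mulr_ge0//.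
  have -> : C3 * m * (d * e ^+ n / (C3 * m + 1)) =
      d * e ^+ n * (C3 * m / (C3 * m + 1)) by lra.
  apply: ler_piMr; first by apply: mulr_ge0; exact: ltW.
  by rewrite ler_pdivrMr// mul1r lerDl.
rewrite -/m => h1 h2; have {}h2 := le_trans h2 h1.
have : `|S_op k f y| <= `|S_op k f y' - S_op k f y| + `|S_op k f y'|.
  by rewrite -[X in `|X| <= _](subrK (S_op k f y')) (le_trans (ler_normD _ _))// distrC.
rewrite /d in h2 d0 * => h3; lra.
Qed.

(** The gain of the regularity estimates from one dyadic annulus to the
next. *)
Definition decay : R := 2^-1 `^ delta.

Lemma decay_gt0 : 0 < decay. Proof. exact: powR_gt0. Qed.

Lemma decay_lt1 : decay < 1.
Proof.
have -> : (1 : R) = 1 `^ delta by rewrite powR1.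
by apply: gt0_ltr_powR => //; rewrite ?nnegrE//; lra.
Qed.

Lemma decayX m : (2 ^- m) `^ delta = decay ^+ m.
Proof.
rewrite -exprVn -powR_mulrn ?powR_ge0// -powR_mulrn//.
by rewrite -!powRrM mulrC.
Qed.

Lemma scale_powR (a l : R) m : 0 <= a -> 0 < l ->
  ((a * l) / (2 ^+ m * l)) `^ delta / (2 ^+ m * l) ^+ n =
  a `^ delta * (decay ^+ m / (2 ^+ m * l) ^+ n).
Proof.
move=> a0 l0; have p0 : (2 : R) ^+ m != 0 by rewrite expf_neq0// pnatr_eq0.
have -> : (a * l) / (2 ^+ m * l) = a * 2 ^- m.
  by field; rewrite p0 gt_eqF.
by rewrite powRM// ?invr_ge0 ?exprn_ge0// decayX mulrA.
Qed.

Definition pow_dilate m P : cube R n := dilate (2 ^+ m)%:pos P.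

Lemma side_pow_dilate m P : side (pow_dilate m P) = 2 ^+ m * side P.
Proof. by []. Qed.

Lemma pow_dilate_sub m P : cube_set P `<=` cube_set (pow_dilate m P).
Proof.
move=> x Px i; have := Px i; rewrite side_pow_dilate /=.
have := side_gt0 P => l0; have : side P <= 2 ^+ m * side P.
  by rewrite ler_peMl ?(ltW l0)// exprn_ege1// ler1n.
by move=> h1 /andP[h2 h3]; apply/andP; split; lra.
Qed.

Lemma pow_dilate_cover P p : H p -> exists m, carleson_box (pow_dilate m P) p.
Proof.
move=> Hp; have l0 := side_gt0 P.
pose S := \sum_(i < n) `|tnth p.2 i - tnth P.1 i : R|.
have S0 : 0 <= S by apply: sumr_ge0 => i _.
pose M := (p.1 + 2 * S) / side P.
exists (Num.Def.archi_bound M).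
have : M < 2 ^+ Num.Def.archi_bound M by exact: upper_nthrootP.
rewrite ltr_pdivrMr// => hM; rewrite /halfspace /= in Hp.
split; first by rewrite side_pow_dilate Hp /=; lra.
move=> i; rewrite side_pow_dilate /=.
have : `|tnth p.2 i - tnth P.1 i : R| <= S.
  by rewrite /S (bigD1 i)//= lerDl sumr_ge0.
rewrite ler_norml => /andP[h1 h2]; apply/andP; split; lra.
Qed.

Lemma carleson_boxPn P p : H p -> ~ carleson_box P p ->
  side P <= p.1 \/ exists i, side P / 2 <= `|tnth p.2 i - tnth P.1 i : R|.
Proof.
move=> Hp; have [sp|ps] := leP (side P) p.1; first by left.
move=> nPp; right; apply: contrapT => /forallNP h; apply: nPp; split.
  by rewrite ps andbT.
move=> i; have := h i => /negP; rewrite -ltNge ltr_norml => /andP[h1 h2].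
apply/andP; split; lra.
Qed.

(** The constant that oscillation uses in dyadic annuli around a cube. *)
Definition osc_const : R :=
  (C3 + 2 * B) * (4 * n%:R) `^ delta * 8 ^+ n / (1 - decay).

Lemma osc_const_ge0 : 0 <= osc_const.
Proof.
apply: divr_ge0; last by rewrite subr_ge0 ltW// decay_lt1.
by rewrite !mulr_ge0 ?addr_ge0 ?powR_ge0 ?exprn_ge0 ?mulr_ge0.
Qed.

(** The point p is at distance at least a multiple of 2^m times the side from P.
For large m this is enough to use y-regularity, and in the finitely many other
annuli the size bound will do. *)
Lemma kernel_osc P p y y' m : cube_set P y -> cube_set P y' -> H p ->
  ~ carleson_box (pow_dilate m.+1 P) p ->
  `|k p.1 p.2 y - k p.1 p.2 y'| <=
  (C3 + 2 * B) * (4 * n%:R) `^ delta * 2 ^+ n *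
    (decay ^+ m / (2 ^+ m * side P) ^+ n).
Proof.
move=> Py Py' Hp nbox; have l0 := side_gt0 P; set l := side P in l0 *.
have n1 : 1 <= n%:R :> R by rewrite ler1n.
have m1 : 1 <= 2 ^+ m :> R by rewrite exprn_ege1// ler1n.
have pm0 : 0 < 2 ^+ m :> R by rewrite exprn_gt0.
pose b := 2 ^+ m * (l / 2).
have b0 : 0 < b by rewrite mulr_gt0// divr_gt0.
have far z : cube_set P z -> b <= norm_R1n p.1 (subRn p.2 z).
  move=> Pz; have := carleson_boxPn Hp nbox; rewrite side_pow_dilate -/l exprS.
  move=> [h|[i]] /=.
    apply: (le_trans _ (norm_R1n_ge_t _ _)); rewrite /b; nra.
  move=> hi; apply: (le_trans _ (norm_R1n_ge_coord _ _ i)); rewrite tnth_mktuple.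
  have := Pz i; rewrite -/l => /andP[h1 h2].
  have h3 : `|tnth z i - tnth P.1 i : R| <= l / 2 by rewrite ler_norml; lra.
  have := ler_normD (tnth p.2 i - tnth z i : R) (tnth z i - tnth P.1 i).
  rewrite addrA subrK /b => h4; nra.
have bn0 : 0 < b ^+ n by rewrite exprn_gt0.
have E (a : R) : 0 <= a -> (a * l / b) `^ delta / b ^+ n =
    (2 * a) `^ delta * 2 ^+ n * (decay ^+ m / (2 ^+ m * l) ^+ n).
  move=> a0; have -> : a * l = (2 * a) * (l / 2) by field.
  rewrite /b scale_powR ?mulr_ge0 ?divr_gt0// -[RHS]mulrA; congr (_ * _).
  have -> : 2 ^+ m * (l / 2) = 2 ^+ m * l / 2 by field.
  rewrite expr_div_n.
  have p2 : (2 : R) ^+ n != 0 by rewrite expf_neq0// pnatr_eq0.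
  by field; rewrite p2 /= expf_neq0// mulf_neq0 ?gt_eqF.
have pw : (2 * n%:R) `^ delta <= (4 * n%:R) `^ delta.
  by apply: ge0_ler_powR; rewrite ?nnegrE ?mulr_ge0 ?(ltW delta_gt0)//; lra.
have q0 : 0 <= decay ^+ m / (2 ^+ m * l) ^+ n.
  by rewrite divr_ge0 ?exprn_ge0 ?(ltW decay_gt0)// mulr_ge0// ltW.
have g0 : 0 <= 2 ^+ n * (decay ^+ m / (2 ^+ m * l) ^+ n).
  by rewrite mulr_ge0// exprn_ge0.
have [ab|ba] := lerP (n%:R * l) (b / 2).
  rewrite distrC.
  apply: (le_trans (@y_regularity_le _ _ _ _ delta_gt0 C3_ge0 _ _ _ y y'
    (n%:R * l) b ky Hp _ _ ab)).
  - apply: norm_Rn_le; first exact: ltW.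
    by move=> i; rewrite tnth_mktuple ltW//; exact: (cube_dist _ Py' Py).
  - by rewrite b0 far.
  rewrite E; last by rewrite (le_trans ler01).
  rewrite -!mulrA; apply: ler_pM => //; first by rewrite mulr_ge0 ?powR_ge0.
    by rewrite lerDl mulr_ge0.
  by rewrite ler_wpM2r.
have sz z : cube_set P z -> `|k p.1 p.2 z| <= B / b ^+ n.
  move=> Pz; rewrite (le_trans (ksize _ _ Hp))// ler_wpM2l// lef_pV2 ?posrE//.
    by rewrite ler_pXn2r ?nnegrE ?norm_R1n_ge0 ?(ltW b0)// far.
  by rewrite exprn_gt0// (lt_le_trans b0)// far.
rewrite (le_trans (ler_normB _ _))//.
apply: (@le_trans _ _ (2 * B / b ^+ n)).
  by have := sz _ Py; have := sz _ Py'; lra.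
(* Here 2^m < 4n, so the decaying factor is bounded below. *)
have h1 : 1 <= (4 * n%:R * l / (2 * b)) `^ delta.
  rewrite -[leLHS](_ : 1 `^ delta = 1); last by rewrite powR1.
  apply: ge0_ler_powR; rewrite ?nnegrE ?(ltW delta_gt0)//.
    by rewrite divr_ge0 ?mulr_ge0 ?(ltW l0) ?(ltW b0).
  rewrite ler_pdivlMr ?mulr_gt0// mul1r; lra.
have E2 : (4 * n%:R * l / (2 * b)) `^ delta / b ^+ n =
    (4 * n%:R) `^ delta * 2 ^+ n * (decay ^+ m / (2 ^+ m * l) ^+ n).
  have -> : 4 * n%:R * l / (2 * b) = 2 * n%:R * l / b by field; rewrite gt_eqF.
  rewrite E ?mulr_ge0//; congr (_ `^ _ * _ * _); lra.
set T := (4 * n%:R) `^ delta * _ * _ in E2.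
have -> : (C3 + 2 * B) * (4 * n%:R) `^ delta * 2 ^+ n *
    (decay ^+ m / (2 ^+ m * l) ^+ n) = (C3 + 2 * B) * T by rewrite /T !mulrA.
rewrite -E2 mulrA ler_pM2r ?invr_gt0//.
apply: (@le_trans _ _ (C3 + 2 * B)); first by rewrite lerDr.
by rewrite ler_peMr// addr_ge0// mulr_ge0.
Qed.

(** The mass of f in each dyadic dilate of P is bounded by its volume times the
Carleson functional at w, and the decay of kernel_osc makes the sum over the
dilates converge. *)
Lemma oscillation e f P y y' w c : 0 < e -> lifted e f ->
  (forall p, carleson_box (dilate 3%:pos P) p -> f p = 0) ->
  cube_set P y -> cube_set P y' -> cube_set P w -> (carleson f w <= c%:E)%E ->
  `|S_op k f y - S_op k f y'| <= osc_const * c.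
Proof.
move=> e0 fe fP Py Py' Pw fc; have mf := lifted_measurable fe.
have l0 := side_gt0 P.
have c0 : 0 <= c by rewrite -lee_fin (le_trans (carleson_ge0 f w)).
pose a m := (C3 + 2 * B) * (4 * n%:R) `^ delta * 2 ^+ n *
    (decay ^+ m / (2 ^+ m * side P) ^+ n).
have a0 m : 0 <= a m.
  have pm0 : 0 < 2 ^+ m :> R by rewrite exprn_gt0.
  rewrite /a; apply: mulr_ge0.
    by rewrite !mulr_ge0 ?addr_ge0 ?powR_ge0 ?exprn_ge0 ?mulr_ge0.
  by rewrite divr_ge0 ?exprn_ge0 ?(ltW decay_gt0)// mulr_ge0// ltW.
pose E m := carleson_box (pow_dilate m.+2 P).
have mE m : measurable (E m) by exact: measurable_carleson_box.
pose G m (p : R1n R n) : \bar R := (a m * (\1_(E m) p * `|f p|))%:E.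
have G0 m p : (0 <= G m p)%E.
  by rewrite lee_fin; apply: mulr_ge0 => //; exact: mulr_ge0.
have mG m : measurable_fun H (G m).
  apply/measurable_EFinP; apply: measurable_funM => //; apply: measurable_funM.
    exact/measurable_funTS/measurable_indic.
  exact: measurableT_comp.
rewrite -lee_fin.
apply: (le_trans (S_op_diff_le (lifted_converges _ e0 fe) (lifted_converges _ e0 fe))).
apply: (@le_trans _ _ (\int[nu]_(p in H) (\sum_(0 <= m <oo) G m p)%E)%E).
  apply: ge0_le_integral => //.
  - apply/measurable_EFinP; apply: measurable_funM.
      apply: measurableT_comp => //; apply: measurable_funB;
      exact: (measurable_kernel delta_gt0 C2_ge0).
    exact: measurableT_comp.
  - exact: ge0_emeasurable_sum.
  move=> p Hp; have [fp0|fp0] := eqVneq (f p) 0.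
    by rewrite fp0 normr0 mulr0; apply: nneseries_ge0.
  case: (ex_minnP (_ : exists m, `[< carleson_box (pow_dilate m P) p >])).
    by have [m hm] := pow_dilate_cover P Hp; exists m; apply/asboolP.
  move=> m /asboolP mP mmin.
  case: m mP mmin => [|[|m]] mP mmin.
  1,2: exfalso; move/eqP: fp0; apply; apply: fP; move: mP => [/andP[h1 h2] h3].
  1,2: split; first (rewrite h1 (lt_le_trans h2)// side_pow_dilate;
    rewrite /side /= ?expr0 ?expr1 ler_pM2r//; lra).
  1,2: move=> i; have := h3 i; rewrite side_pow_dilate.
  1,2: have -> : side (dilate 3%:pos%R P) = 3 * side P by [].
  1,2: rewrite ?expr0 ?expr1 /= => /andP[h4 h5]; apply/andP; split; lra.
  have nbox : ~ carleson_box (pow_dilate m.+1 P) p.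
    by move=> h; have := mmin m.+1; rewrite ltnn => /(_ (asboolT h)).
  apply: le_trans (nneseries_ge_term m (G0 ^~ p)).
  rewrite lee_fin indicE mem_set// mul1r ler_wpM2r//.
  exact: kernel_osc.
rewrite integral_nneseries//.
have E1 : osc_const * c = (C3 + 2 * B) * (4 * n%:R) `^ delta * 8 ^+ n * c / (1 - decay).
  by rewrite /osc_const; lra.
rewrite E1; apply: le_trans; last first.
  apply: nneseries_geometric_le; last by rewrite decay_gt0 decay_lt1.
  by rewrite !mulr_ge0 ?addr_ge0 ?powR_ge0 ?exprn_ge0 ?mulr_ge0.
apply: lee_nneseries => [m _ _|m _].
  by apply: integral_ge0 => p _; exact: G0.
rewrite /G; under eq_integral do rewrite EFinM.
rewrite ge0_integralZl_EFin//; last first.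
  apply/measurable_EFinP; apply: measurable_funM; last exact: measurableT_comp.
  exact/measurable_funTS/measurable_indic.
have -> : (\int[nu]_(p in H) (\1_(E m) p * `|f p|)%:E)%E = mass f (E m).
  transitivity (mass f (H `&` E m)); last first.
    by congr (mass f _); rewrite setIidr//; exact: carleson_box_halfspace.
  rewrite /mass integral_mkcondr; apply: eq_integral => p _; rewrite patchE indicE.
  by case: (p \in E m); rewrite ?mul1r ?mul0r.
have sE : side (pow_dilate m.+2 P) = 4 * (2 ^+ m * side P).
  by rewrite side_pow_dilate !exprS; lra.
apply: (@le_trans _ _ ((a m)%:E * (side (pow_dilate m.+2 P) ^+ n * c)%:E)%E).
  rewrite lee_wpmul2l ?lee_fin//.
  apply: (le_trans (mass_le_carleson f (pow_dilate_sub _ Pw))).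
  by rewrite EFinM lee_wpmul2l// lee_fin exprn_ge0// ltW// side_gt0.
rewrite -EFinM lee_fin le_eqVlt; apply/orP; left; apply/eqP.
rewrite sE exprMn /a.
have -> : (8 : R) ^+ n = 2 ^+ n * 4 ^+ n by rewrite -exprMn; congr (_ ^+ _); lra.
have ? : (2 ^+ m * side P) ^+ n != 0.
  by rewrite expf_neq0// gt_eqF// mulr_gt0// exprn_gt0.
by field.
Qed.

End lifted_functions.

(** * The weak type estimate *)

Section weak_type.
Context (R : realType) (n : nat) (n_gt0 : (0 < n)%N) (delta C1 C2 C3 B : R).
Context (delta_gt0 : 0 < delta) (C2_ge0 : 0 <= C2) (C3_ge0 : 0 <= C3)
  (B_ge0 : 0 <= B).
Context (D : int -> set (cube R n)) (HD : dyadic_system D).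
Context (k : kernel_fun R n) (kL2 : L2_carleson_estimate k C1).
Context (kx : x_regularity k delta C2) (ky : y_regularity k delta C3).
Context (ksize : forall (t : R) x y, 0 < t ->
  `|k t x y| <= B / norm_R1n t (subRn x y) ^+ n).
Implicit Types (P Q : cube R n) (x y z : Rn R n) (p : R1n R n).
Local Notation mu := (lebesgue_Rn R n).
Local Notation nu := (lebesgue_R1n R n).
Local Notation H := (@halfspace R n).
Let mH : measurable H := @measurable_halfspace R n.
Local Notation q := (decay delta).

Section decomposition.
Context (e : R) (f : R1n R n -> R) (l N : R).
Context (e0 : 0 < e) (fe : lifted e f) (l0 : 0 < l) (fN : (mass f H <= N%:E)%E).
Let mf : measurable_fun H f := lifted_measurable fe.
Local Notation heavy := (heavy_cubes D f l).
Local Notation stopped := (maximal_cube heavy).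

Let heavy_dy : heavy `<=` dyadic_cubes D. Proof. by move=> P []. Qed.
Let cst : countable stopped. Proof. exact: (countable_maximal_cube HD heavy_dy). Qed.
Let tst : trivIset stopped (@carleson_box R n).
Proof. by apply: trivIset_carleson_box; exact: (trivIset_maximal_cube n_gt0 HD heavy_dy). Qed.
Let box_mass_le P : (mass f (carleson_box P) <= mass f H)%E.
Proof.
apply: le_mass => //; first exact: measurable_carleson_box.
exact: carleson_box_halfspace.
Qed.

Definition stopped_region := \bigcup_(P in stopped) carleson_box P.

Lemma measurable_stopped_region : measurable stopped_region.
Proof.
apply: countable_bigcup_measurable => // P _; exact: measurable_carleson_box.
Qed.

Definition upper_half P : set (R1n R n) :=
  `[side P / 2, side P[%classic `*` cube_set P.

Lemma measurable_upper_half P : measurable (upper_half P).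
Proof. by apply: measurableX; [exact: measurable_itv|exact: measurable_cube]. Qed.

Lemma upper_half_sub P : upper_half P `<=` carleson_box P.
Proof.
move=> [t x] [/=]; rewrite in_itv /= => /andP[h1 h2] Px; split => //=.
by rewrite h2 andbT; have := side_gt0 P; lra.
Qed.

Lemma lebesgue_upper_half P :
  nu (upper_half P) = (side P / 2 * side P ^+ n)%:E.
Proof.
rewrite /lebesgue_R1n /= product_measure1E.
- rewrite EFinM; congr (_ * _)%E; last exact: lebesgue_cube.
  transitivity (lebesgue_measure (`[side P / 2, side P[%classic : set R)) => //.
  rewrite lebesgue_measure_itv /= lte_fin ifT; last by have := side_gt0 P; lra.
  by rewrite -EFinB; congr EFin; lra.
- exact: measurable_itv.
- exact: measurable_cube.
Qed.

(** The mass of f in a stopped box is spread over the upper half of the box,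
where no strictly smaller box reaches. *)
Definition spread P : R :=
  (\int[nu]_(p in carleson_box P) f p) / (side P / 2 * side P ^+ n).

(** The decomposition f = good + bad of Calderon and Zygmund, with Carleson boxes
as the atoms: the bad part has mean zero on each stopped box. *)
Definition good p : R :=
  if pselect (exists P, stopped P /\ carleson_box P p) is left h
  then spread (projT1 (cid h)) * \1_(upper_half (projT1 (cid h))) p else f p.

Lemma good_stopped P p : stopped P -> carleson_box P p ->
  good p = spread P * \1_(upper_half P) p.
Proof.
move=> sP Pp; rewrite /good; case: pselect => [h|]; last by case; exists P.
have [sQ Qp] := projT2 (cid h).
by have -> : projT1 (cid h) = P by apply: tst => //; exists p.
Qed.

Lemma good_out p : ~ stopped_region p -> good p = f p.
Proof.
move=> np; rewrite /good; case: pselect => // -[P [sP Pp]].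
by exfalso; apply: np; exists P.
Qed.

Let upper_volume_gt0 P : 0 < side P / 2 * side P ^+ n.
Proof. by rewrite mulr_gt0 ?exprn_gt0 ?divr_gt0// side_gt0. Qed.

Lemma measurable_good_box P : stopped P -> measurable_fun (carleson_box P) good.
Proof.
move=> sP; apply: (eq_measurable_fun (fun p => spread P * \1_(upper_half P) p)).
  by move=> p /set_mem Pp; rewrite (good_stopped sP).
apply: measurable_funM => //; apply/measurable_funTS/measurable_indic.
exact: measurable_upper_half.
Qed.

Lemma measurable_good : measurable_fun H good.
Proof.
have -> : H = (H `\` stopped_region) `|` stopped_region.
  rewrite setDKU// => p [P _]; exact: carleson_box_halfspace.
have mS := measurable_stopped_region.
apply/measurable_funU => //; first exact: measurableD.
split.
  apply: (eq_measurable_fun f); first by move=> p /set_mem[_ /good_out].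
  by apply: measurable_funS mf => //; exact: subDsetl.
apply: measurable_fun_countable_bigcup => // P sP.
  exact: measurable_carleson_box.
exact: measurable_good_box.
Qed.

Let int_box P : nu.-integrable (carleson_box P) (EFin \o f).
Proof.
apply: integrableS fe.1 => //; first exact: measurable_carleson_box.
exact: carleson_box_halfspace.
Qed.

Lemma mass_good_box P : stopped P ->
  (mass good (carleson_box P) <= mass f (carleson_box P))%E.
Proof.
move=> sP; have mP := measurable_carleson_box P; have mU := measurable_upper_half P.
rewrite /mass (eq_integral (fun p => (`|spread P|)%:E * (\1_(upper_half P) p)%:E)%E).
  rewrite ge0_integralZl_EFin//; last first.
    exact/measurable_EFinP/measurable_funTS/measurable_indic.
  rewrite integral_indic// (setIidl (@upper_half_sub P)) lebesgue_upper_half.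
  rewrite -EFinM /spread normrM normfV (gtr0_norm (upper_volume_gt0 P)).
  rewrite divfK ?gt_eqF// EFin_normr_Rintegral//.
  apply: le_trans (le_abse_integral _ _ _) _ => //.
  exact: measurable_int (int_box P).
move=> p /set_mem Pp; rewrite (good_stopped sP Pp) normrM -EFinM.
by rewrite [`|\1_(_) p|]ger0_norm.
Qed.

Lemma mass_good_le A : measurable A -> A `<=` H ->
  (forall P, stopped P -> carleson_box P `<=` A \/
     carleson_box P `&` A = set0) ->
  (mass good A <= mass f A)%E.
Proof.
move=> mA AH PA; have mS := measurable_stopped_region.
pose I := [set P | stopped P /\ carleson_box P `<=` A].
have cI : countable I by apply: sub_countable cst; apply: subset_card_le => P [].
have tI : trivIset I (@carleson_box R n) by move=> P Q [sP _] [sQ _]; exact: tst.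
have mI P : I P -> measurable (carleson_box P) by move=> _; exact: measurable_carleson_box.
have IH P : I P -> carleson_box P `<=` H by move=> _; exact: carleson_box_halfspace.
have AE : A = (A `\` stopped_region) `|` \bigcup_(P in I) carleson_box P.
  apply/seteqP; split=> p.
    move=> Ap; have [[P sP Pp]|nSp] := pselect (stopped_region p); last by left.
    right; exists P => //; split => //; have [//|PA0] := PA P sP.
    by have : (carleson_box P `&` A) p by []; rewrite PA0.
  by move=> [[]//|[P [_ PsA] /PsA]].
have mU : measurable (\bigcup_(P in I) carleson_box P).
  exact: countable_bigcup_measurable.
have dAU : [disjoint A `\` stopped_region & \bigcup_(P in I) carleson_box P]%classic.
  apply/disj_setPS => p [[_ np] [P [sP _] Pp]]; apply: np; by exists P.
have split_mass h : measurable_fun H h -> mass h A =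
    (mass h (A `\` stopped_region) + \esum_(P in I) mass h (carleson_box P))%E.
  move=> mh; rewrite -mass_countable_bigcup// /mass [in LHS]AE.
  rewrite ge0_integral_setU//; first exact: measurableD.
  by rewrite -AE; exact: measurable_normE.
rewrite !split_mass//; last exact: measurable_good.
apply: leeD; last by apply: le_esum => P [sP _]; exact: mass_good_box.
rewrite le_eqVlt; apply/orP; left; apply/eqP; apply: eq_integral => p.
by move=> /set_mem[_ /good_out ->].
Qed.

Lemma mass_good_H : (mass good H <= N%:E)%E.
Proof.
apply: le_trans fN; apply: mass_good_le => // P _.
by left; exact: carleson_box_halfspace.
Qed.

Lemma stopped_side P : stopped P -> e < side P.
Proof.
move=> [[dP hP] _]; rewrite ltNge; apply/negP => Pe.
move: hP; rewrite ltNge => /negP; apply.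
rewrite /mass (eq_integral (fun=> 0%E)).
  by rewrite integral0 lee_fin mulr_ge0 ?exprn_ge0 ?(ltW l0)// ltW// side_gt0.
move=> p /set_mem Pp; rewrite fe.2 ?normr0//; first exact: carleson_box_halfspace Pp.
by case: Pp => /andP[_ pP] _; rewrite (le_trans (ltW pP)).
Qed.

Lemma lifted_good : lifted (e / 2) good.
Proof.
split.
  apply/L1_halfspaceP; split; first exact: measurable_good.
  exact: le_lt_trans mass_good_H (ltry _).
move=> p Hp pe; have [[P sP Pp]|nSp] := pselect (stopped_region p); last first.
  have e2e : e / 2 <= e by have := e0; lra.
  by rewrite good_out// fe.2//; exact: le_trans pe e2e.
rewrite (good_stopped sP Pp) indicE memNset ?mulr0// => -[/=].
by rewrite in_itv /= => /andP[h _] _; have := stopped_side sP; have := le_trans h pe; lra.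
Qed.

(** The dyadic parent of a stopped cube is not heavy. *)
Lemma mass_f_stopped P : stopped P ->
  (mass f (carleson_box P) <= (2 ^+ n * l * side P ^+ n)%:E)%E.
Proof.
move=> [[[j _ DP] hP] mP]; have [T] := dyadic_ancestor n_gt0 HD 1 DP.
move=> DT PT; have dT : dyadic_cubes D T by exists (j - 1%:Z).
have sT : side T = 2 * side P.
  by rewrite (dyadic_side HD DP) (dyadic_side HD DT) opprB expfzDr ?pnatr_eq0.
have nhT : ~ heavy T.
  move=> hT; have : side T <= side P.
    apply: (cube_set_side n_gt0); apply: mP => //.
    by exists P.1; split; [exact: cube_center|exact/PT/cube_center].
  by rewrite sT; have := side_gt0 P; lra.
have : (mass f (carleson_box T) <= (l * side T ^+ n)%:E)%E.
  by rewrite leNgt; apply/negP => h; apply: nhT.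
rewrite sT exprMn mulrA (mulrC l); apply: le_trans; apply: le_mass => //.
- exact: measurable_carleson_box.
- exact: measurable_carleson_box.
- exact: carleson_box_halfspace.
- exact: (carleson_boxS n_gt0).
Qed.

(** A cube strictly inside a stopped cube has a box that misses the upper half,
where the good part lives; on any other cube the good part has no more mass
than f, and the cube is stopped or not heavy. *)
Lemma good_mean_le Q : dyadic_cubes D Q ->
  (mass good (carleson_box Q) <= (2 ^+ n * l * side Q ^+ n)%:E)%E.
Proof.
move=> dQ; have lQ := side_gt0 Q.
have [[P [sP QP nQP]]|noP] :=
    pselect (exists P, [/\ stopped P, cube_set Q `<=` cube_set P & Q <> P]).
  rewrite /mass (eq_integral (fun=> 0%E)).
    by rewrite integral0 lee_fin !mulr_ge0 ?exprn_ge0// ltW.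
  move=> p /set_mem Qp; have Pp := carleson_boxS n_gt0 QP Qp.
  rewrite (good_stopped sP Pp) indicE memNset ?mulr0 ?normr0// => -[/=].
  rewrite in_itv /= => /andP[h _] _; case: Qp => /andP[_ pQ] _.
  have := le_lt_trans h pQ.
  by have := dyadic_proper_side n_gt0 HD (heavy_dy sP.1) dQ QP nQP; lra.
apply: (@le_trans _ _ (mass f (carleson_box Q))).
  apply: mass_good_le; [exact: measurable_carleson_box|exact: carleson_box_halfspace|].
  move=> P sP; have [PQ|PQ] := pselect (cube_set P `&` cube_set Q !=set0).
    left; apply: (carleson_boxS n_gt0).
    have [QP|//] := dyadic_nestedW n_gt0 HD (heavy_dy sP.1) dQ PQ.
    have [->//|nQP] := pselect (Q = P).
    by exfalso; apply: noP; exists P.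
  right; apply/seteqP; split=> // p [[_ Pp] [_ Qp]]; apply: PQ; by exists p.2.
have [hQ|nhQ] := pselect (heavy Q).
  have [P sP QP] := maximal_cube_exists n_gt0 HD heavy_dy
    (heavy_cubes_side n_gt0 mf l0 fN) hQ.
  have [->|nQP] := pselect (Q = P); first exact: mass_f_stopped.
  by exfalso; apply: noP; exists P.
apply: (@le_trans _ _ (l * side Q ^+ n)%:E).
  by rewrite leNgt; apply/negP => h; apply: nhQ.
rewrite lee_fin ler_wpM2r ?exprn_ge0 ?(ltW lQ)// ler_peMl ?(ltW l0)//.
by rewrite exprn_ege1// ler1n.
Qed.

Lemma S_good_le : (mu [set y | (l / 2 < `|S_op k good y|)%R] <=
  (16 * C1 ^+ 2 * (100 ^+ n * 2 ^+ n) * (N / l))%:E)%E.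
Proof.
have e20 : 0 < e / 2 by rewrite divr_gt0.
have gl := lifted_good.
have gc y : S_converges k good y.
  exact: (lifted_converges n_gt0 delta_gt0 C2_ge0 B_ge0 kx ksize y e20 gl).
have oS : open_Rn [set y | l / 2 < `|S_op k good y|].
  exact: (open_S_op n_gt0 delta_gt0 C2_ge0 C3_ge0 B_ge0 kx ky ksize e20 gl).
have L0 : 0 < 2 ^+ n * l by rewrite mulr_gt0// exprn_gt0.
have l20 : 0 <= l / 2 by rewrite divr_ge0// ltW.
have := L2_carleson_estimate_le kL2 measurable_good gc
  (carleson_L2 n_gt0 HD measurable_good L0 mass_good_H good_mean_le)
  (measurable_open_Rn oS) l20 (fun y h => ltW h).
rewrite -lee_pdivlMl ?exprn_gt0 ?divr_gt0// => /le_trans; apply.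
rewrite -EFinM lee_fin le_eqVlt; apply/orP; left; apply/eqP.
by field; rewrite gt_eqF.
Qed.


Definition bad_const : R := 2 * (C2 * (2 * (n%:R + 1)) `^ delta * 2 ^+ n).

Let bad_const_ge0 : 0 <= bad_const.
Proof. by rewrite mulr_ge0// !mulr_ge0 ?powR_ge0 ?exprn_ge0. Qed.

(** The profile of the tail of S applied to a function of mean zero on the
box of P: its integral is bounded independently of P. *)
Definition tail_term P m y : R :=
  q ^+ m / (2 ^+ m * side P) ^+ n * \1_(open_cube P.1 (2 ^+ m * side P)) y.

Definition tail P y : \bar R := (\sum_(0 <= m <oo) (tail_term P m y)%:E)%E.

Lemma tail_term_ge0 P m y : 0 <= tail_term P m y.
Proof.
apply: mulr_ge0 => //; apply: divr_ge0.
  by rewrite exprn_ge0// ltW// decay_gt0.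
by rewrite exprn_ge0// mulr_ge0 ?exprn_ge0// ltW// side_gt0.
Qed.

Lemma measurable_tail_term P m :
  measurable_fun setT (fun y => (tail_term P m y)%:E).
Proof.
apply/measurable_EFinP; apply: measurable_funM => //.
by apply: measurable_indic; exact: measurable_open_cube.
Qed.

Lemma tail_ge0 P y : (0 <= tail P y)%E.
Proof. by apply: nneseries_ge0 => m _ _; rewrite lee_fin tail_term_ge0. Qed.

Lemma measurable_tail P : measurable_fun setT (tail P).
Proof.
apply: ge0_emeasurable_sum; first by move=> m y _ _; rewrite lee_fin tail_term_ge0.
by move=> m _; exact: measurable_tail_term.
Qed.

Lemma integral_tail_le P : (\int[mu]_y tail P y <= (2 ^+ n / (1 - q))%:E)%E.
Proof.
have lP := side_gt0 P.
rewrite /tail integral_nneseries//; last 2 first.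
- exact: measurable_tail_term.
- by move=> m y _; rewrite lee_fin tail_term_ge0.
apply: le_trans (nneseries_geometric_le _ _); last 2 first.
- exact: exprn_ge0.
- by rewrite decay_gt0 decay_lt1.
apply: lee_nneseries => [m _ _|m _].
  by apply: integral_ge0 => y _; rewrite lee_fin tail_term_ge0.
have pm : 0 < 2 ^+ m * side P by rewrite mulr_gt0// exprn_gt0.
rewrite /tail_term; under eq_integral do rewrite EFinM.
rewrite ge0_integralZl_EFin//; last 2 first.
- by apply/measurable_EFinP; apply: measurable_indic; exact: measurable_open_cube.
- by rewrite divr_ge0 ?exprn_ge0 ?(ltW (decay_gt0 _))// ltW.
rewrite integral_indic//; last exact: measurable_open_cube.
rewrite setIT [X in (_ * X)%E](_ : _ = ((2 * (2 ^+ m * side P)) ^+ n)%:E); last first.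
  exact: lebesgue_open_cube.
rewrite -EFinM lee_fin; move: (2 ^+ m * side P) pm => s s0.
have sn : s ^+ n != 0 by rewrite gt_eqF// exprn_gt0.
rewrite le_eqVlt; apply/orP; left; apply/eqP.
by rewrite exprMn; field.
Qed.

(** The mean of the bad part on the box of P is zero, so the kernel may be
replaced by its difference with the value at a reference point. This point is
taken below the support of the bad part, because x-regularity compares a
point with higher ones. *)
Lemma bad_box_le P y : stopped P -> ~ open_cube P.1 (2 ^+ n.+1 * side P) y ->
  (`|\int[nu]_(p in carleson_box P) (k p.1 p.2 y * (f p - good p))%:E| <=
   (bad_const * fine (mass f (carleson_box P)))%:E * tail P y)%E.
Proof.
move=> sP nPy; have lP := side_gt0 P; set l' := side P in lP nPy *.
have mP := measurable_carleson_box P.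
have e4 : 0 < e / 4 by rewrite divr_gt0.
have lg := lifted_good.
case: (ex_minnP (_ : exists m, `[< open_cube P.1 (2 ^+ m * l') y >])).
  pose S := \sum_(i < n) `|tnth y i - tnth P.1 i : R|.
  exists (Num.Def.archi_bound (S / l')); apply/asboolP => i.
  have : S / l' < 2 ^+ Num.Def.archi_bound (S / l') by exact: upper_nthrootP.
  rewrite ltr_pdivrMr//; apply: le_lt_trans.
  by rewrite /S (bigD1 i)//= lerDl sumr_ge0.
move=> m /asboolP ym mmin.
have nm : (n.+1 < m)%N.
  rewrite ltnNge; apply/negP => mn; apply: nPy => i; apply: lt_le_trans (ym i) _.
  by rewrite ler_pM2r// ler_weXn2l// ler1n.
case: m nm ym mmin => // m nm ym mmin.
have [i yi] : exists i, 2 ^+ m * l' <= `|tnth y i - tnth P.1 i : R|.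
  apply: contrapT => /forallNP h.
  have : (m.+1 <= m)%N.
    by apply: mmin; apply/asboolP => i; rewrite ltNge; apply/negP/h.
  by rewrite ltnn.
have n1m : n%:R + 1 <= 2 ^+ m / 2 :> R.
  case: m nm {ym mmin yi} => [//|m] nm.
  rewrite exprS mulrAC divff ?pnatr_eq0// mul1r natr1 -natrX ler_nat.
  by apply: leq_trans (ltn_expl m (ltnSn 1)); lia.
pose c := C2 * (2 * (n%:R + 1)) `^ delta * 2 ^+ n *
  (q ^+ m.+1 / (2 ^+ m.+1 * l') ^+ n).
have pm0 : 0 < 2 ^+ m * l' by rewrite mulr_gt0// exprn_gt0.
have c0 : 0 <= c.
  apply: mulr_ge0; first by rewrite !mulr_ge0 ?powR_ge0 ?exprn_ge0.
  by rewrite divr_ge0 ?exprn_ge0 ?(ltW (decay_gt0 _))// exprS -mulrA mulr_ge0// ltW.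
pose k0 := k (e / 4) P.1 y.
have kc p : carleson_box P p -> f p - good p != 0 -> `|k p.1 p.2 y - k0| <= c.
  move=> Pp fgp; have Hp := carleson_box_halfspace Pp.
  have ep : e / 2 < p.1.
    rewrite ltNge; apply/negP => h; move/eqP: fgp; apply.
    have h' : p.1 <= e by apply: le_trans h _; have := e0; lra.
    by rewrite fe.2// lg.2// subrr.
  have e24 : e / 4 < e / 2 by have := e0; lra.
  apply: (le_trans (@x_regularity_le _ _ _ _ delta_gt0 C2_ge0 _ _ _ _ _ y
    ((n%:R + 1) * l') (2 ^+ m * l') kx e4 (lt_trans e24 ep) _ _ _)).
  - case: Pp => /andP[_ pP] Pp; rewrite -/l' in pP.
    apply: (le_trans (@norm_R1n_le _ _ _ _ l' _ _ _)).
    + by rewrite subr_ge0 ltW// (lt_trans e24).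
    + exact: ltW.
    + move=> j; rewrite tnth_mktuple ltW//.
      exact: (cube_dist _ Pp (cube_center P)).
    + have h : p.1 - e / 4 <= l'.
        by rewrite (le_trans _ (ltW pP))// gerBl ltW.
      by rewrite mulrDl mul1r addrC lerD2l.
  - rewrite pm0 /=; apply: (le_trans _ (norm_R1n_ge_coord _ _ i)).
    by rewrite tnth_mktuple distrC.
  - by have := lP; nra.
  rewrite scale_powR ?addr_ge0//.
  rewrite /c -!mulrA ler_wpM2l//.
  have -> : (2 * (n%:R + 1)) `^ delta = 2 `^ delta * (n%:R + 1) `^ delta :> R.
    by rewrite powRM ?addr_ge0.
  have qE : 2 `^ delta * q = 1 :> R.
    by rewrite /decay -powRM// divff ?pnatr_eq0// powR1.
  rewrite le_eqVlt; apply/orP; left; apply/eqP.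
  have -> : (2 ^+ m.+1 * l') ^+ n = 2 ^+ n * (2 ^+ m * l') ^+ n.
    by rewrite exprS -mulrA exprMn.
  rewrite exprS.
  transitivity ((2 `^ delta * q) * (n%:R + 1) `^ delta *
    (q ^+ m / (2 ^+ m * l') ^+ n)); first by rewrite qE mul1r.
  have p2n : (2 : R) ^+ n != 0 by rewrite expf_neq0// pnatr_eq0.
  have pmn : (2 ^+ m * l') ^+ n != 0 by rewrite gt_eqF// exprn_gt0.
  by field; rewrite p2n pmn.
have ifg : nu.-integrable (carleson_box P) (EFin \o (fun p => f p - good p)).
  apply: integrableS (L1_halfspaceB fe.1 lg.1) => //.
  exact: carleson_box_halfspace.
have ig : nu.-integrable (carleson_box P) (EFin \o good).
  by apply: integrableS lg.1 => //; exact: carleson_box_halfspace.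
have fy : S_converges k f y.
  exact: (lifted_converges n_gt0 delta_gt0 C2_ge0 B_ge0 kx ksize y e0 fe).
have gy : S_converges k good y.
  apply: (lifted_converges n_gt0 delta_gt0 C2_ge0 B_ge0 kx ksize y _ lg).
  by rewrite divr_gt0.
have ikfg : nu.-integrable (carleson_box P)
    (EFin \o (fun p => k p.1 p.2 y * (f p - good p))).
  apply: integrableS (S_opB fy gy).1 => //; exact: carleson_box_halfspace.
have int0 : \int[nu]_(p in carleson_box P) (f p - good p) = 0.
  rewrite (RintegralB mP (int_box P) ig).
  have -> : \int[nu]_(p in carleson_box P) good p =
      \int[nu]_(p in carleson_box P) (spread P * \1_(upper_half P) p).
    by apply: eq_Rintegral => p /set_mem Pp; rewrite (good_stopped sP).
  have mU := measurable_upper_half P.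
  have iU : nu.-integrable (carleson_box P) (EFin \o (\1_(upper_half P) : _ -> R)).
    apply/integrableP; split.
      exact/measurable_EFinP/measurable_funTS/measurable_indic.
    rewrite /=; under eq_integral do rewrite ger0_norm//.
    by rewrite integral_indic// (setIidl (@upper_half_sub P)) lebesgue_upper_half ltry.
  rewrite RintegralZl// /Rintegral integral_indic// (setIidl (@upper_half_sub P)).
  rewrite lebesgue_upper_half /= /spread divfK ?subrr//.
  by rewrite gt_eqF// upper_volume_gt0.
have mdiff : measurable_fun (carleson_box P) (fun p => `|f p - good p|%:E).
  apply/measurable_EFinP; apply: measurableT_comp => //.
  by apply/measurable_EFinP; exact: measurable_int ifg.
have massP : mass f (carleson_box P) = (fine (mass f (carleson_box P)))%:E.
  rewrite fineK// ge0_fin_numE ?mass_ge0//.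
  by rewrite (le_lt_trans (box_mass_le P))// (le_lt_trans fN)// ltry.
have mfg : (mass (fun p => (f p - good p)%R) (carleson_box P) <=
    2%:E * mass f (carleson_box P))%E.
  apply: (@le_trans _ _ (mass f (carleson_box P) + mass good (carleson_box P))%E).
    rewrite /mass -ge0_integralD//; last 2 first.
    - by apply/measurable_EFinP; apply: measurableT_comp => //;
        apply: measurable_funS mf => //; exact: carleson_box_halfspace.
    - by apply/measurable_EFinP; apply: measurableT_comp => //;
        exact: measurable_good_box.
    apply: ge0_le_integral => //.
    - apply: emeasurable_funD; apply/measurable_EFinP; apply: measurableT_comp => //.
        by apply: measurable_funS mf => //; exact: carleson_box_halfspace.
      exact: measurable_good_box.
    by move=> p _; rewrite -EFinD lee_fin ler_normB.
  apply: (le_trans (leeD2l _ (mass_good_box sP))).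
  by rewrite massP -EFinD -EFinM lee_fin; lra.
set F := fine _ in massP *.
have F0 : 0 <= F by rewrite fine_ge0// mass_ge0.
have ik0 : nu.-integrable (carleson_box P)
    (EFin \o (fun p => k0 * (f p - good p))).
  exact: (integrableZl mP k0 ifg).
apply: (@le_trans _ _ (c%:E * mass (fun p => (f p - good p)%R) (carleson_box P))%E).
  have -> : (\int[nu]_(p in carleson_box P) (k p.1 p.2 y * (f p - good p))%:E =
      \int[nu]_(p in carleson_box P) ((k p.1 p.2 y - k0) * (f p - good p))%:E)%E.
    rewrite -[LHS]sube0 -(_ : (\int[nu]_(p in carleson_box P) (k0 * (f p - good p))%:E = 0)%E).
      rewrite -integralB//; apply: eq_integral => p _.
      by rewrite -EFinB mulrBl.
    under eq_integral do rewrite EFinM.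
    rewrite integralZl//.
    have -> : (\int[nu]_(p in carleson_box P) (f p - good p)%:E = 0)%E; last by rewrite mule0.
    by rewrite -[LHS]fineK ?[fine _]int0//; exact: (integrable_fin_num mP ifg).
  have ikk : nu.-integrable (carleson_box P)
      (EFin \o (fun p => (k p.1 p.2 y - k0) * (f p - good p))).
    have := integrableB mP ikfg ik0; apply: eq_integrable => // p _.
    by rewrite /= -EFinB mulrBl.
  apply: le_trans (le_abse_integral _ _ _) _ => //; first exact: measurable_int ikk.
  rewrite /mass -ge0_integralZl_EFin//.
  apply: ge0_le_integral => //.
  - apply: measurableT_comp => //; exact: measurable_int ikk.
  - exact: measurable_funeM.
  move=> p Pp; rewrite -EFinM lee_fin normrM.
  have [->|fgp] := eqVneq (f p - good p) 0; first by rewrite normr0 !mulr0.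
  by rewrite ler_wpM2r// kc.
apply: (@le_trans _ _ (c%:E * (2%:E * F%:E))%E).
  by rewrite lee_wpmul2l ?lee_fin// -massP.
apply: (@le_trans _ _ ((bad_const * F)%:E * (tail_term P m.+1 y)%:E)%E); last first.
  rewrite lee_wpmul2l//; first by rewrite lee_fin mulr_ge0.
  by apply: (nneseries_ge_term m.+1) => j; rewrite lee_fin tail_term_ge0.
rewrite -!EFinM lee_fin /tail_term indicE mem_set// mulr1.
rewrite le_eqVlt; apply/orP; left; apply/eqP.
by rewrite /c /bad_const -/l'; ring.
Qed.

Lemma S_bad_le y :
  (forall P, stopped P -> ~ open_cube P.1 (2 ^+ n.+1 * side P) y) ->
  (`|S_op k f y - S_op k good y|%:E <= \esum_(P in stopped)
    ((bad_const * fine (mass f (carleson_box P)))%:E * tail P y))%E.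
Proof.
move=> nP; have lg := lifted_good; have mS := measurable_stopped_region.
have fy : S_converges k f y.
  exact: (lifted_converges n_gt0 delta_gt0 C2_ge0 B_ge0 kx ksize y e0 fe).
have gy : S_converges k good y.
  apply: (lifted_converges n_gt0 delta_gt0 C2_ge0 B_ge0 kx ksize y _ lg).
  by rewrite divr_gt0.
have [iS <-] := S_opB fy gy.
have SH : stopped_region `<=` H by move=> p [P _]; exact: carleson_box_halfspace.
rewrite EFin_normr_Rintegral//.
have -> : (\int[nu]_(p in H) (k p.1 p.2 y * (f p - good p))%:E =
    \int[nu]_(p in stopped_region) (k p.1 p.2 y * (f p - good p))%:E)%E.
  rewrite -[in RHS](setIidr SH) integral_mkcondr; apply: eq_integral => p _.
  rewrite patchE; case: ifPn => // /negP np.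
  rewrite good_out ?subrr ?mulr0//; by move=> h; apply: np; exact/mem_set.
apply: (le_trans (abse_integral_countable_bigcup _ _ _ _)) => //.
- by move=> P _; exact: measurable_carleson_box.
- by apply: integrableS iS.
by apply: le_esum => P sP; apply: bad_box_le => //; exact: nP.
Qed.

Definition weak_const : R := 16 * C1 ^+ 2 * (100 ^+ n * 2 ^+ n) +
  ((2 * 2 ^+ n.+1) ^+ n + 2 * bad_const * (2 ^+ n / (1 - q))).

Lemma weak_const_ge0 : 0 <= weak_const.
Proof.
have q1 : 0 <= 1 - q by rewrite subr_ge0 ltW// decay_lt1.
have p2 m : 0 <= 2 ^+ m :> R by rewrite exprn_ge0.
apply: addr_ge0.
  by apply: mulr_ge0; apply: mulr_ge0; rewrite ?sqr_ge0 ?exprn_ge0.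
apply: addr_ge0; first by apply: exprn_ge0; exact: mulr_ge0.
apply: mulr_ge0; first by apply: mulr_ge0 => //; exact: bad_const_ge0.
by apply: divr_ge0 => //; exact: p2.
Qed.

(** The good part is controlled by the L2 estimate. Off the dilated stopped
cubes, the bad part is dominated by a sum of tails whose integral is at most
a multiple of the mass. *)
Lemma weak_type : (mu [set y | (l < `|S_op k f y|)%R] <= (weak_const * (N / l))%:E)%E.
Proof.
have l20 : 0 < l / 2 by rewrite divr_gt0.
have N0 : 0 <= N by rewrite -lee_fin (le_trans (mass_ge0 f H)).
have q1 : 0 < 1 - q by rewrite subr_gt0 decay_lt1.
pose a P := bad_const * fine (mass f (carleson_box P)).
have a0 P : 0 <= a P by rewrite mulr_ge0// fine_ge0// mass_ge0.
pose Phi y := (\esum_(P in stopped) ((a P)%:E * tail P y))%E.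
have at0 P y : stopped P -> (0 <= (a P)%:E * tail P y)%E.
  by move=> _; apply: mule_ge0; [rewrite lee_fin; exact: a0|exact: tail_ge0].
have mat P : stopped P -> measurable_fun setT (fun y => (a P)%:E * tail P y)%E.
  by move=> _; apply: measurable_funeM; exact: measurable_tail.
have [mPhi intPhi] := @ge0_integral_esum R _ stopped _ _ mu setT _ cst measurableT mat at0.
have Phi0 y : (0 <= Phi y)%E by apply: esum_ge0 => P sP; exact: at0.
have esum_mass : (\esum_(P in stopped) mass f (carleson_box P) <= N%:E)%E.
  rewrite -mass_countable_bigcup//.
  - apply: le_trans fN; apply: le_mass => //; first exact: measurable_stopped_region.
    by move=> p [P _]; exact: carleson_box_halfspace.
  - by move=> P _; exact: measurable_carleson_box.
  - by move=> P _; exact: carleson_box_halfspace.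
have tail_int : (\int[mu]_y Phi y <= (bad_const * (2 ^+ n / (1 - q)) * N)%:E)%E.
  rewrite intPhi.
  apply: (@le_trans _ _ (\esum_(P in stopped)
      ((bad_const * (2 ^+ n / (1 - q)))%:E * mass f (carleson_box P)))%E).
    apply: le_esum => P sP.
    rewrite ge0_integralZl_EFin//; last 2 first.
    - by move=> y _; exact: tail_ge0.
    - exact: measurable_tail.
    apply: (@le_trans _ _ ((a P)%:E * (2 ^+ n / (1 - q))%:E)%E).
      by rewrite lee_wpmul2l ?lee_fin// integral_tail_le.
    rewrite -[mass f _ in leRHS]fineK; last first.
      rewrite ge0_fin_numE ?mass_ge0//.
      by rewrite (le_lt_trans (box_mass_le P))// (le_lt_trans fN)// ltry.
    by rewrite -!EFinM lee_fin /a; lra.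
  have cq0 : 0 <= bad_const * (2 ^+ n / (1 - q)).
    by rewrite mulr_ge0// divr_ge0 ?exprn_ge0// ltW.
  rewrite (esumZl cst (fun P _ => mass_ge0 f (carleson_box P)) cq0).
  by rewrite [leRHS]EFinM lee_wpmul2l.
pose A1 := [set y | (l / 2 < `|S_op k good y|)%R].
pose A2 := \bigcup_(P in stopped) open_cube P.1 (2 ^+ n.+1 * side P).
pose A3 := [set y | ((l / 2)%:E <= Phi y)%E].
have mA1 : measurable A1.
  apply: measurable_open_Rn.
  apply: (open_S_op n_gt0 delta_gt0 C2_ge0 C3_ge0 B_ge0 kx ky ksize _ lifted_good).
  by rewrite divr_gt0.
have mA2 : measurable A2.
  by apply: countable_bigcup_measurable => // P _; exact: measurable_open_cube.
have mA3 : measurable A3.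
  by rewrite -[A3]setTI; exact: emeasurable_fun_c_infty.
have sub : [set y | (l < `|S_op k f y|)%R] `<=` A1 `|` (A2 `|` A3).
  move=> y /= ly; have [yA1|yA1] := pselect (A1 y); first by left.
  right; have [yA2|yA2] := pselect (A2 y); first by left.
  right; rewrite /A3 /=; apply: (le_trans _ (S_bad_le _)); last first.
    by move=> P sP Py; apply: yA2; exists P.
  rewrite lee_fin; move/negP : yA1; rewrite -leNgt => h.
  have := ler_normB (S_op k f y - S_op k good y) (- S_op k good y).
  rewrite opprK subrK normrN; lra.
apply: (@le_trans _ _ (mu (A1 `|` (A2 `|` A3)))).
  apply: le_measure; rewrite ?inE//.
    apply: measurable_open_Rn.
    exact: (open_S_op n_gt0 delta_gt0 C2_ge0 C3_ge0 B_ge0 kx ky ksize e0 fe).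
  by apply: measurableU => //; exact: measurableU.
apply: (le_trans (measureU2 _ _ _)) => //; first exact: measurableU.
rewrite /weak_const mulrDl EFinD; apply: leeD; first exact: S_good_le.
apply: (le_trans (measureU2 _ _ _)) => //.
rewrite mulrDl EFinD; apply: leeD.
  apply: (le_trans (measure_countable_le _ cst _)).
    by move=> P _; exact: measurable_open_cube.
  apply: (@le_trans _ _ (\esum_(P in stopped)
      (((2 * 2 ^+ n.+1) ^+ n)%:E * mu (cube_set P)))%E).
    apply: le_esum => P _; rewrite lebesgue_cube -EFinM -exprMn -mulrA.
    rewrite le_eqVlt; apply/orP; left; apply/eqP.
    by apply: lebesgue_open_cube; rewrite mulr_gt0 ?exprn_gt0// side_gt0.
  have c0 : 0 <= (2 * 2 ^+ n.+1 : R) ^+ n by rewrite exprn_ge0.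
  rewrite esumZl// [leRHS]EFinM lee_wpmul2l ?lee_fin//.
  exact: (esum_heavy_cubes_le n_gt0 HD mf l0 fN).
have -> : 2 * bad_const * (2 ^+ n / (1 - q)) * (N / l) =
    (l / 2)^-1 * (bad_const * (2 ^+ n / (1 - q)) * N).
  by field; rewrite gt_eqF//= gt_eqF.
rewrite EFinM -lee_pdivrMl ?invr_gt0// invrK.
apply: le_trans tail_int.
have -> : ((l / 2)%:E * mu A3 = \int[mu]_y ((l / 2)%:E * (\1_A3 y)%:E))%E.
  rewrite ge0_integralZl_EFin//; last 2 first.
  - by apply/measurable_EFinP; apply: measurable_indic.
  - exact: ltW.
  by rewrite integral_indic// setIT.
apply: ge0_le_integralW => y; first by rewrite -EFinM lee_fin mulr_ge0// ltW.
rewrite indicE; have [yA|yA] := boolP (y \in A3); last by rewrite mule0.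
by rewrite mule1; move/set_mem : yA.
Qed.

End decomposition.
End weak_type.

(** * Values of the operator on integrable functions *)

Section fast_convergence.
Context (R : realType).

Lemma geometric_increments_cvg (s : nat -> R) (a b : R) : 0 <= a ->
  `|s 0%N| <= b -> (forall i, `|s i.+1 - s i| <= a * 2^-1 ^+ i) ->
  exists2 g, s @ \oo --> g & `|g| <= b + 2 * a.
Proof.
move=> a0 sb sa.
have h0 : `|2^-1 : R| < 1 by rewrite ger0_norm; lra.
have ser : cvgn (series (telescope s)).
  apply: normed_cvg; apply: (@series_le_cvg _ _ (geometric a 2^-1)).
  - by move=> i; exact: normr_ge0.
  - by move=> i; rewrite /geometric/= mulr_ge0// exprn_ge0.
  - by move=> i; rewrite /telescope/=; exact: sa.
  - by apply/cvg_ex; exists (a / (1 - 2^-1)); exact: cvg_geometric_series.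
have scv : cvgn s.
  have -> : s = (fun i => s 0%N + series (telescope s) i).
    by apply/funext => i; exact: eq_sum_telescope.
  apply: is_cvgD => //; exact: is_cvg_cst.
exists (limn s) => //.
have bd i : `|s i| <= b + 2 * a.
  rewrite (eq_sum_telescope s i) (le_trans (ler_normD _ _))// lerD//.
  rewrite (le_trans (ler_norm_sum _ _ _))//.
  apply: (@le_trans _ _ (series (geometric a 2^-1) i)).
    by apply: ler_sum => j _; exact: sa.
  have := @geometric_le_lim R i a 2^-1 a0 _ h0.
  have -> : a / (1 - 2^-1) = 2 * a by have -> : 1 - 2^-1 = 2^-1 :> R; [lra|rewrite invrK mulrC].
  by apply; lra.
rewrite -(lim_norm scv)//; apply: limr_le; first exact: is_cvg_norm.
exact: nearW.
Qed.

Lemma cvge0_lt (u : nat -> \bar R) (e : R) : u @ \oo --> 0%E -> 0 < e ->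
  \forall j \near \oo, (u j < e%:E)%E.
Proof.
move=> /fine_cvgP[ufin /cvgrPdist_lt u0] e0; near=> j.
have uj : u j \is a fin_num by near: j.
rewrite -(fineK uj) lte_fin (le_lt_trans (ler_norm _))//.
by rewrite -[X in `|X|]subr0 distrC; near: j; exact: u0.
Unshelve. all: by end_near. Qed.

End fast_convergence.

Section truncation.
Context (R : realType) (n : nat).
Implicit Types (f g : R1n R n -> R) (e : R).
Local Notation mu := (lebesgue_Rn R n).
Local Notation nu := (lebesgue_R1n R n).
Local Notation H := (@halfspace R n).
Let mH : measurable H := @measurable_halfspace R n.

Definition trunc e f : R1n R n -> R := fun p => if e < (p.1 : R) then f p else 0.

Lemma measurable_trunc e f : measurable_fun H f -> measurable_fun H (trunc e f).
Proof.
move=> mf; apply: measurable_fun_if => //.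
  apply: measurable_fun_ltr => //; exact: measurable_funTS.
apply: measurable_funS mf => //; exact: subIsetl.
Qed.

Lemma trunc_norm_le e f p : `|trunc e f p| <= `|f p|.
Proof. by rewrite /trunc; case: ifP => // _; rewrite normr0. Qed.

Lemma lifted_trunc e f : L1_halfspace f -> lifted e (trunc e f).
Proof.
move=> f1; have [mf _] := (L1_halfspaceP f).1 f1; split.
  apply: L1_halfspaceS f1; first exact: measurable_trunc.
  by move=> p _; exact: trunc_norm_le.
by move=> p _ pe; rewrite /trunc ltNge pe.
Qed.

Lemma eq_mass f g A : {in A, f =1 g} -> mass f A = mass g A.
Proof. by move=> fg; apply: eq_integral => p pA; rewrite fg. Qed.

Lemma mass_mono f g : measurable_fun H f -> measurable_fun H g ->
  (forall p, H p -> `|f p| <= `|g p|) -> (mass f H <= mass g H)%E.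
Proof.
by move=> mf mg fg; apply: ge0_le_integral => //; exact: measurable_normE.
Qed.

Lemma massB_le f g : measurable_fun H f -> measurable_fun H g ->
  (mass (fun p => (f p - g p)%R) H <= mass f H + mass g H)%E.
Proof.
move=> mf mg; rewrite /mass -ge0_integralD//; try exact: measurable_normE.
apply: ge0_le_integral => //.
- by apply: measurable_normE => //; exact: measurable_funB.
- by apply: emeasurable_funD; exact: measurable_normE.
- by move=> p _; rewrite -EFinD lee_fin ler_normB.
Qed.

Lemma mass_trunc_cvg f : L1_halfspace f ->
  (fun i => mass (fun p => f p - trunc i.+1%:R^-1 f p) H) @ \oo --> 0%E.
Proof.
move=> f1; have [mf _] := (L1_halfspaceP f).1 f1.
have mf_ i : measurable_fun H (fun p => (f p - trunc i.+1%:R^-1 f p)%:E).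
  by apply/measurable_EFinP; apply: measurable_funB => //; exact: measurable_trunc.
have m0 : measurable_fun H (fun _ : R1n R n => 0%E : \bar R) by exact: measurable_cst.
have cv : {ae nu, forall p, H p ->
    (fun i => (f p - trunc i.+1%:R^-1 f p)%:E) @ \oo --> 0%E}.
  apply: aeW => p Hp; apply: cvg_near_cst; near=> i; rewrite /trunc ifT ?subrr//.
  by near: i; exact: (near_infty_natSinv_lt (PosNum Hp)).
have ig : nu.-integrable H (fun p => `|f p|%:E) by exact: (integrable_norm f1).
have bd : {ae nu, forall p, forall i, H p ->
    (`|(f p - trunc i.+1%:R^-1 f p)%:E| <= `|f p|%:E)%E}.
  apply: aeW => p i Hp; rewrite /= lee_fin /trunc; case: ifP => _.
    by rewrite subrr normr0.
  by rewrite subr0.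
have [_ + _] := dominated_convergence mH mf_ m0 cv ig bd.
apply: cvg_trans; apply: near_eq_cvg; near=> i.
by rewrite /mass; apply: eq_integral => p _; rewrite sube0.
Unshelve. all: by end_near. Qed.

Lemma trunc_small f (r h : R) : L1_halfspace f -> 0 < r -> 0 < h ->
  exists2 e : R, 0 < e <= r &
    (mass (fun p => (f p - trunc e f p)%R) H <= (h * fine (mass f H))%:E)%E.
Proof.
move=> f1 r0 h0; have [mf _] := (L1_halfspaceP f).1 f1.
have m0 : 0 <= fine (mass f H) by rewrite fine_ge0// mass_ge0.
have [mz|mnz] := eqVneq (fine (mass f H)) 0.
  exists r; first by rewrite r0 lexx.
  rewrite mz mulr0; apply: (@le_trans _ _ (mass f H)).
    apply: mass_mono => //; first by apply: measurable_funB => //; exact: measurable_trunc.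
    move=> p _; rewrite /trunc; case: ifP => _; first by rewrite subrr normr0.
    by rewrite subr0.
  by rewrite mass_fine// mz.
have hm0 : (0 < (h * fine (mass f H))%:E)%E.
  by rewrite lte_fin mulr_gt0// lt_def mnz.
rewrite lte_fin in hm0.
have [j [jh jr]] : exists j : nat,
    (mass (fun p => (f p - trunc j.+1%:R^-1 f p)%R) H < (h * fine (mass f H))%:E)%E /\
    j.+1%:R^-1 < r.
  near \oo => j; exists j; split; near: j.
    exact: cvge0_lt (mass_trunc_cvg f1) hm0.
  exact: (near_infty_natSinv_lt (PosNum r0)).
exists j.+1%:R^-1; last exact: ltW.
by rewrite invr_gt0 ltr0n /= ltW.
Unshelve. all: by end_near. Qed.

Lemma trunc_eventually f (e_ : nat -> R) p : H p -> e_ @ \oo --> 0 ->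
  \forall i \near \oo, trunc (e_ i) f p = f p.
Proof.
move=> Hp /cvgrPdist_lt e0; near=> i; rewrite /trunc ifT//.
have : `|0 - e_ i| < p.1 by near: i; exact: e0.
by rewrite sub0r normrN => /(le_lt_trans (ler_norm _)).
Unshelve. all: by end_near. Qed.

End truncation.

Section negligible_tools.
Context d (T : measurableType d) (R : realType) (m : {measure set T -> \bar R}).

Lemma ge0_small_eq0 (x : \bar R) (C : R) : (0 <= x)%E ->
  (forall j : nat, (x <= (C / j.+1%:R)%:E)%E) -> x = 0%E.
Proof.
move=> x0 xC; case: x x0 xC => [r|_ /(_ 0%N)|//]; last by rewrite leye_eq.
rewrite lee_fin => r0 rC; congr EFin; apply/eqP; rewrite eq_le r0 andbT.
rewrite leNgt; apply/negP => {}r0.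
have := truncnS_gt (C / r); rewrite ltr_pdivrMr// => h.
have := rC (Num.Def.trunc (C / r)); rewrite lee_fin ler_pdivlMr// mulrC.
by rewrite leNgt h.
Qed.

Lemma negligible_small (Z : set T) (O : nat -> set T) (C : R) :
  (forall j, measurable (O j)) -> (forall j, Z `<=` O j) ->
  (forall j, (m (O j) <= (C / j.+1%:R)%:E)%E) -> m.-negligible Z.
Proof.
move=> mO ZO OC; exists (\bigcap_j O j); split.
- exact: bigcapT_measurable.
- apply: (ge0_small_eq0 (C := C)) => // j.
  apply: le_trans (OC j); apply: le_measure; rewrite ?inE//.
    exact: bigcapT_measurable.
  by apply: bigcap_inf.
- by move=> x Zx j _; exact: ZO.
Qed.

End negligible_tools.

Section S_values.
Context (R : realType) (n : nat) (k : kernel_fun R n) (W A : R).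
Implicit Types (f : R1n R n -> R) (g : Rn R n -> R) (P : cube R n) (y : Rn R n).
Local Notation mu := (lebesgue_Rn R n).
Local Notation nu := (lebesgue_R1n R n).
Local Notation H := (@halfspace R n).
Let mH : measurable H := @measurable_halfspace R n.
Context (W_ge0 : 0 <= W) (kmeas : forall y, measurable_fun H (fun p => k p.1 p.2 y)).
Context (Sconv : forall (e : R) f y, 0 < e -> lifted e f -> S_converges k f y).
Context (Sopen : forall (e l : R) f, 0 < e -> lifted e f ->
  open_Rn [set y | l < `|S_op k f y|]).
Context (Sweak : forall (e l N : R) f, 0 < e -> lifted e f -> 0 < l ->
  (mass f H <= N%:E)%E ->
  (mu [set y | (l < `|S_op k f y|)%R] <= (W * (N / l))%:E)%E).
Context (Sosc : forall (e c : R) f P y y' w, 0 < e -> lifted e f ->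
  (forall p, carleson_box (dilate 3%:pos P) p -> f p = 0) ->
  cube_set P y -> cube_set P y' -> cube_set P w -> (carleson f w <= c%:E)%E ->
  `|S_op k f y - S_op k f y'| <= A * c).

Lemma L1_mass_ge0 f : 0 <= fine (mass f H).
Proof. by rewrite fine_ge0// mass_ge0. Qed.

(** Truncating fast enough towards the boundary makes the weak type bounds of
the increments summable; outside an open set of controlled measure the
values then converge, which gives existence and the weak type bound at
once. *)
Lemma truncations_converge f : L1_halfspace f -> exists e_ : nat -> R,
  [/\ forall i, 0 < e_ i <= 2^-1 ^+ i,
      forall i, (mass (fun p => (f p - trunc (e_ i) f p)%R) H <=
         (8^-1 ^+ i * fine (mass f H))%:E)%E
    & forall l, 0 < l -> exists O : set (Rn R n),
       [/\ open_Rn O, (mu O <= (13 * W * (fine (mass f H) / l))%:E)%E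
         & forall y, ~ O y -> exists2 g : R,
             (fun i => S_op k (trunc (e_ i) f) y) @ \oo --> g & `|g| <= l]].
Proof.
move=> f1; have [mf _] := (L1_halfspaceP f).1 f1.
set m := fine (mass f H); have m0 : 0 <= m by exact: L1_mass_ge0.
have p2 i : 0 < 2^-1 ^+ i :> R by rewrite exprn_gt0// invr_gt0.
have p8 i : 0 < 8^-1 ^+ i :> R by rewrite exprn_gt0// invr_gt0.
have ex i : exists e : R, (0 < e <= 2^-1 ^+ i) /\
    (mass (fun p => (f p - trunc e f p)%R) H <= (8^-1 ^+ i * m)%:E)%E.
  by have [e e1 e2] := trunc_small f1 (p2 i) (p8 i); exists e.
have [e_ eP] := choice ex.
exists e_; split; [by move=> i; have [] := eP i|by move=> i; have [] := eP i|].
have e0 i : 0 < e_ i by have [/andP[]] := eP i.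
have lt i := lifted_trunc (e_ i) f1.
pose h i p := trunc (e_ i.+1) f p - trunc (e_ i) f p.
pose eh i := Num.min (e_ i) (e_ i.+1).
have eh0 i : 0 < eh i by rewrite lt_min !e0.
have lh i : lifted (eh i) (h i).
  split; first exact: L1_halfspaceB (lt _).1 (lt _).1.
  move=> p Hp; rewrite /eh le_min => /andP[h1 h2].
  by rewrite /h (lt _).2// (lt _).2// subrr.
have Sh i y : S_op k (h i) y = S_op k (trunc (e_ i.+1) f) y - S_op k (trunc (e_ i) f) y.
  exact: (S_opB (Sconv _ (e0 _) (lt _)) (Sconv _ (e0 _) (lt _))).2.
have mt i := measurable_trunc (e_ i) mf.
have mh i : (mass (h i) H <= (2 * (8^-1 ^+ i * m))%:E)%E.
  rewrite (eq_mass (g := fun p => (f p - trunc (e_ i) f p) - (f p - trunc (e_ i.+1) f p))); last first.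
    by move=> p _; rewrite /h; lra.
  apply: (le_trans (massB_le _ _)); try exact: measurable_funB.
  have -> : 2 * (8^-1 ^+ i * m) = 8^-1 ^+ i * m + 8^-1 ^+ i * m by lra.
  rewrite EFinD leeD//; first by have [] := eP i.
  have [_ h2] := eP i.+1; apply: (le_trans h2).
  rewrite lee_fin ler_wpM2r// exprS ler_piMl ?(ltW (p8 i))//; lra.
move=> l l0.
pose O0 := [set y | l / 2 < `|S_op k (trunc (e_ 0%N) f) y|].
pose O1 i := [set y | l / 4 * 2^-1 ^+ i < `|S_op k (h i) y|].
have oO0 : open_Rn O0 by exact: (@Sopen _ (l / 2) _ (e0 0%N) (lt 0%N)).
have oO1 i : open_Rn (O1 i) by exact: (@Sopen _ (l / 4 * 2^-1 ^+ i) _ (eh0 i) (lh i)).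
have oU : open_Rn (\bigcup_i O1 i) by apply: open_bigcup => i _.
exists (O0 `|` \bigcup_i O1 i); split.
- exact: open_setU.
- apply: (le_trans (measureU2 _ _ _)); try exact: measurable_open_Rn.
  have -> : 13 * W * (m / l) = W * (m / (l / 2)) + 11 * (W * (m / l)).
    by field; rewrite gt_eqF.
  rewrite EFinD; apply: leeD.
    apply: (Sweak (e0 0%N) (lt 0%N)); first by rewrite divr_gt0.
    rewrite -mass_fine//; apply: mass_mono => // p _; exact: trunc_norm_le.
  apply: (@le_trans _ _ (\sum_(0 <= i <oo) mu (O1 i))%E).
    apply: (measure_sigma_subadditive mu) => //.
    + by move=> i; exact: measurable_open_Rn.
    + exact: measurable_open_Rn.
  apply: (@le_trans _ _ (\sum_(0 <= i <oo) (8 * (W * (m / l)) * 4^-1 ^+ i)%:E)%E).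
    apply: lee_nneseries => [//|i _].
    have l4 : 0 < l / 4 * 2^-1 ^+ i by rewrite mulr_gt0// divr_gt0.
    apply: (le_trans (Sweak (eh0 i) (lh i) l4 (mh i))).
    rewrite lee_fin le_eqVlt; apply/orP; left; apply/eqP.
    have -> : 8^-1 ^+ i = 2^-1 ^+ i * 4^-1 ^+ i :> R.
      by rewrite -exprMn; congr (_ ^+ _); lra.
    by field; rewrite !gt_eqF.
  have Wml : 0 <= W * (m / l) by rewrite mulr_ge0// divr_ge0// ltW.
  apply: (le_trans (nneseries_geometric_le _ _)).
  + by rewrite mulr_ge0.
  + by apply/andP; split; lra.
  + have e43 : (1 - 4^-1)^-1 = 4 / 3 :> R by field.
    by rewrite lee_fin e43; lra.
move=> y /not_orP[yO0 yO1].
have ha : 0 <= l / 4 by rewrite divr_ge0// ltW.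
have [|i|g gl gb] := @geometric_increments_cvg R
    (fun i => S_op k (trunc (e_ i) f) y) (l / 4) (l / 2) ha.
- by rewrite leNgt; apply/negP.
- rewrite -Sh leNgt; apply/negP => yi; apply: yO1; by exists i.
- by exists g => //; lra.
Qed.

Lemma truncation_S_op f (e_ : nat -> R) y : L1_halfspace f ->
  e_ @ \oo --> 0 -> S_converges k f y ->
  (fun i => S_op k (trunc (e_ i) f) y) @ \oo --> S_op k f y.
Proof.
move=> f1 e0 fy; have [mf _] := (L1_halfspaceP f).1 f1.
have mk (u : R1n R n -> R) : measurable_fun H u ->
    measurable_fun H (fun p => (k p.1 p.2 y * u p)%:E).
  by move=> mg; apply/measurable_EFinP; apply: measurable_funM.
have mk_ i := mk _ (measurable_trunc (e_ i) mf).
have cv : {ae nu, forall p, H p ->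
    (fun i => (k p.1 p.2 y * trunc (e_ i) f p)%:E) @ \oo --> (k p.1 p.2 y * f p)%:E}.
  apply: aeW => p Hp; apply: cvg_near_cst; near=> i.
  by congr (_ * _)%:E; near: i; exact: trunc_eventually.
have ig : nu.-integrable H (fun p => `|k p.1 p.2 y * f p|%:E) by exact: (integrable_norm fy).
have bd : {ae nu, forall p, forall i, H p ->
    (`|(k p.1 p.2 y * trunc (e_ i) f p)%:E| <= `|k p.1 p.2 y * f p|%:E)%E}.
  apply: aeW => p i Hp; rewrite /= lee_fin !normrM ler_wpM2l//.
  exact: trunc_norm_le.
have [ikf _ +] := dominated_convergence mH mk_ (mk _ mf) cv ig bd.
move=> h; rewrite /S_op /Rintegral.
apply: fine_cvg; rewrite fineK//.
exact: (integrable_fin_num mH ikf).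
Unshelve. all: by end_near. Qed.

Lemma geometric_scale_cvg (e_ : nat -> R) :
  (forall i, 0 < e_ i <= 2^-1 ^+ i) -> e_ @ \oo --> 0.
Proof.
move=> eP; apply: (@squeeze_cvgr _ _ _ _ (fun=> 0) (fun i => 2^-1 ^+ i)).
- by apply: nearW => i; have /andP[/ltW -> ->] := eP i.
- exact: cvg_cst.
- by apply: cvg_expr; rewrite ger0_norm; lra.
Qed.

Lemma S_value_exists f : L1_halfspace f -> exists (e_ : nat -> R) g,
  [/\ forall i, 0 < e_ i <= 2^-1 ^+ i,
      S_value k f g,
      {ae mu, forall y, (fun i => S_op k (trunc (e_ i) f) y) @ \oo --> g y}
    & forall l, 0 < l -> exists O : set (Rn R n),
       [/\ open_Rn O, (mu O <= (13 * W * (fine (mass f H) / l))%:E)%E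
         & forall y, ~ O y -> `|g y| <= l]].
Proof.
move=> f1; have [mf _] := (L1_halfspaceP f).1 f1.
have [e_ [eb em eO]] := truncations_converge f1.
pose s y i := S_op k (trunc (e_ i) f) y.
have e0 i : 0 < e_ i by have /andP[] := eb i.
have lt i := lifted_trunc (e_ i) f1.
exists e_, (fun y => limn (s y)).
have scv : {ae mu, forall y, s y @ \oo --> limn (s y)}.
  have [Om OP] := choice (fun j : nat => eO j.+1%:R (ltr0Sn R j)).
  apply: (negligible_small (O := Om) (C := 13 * W * fine (mass f H))).
  - by move=> j; have [oj _ _] := OP j; exact: measurable_open_Rn.
  - move=> j y ny; apply: contrapT => nO; apply: ny.
    have [_ _ /(_ y nO)[g sg _]] := OP j.
    by rewrite /=; apply/cvg_ex; exists g.
  - by move=> j; have [_ + _] := OP j; rewrite mulrA.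
split => //.
- exists (fun i => trunc (e_ i) f); split => //.
  + by move=> i; have [] := lt i.
  + by move=> i; apply: aeW => y; exact: Sconv (e0 i) (lt i).
  apply: (@squeeze_cvge _ _ _ _ (fun=> 0%E) _
    (fun i => (fine (mass f H) * 8^-1 ^+ i)%:E)).
  + apply: nearW => i; apply/andP; split; first by apply: integral_ge0 => p _; rewrite lee_fin.
    rewrite mulrC; apply: le_trans (em i); rewrite le_eqVlt; apply/orP; left; apply/eqP.
    by apply: eq_integral => p _; rewrite distrC.
  + exact: cvg_cst.
  + apply/fine_cvgP; split; first exact: nearW.
    rewrite -[X in _ --> X](mulr0 (fine (mass f H))).
    apply: cvgM; first exact: cvg_cst.
    by apply: cvg_expr; rewrite ger0_norm; lra.
- move=> l l0; have [Om [oO mO OP]] := eO l l0; exists Om; split => //.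
  move=> y /OP[g sg gl].
  by have -> : limn (s y) = g by apply: (cvg_lim _ (sg : s y @ \oo --> g)).
Qed.

(** Where the defining integral converges, it is the limit of its truncations,
so it inherits their weak type bound. *)
Lemma S_op_weak f (l : R) : L1_halfspace f ->
  {ae mu, forall y, S_converges k f y} -> 0 < l ->
  exists Om : set (Rn R n), [/\ measurable Om,
    (mu Om <= (13 * W * (fine (mass f H) / l))%:E)%E
    & {ae mu, forall y, ~ Om y -> `|S_op k f y| <= l}].
Proof.
move=> f1 fS l0; have [e_ [g [eb _ eg eO]]] := S_value_exists f1.
have [Om [oO mO OP]] := eO l l0; exists Om; split => //.
  exact: measurable_open_Rn.
apply: filterS2 eg fS => y yg yS yO.
have := truncation_S_op f1 (geometric_scale_cvg eb) yS.
move=> /(cvg_lim (@Rhausdorff _)) <-; move: yg => /(cvg_lim (@Rhausdorff _)) ->.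
exact: OP.
Qed.

(** Two approximating sequences differ by functions tending to 0 in L1; by the
weak type bound, their images cannot stay away from 0 on a set of positive
measure. *)
Lemma S_value_unique f g g' : L1_halfspace f -> S_value k f g -> S_value k f g' ->
  {ae mu, forall y, g y = g' y}.
Proof.
move=> f1 [f_ [f_1 f_S f_f f_g]] [h_ [h_1 h_S h_f h_g]].
have [mf _] := (L1_halfspaceP f).1 f1.
pose d_ j (p : R1n R n) := f_ j p - h_ j p.
have d1 j : L1_halfspace (d_ j) by exact: L1_halfspaceB.
have dS j : {ae mu, forall y, S_converges k (d_ j) y}.
  by apply: filterS2 (f_S j) (h_S j) => y a b; have [] := S_opB a b.
have dm j : (mass (d_ j) H <=
    mass (fun p => (f_ j p - f p)%R) H + mass (fun p => (h_ j p - f p)%R) H)%E.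
  rewrite (eq_mass (g := fun p => (f_ j p - f p) - (h_ j p - f p))); last first.
    by move=> p _; rewrite /d_; lra.
  have [mfj _] := (L1_halfspaceP _).1 (f_1 j).
  have [mhj _] := (L1_halfspaceP _).1 (h_1 j).
  by apply: massB_le; exact: measurable_funB.
have small (e : R) m : 0 < e -> exists2 j, (m <= j)%N & fine (mass (d_ j) H) <= e.
  move=> e0; have e20 : 0 < e / 2 by rewrite divr_gt0.
  near \oo => j; exists j; first by near: j; exact: nbhs_infty_ge.
  rewrite -lee_fin -mass_fine//; apply: (le_trans (dm j)).
  have -> : e = e / 2 + e / 2 by lra.
  rewrite EFinD leeD// ltW//; near: j.
    exact: (cvge0_lt f_f e20).
  exact: (cvge0_lt h_f e20).
have ael (l : R) : 0 < l -> {ae mu, forall y, `|g y - g' y| <= l}.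
  move=> l0; have [Om OP] := choice (fun j => S_op_weak (d1 j) (dS j) l0).
  have mOm j : measurable (Om j) by have [] := OP j.
  have aeOm : {ae mu, forall y, forall j, ~ Om j y -> `|S_op k (d_ j) y| <= l}.
    by apply: ae_foralln => j; have [] := OP j.
  have aeZ : {ae mu, forall y, forall m, exists2 j, (m <= j)%N & ~ Om j y}.
    apply: ae_foralln => m.
    have W0 : 0 < 13 * W + 1 by have := W_ge0; lra.
    have pick i : exists j, (m <= j)%N /\
        fine (mass (d_ j) H) <= l / (13 * W + 1) / i.+1%:R.
      have h0 : 0 < l / (13 * W + 1) / i.+1%:R by rewrite !divr_gt0.
      by have [j mj hj] := small _ m h0; exists j.
    have [J JP] := choice pick.
    apply: (negligible_small (O := Om \o J) (C := 1)).
    - by move=> i; exact: mOm.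
    - move=> i y ny; apply: contrapT => nO; apply: ny.
      by exists (J i) => //; have [] := JP i.
    - move=> i; have [_ + _] := OP (J i); move/le_trans; apply.
      have [_ hi] := JP i; rewrite lee_fin mulrA ler_pdivrMr//.
      apply: (@le_trans _ _ ((13 * W + 1) * (l / (13 * W + 1) / i.+1%:R))).
        by rewrite ler_pM ?mulr_ge0 ?L1_mass_ge0// lerDl.
      rewrite le_eqVlt; apply/orP; left; apply/eqP.
      have t0 : i.+1%:R != 0 :> R by rewrite pnatr_eq0.
      have w0 : 13 * W + 1 != 0 by rewrite gt_eqF.
      by move: (i.+1%:R : R) t0 => t t0; field; rewrite ?t0 ?w0.
  have aeS : {ae mu, forall y, forall j,
      S_op k (d_ j) y = S_op k (f_ j) y - S_op k (h_ j) y}.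
    apply: ae_foralln => j; apply: filterS2 (f_S j) (h_S j) => y a b.
    by have [] := S_opB a b.
  near=> y.
  have yf : (fun j => S_op k (f_ j) y) @ \oo --> g y by near: y.
  have yh : (fun j => S_op k (h_ j) y) @ \oo --> g' y by near: y.
  have yS : forall j, S_op k (d_ j) y = S_op k (f_ j) y - S_op k (h_ j) y by near: y.
  have yZ : forall m, exists2 j, (m <= j)%N & ~ Om j y by near: y.
  have yO : forall j, ~ Om j y -> `|S_op k (d_ j) y| <= l by near: y.
  rewrite leNgt; apply/negP => lt.
  have : \forall j \near \oo, l < `|S_op k (d_ j) y|.
    have c : (fun j => `|S_op k (d_ j) y|) @ \oo --> `|g y - g' y|.
      under eq_fun do rewrite yS.
      by apply: cvg_norm; exact: cvgB.
    exact: (cvgr_gt _ c).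
  move=> [m _ hm]; have [j mj nO] := yZ m.
  by have := hm j mj; rewrite /= ltNge yO.
have i0 (i : nat) : 0 < i.+1%:R^-1 :> R by rewrite invr_gt0.
apply: filterS (ae_foralln (fun i => ael _ (i0 i))) => y hy.
apply/eqP; rewrite -subr_eq0 -normr_eq0; apply/eqP; apply: EFin_inj.
apply: (ge0_small_eq0 (C := 1)) => [|i]; first by rewrite lee_fin.
by rewrite lee_fin mul1r.
Unshelve. all: by end_near. Qed.

Lemma S_valueB f f' g g' : L1_halfspace f -> L1_halfspace f' ->
  S_value k f g -> S_value k f' g' ->
  S_value k (fun p => f p - f' p) (fun y => g y - g' y).
Proof.
move=> f1 f'1 [f_ [f_1 f_S f_f f_g]] [h_ [h_1 h_S h_f h_g]].
have [mf _] := (L1_halfspaceP f).1 f1.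
have [mf' _] := (L1_halfspaceP f').1 f'1.
exists (fun j p => f_ j p - h_ j p); split.
- by move=> j; exact: L1_halfspaceB.
- by move=> j; apply: filterS2 (f_S j) (h_S j) => y a b; have [] := S_opB a b.
- apply: (@squeeze_cvge _ _ _ _ (fun=> 0%E) _ (fun j =>
    mass (fun p => (f_ j p - f p)%R) H + mass (fun p => (h_ j p - f' p)%R) H)%E).
  + apply: nearW => j; apply/andP; split.
      by apply: integral_ge0 => p _; rewrite lee_fin.
    have [mfj _] := (L1_halfspaceP _).1 (f_1 j).
    have [mhj _] := (L1_halfspaceP _).1 (h_1 j).
    rewrite -/(mass (fun p => (f_ j p - h_ j p - (f p - f' p))%R) H).
    rewrite (eq_mass (g := fun p => (f_ j p - f p) - (h_ j p - f' p))); last first.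
      by move=> p _; lra.
    by apply: massB_le; exact: measurable_funB.
  + exact: cvg_cst.
  + by rewrite -[X in _ --> X]adde0; apply: cvgeD.
- have aeS : {ae mu, forall y, forall j,
      S_op k (fun p => f_ j p - h_ j p) y = S_op k (f_ j) y - S_op k (h_ j) y}.
    apply: ae_foralln => j; apply: filterS2 (f_S j) (h_S j) => y a b.
    by have [] := S_opB a b.
  apply: filterS3 f_g h_g aeS => y yf yh yS.
  under eq_fun do rewrite yS.
  exact: cvgB.
Qed.

Lemma S_value_eq f f' g : {in H, f =1 f'} -> S_value k f g -> S_value k f' g.
Proof.
move=> ff' [f_ [f_1 f_S f_f f_g]]; exists f_; split => //.
apply: cvg_trans f_f; apply: near_eq_cvg; apply: nearW => j.
by apply: eq_integral => p pH; rewrite ff'.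
Qed.

Lemma carleson_mono f f' y : measurable_fun H f -> measurable_fun H f' ->
  (forall p, H p -> `|f p| <= `|f' p|) -> (carleson f y <= carleson f' y)%E.
Proof.
move=> mf mf' ff'; apply: ge_ereal_sup => _ [Q Qy <-].
apply: le_trans (ereal_sup_ubound _); last by exists Q.
rewrite /box_mean lee_wpmul2l//.
  by rewrite lee_fin invr_ge0 cube_volumeE exprn_ge0// ltW// side_gt0.
have mQ := measurable_carleson_box Q.
apply: ge0_le_integral => //; try
  by apply: measurable_normE => //; exact: carleson_box_halfspace.
by move=> p /carleson_box_halfspace Hp; rewrite lee_fin ff'.
Qed.

(** Truncations vanish where f does and have a smaller Carleson functional, so
the bound passes to the limit off a null set. *)
Lemma S_value_osc f g P : L1_halfspace f ->
  (forall p, carleson_box (dilate 3%:pos P) p -> f p = 0) -> S_value k f g ->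
  exists Z, mu.-negligible Z /\ forall y y' w (c : R), ~ Z y -> ~ Z y' ->
    cube_set P y -> cube_set P y' -> cube_set P w -> (carleson f w <= c%:E)%E ->
    `|g y - g y'| <= A * c.
Proof.
move=> f1 f0 fg; have [mf _] := (L1_halfspaceP f).1 f1.
have [e_ [g' [eb fg' eg' _]]] := S_value_exists f1.
have aeZ : {ae mu, forall y, g y = g' y /\
    (fun i => S_op k (trunc (e_ i) f) y) @ \oo --> g' y}.
  by apply: filterS2 (S_value_unique f1 fg fg') eg' => y a b.
exists (~` [set y | g y = g' y /\
  (fun i => S_op k (trunc (e_ i) f) y) @ \oo --> g' y]); split; first exact: aeZ.
move=> y y' w c /contrapT[-> yg] /contrapT[-> y'g] Py Py' Pw wc.
have cv : (fun i => `|S_op k (trunc (e_ i) f) y - S_op k (trunc (e_ i) f) y'|)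
    @ \oo --> `|g' y - g' y'| by apply: cvg_norm; exact: cvgB.
rewrite -(cvg_lim (@Rhausdorff _) cv); apply: limr_le.
  by apply/cvg_ex; exists `|g' y - g' y'|.
apply: nearW => i; have /andP[e0 _] := eb i.
apply: (Sosc e0 (lifted_trunc _ f1) _ Py Py' Pw).
  by move=> p Pp; rewrite /trunc f0// if_same.
apply: le_trans wc; apply: carleson_mono => //; first exact: measurable_trunc.
by move=> p _; exact: trunc_norm_le.
Qed.

End S_values.

(** * Initial cubes *)

Section countable_ae.
Context d (X : measurableType d) (R : realType) (m : {measure set X -> \bar R}).

Lemma ae_countable (T : choiceType) (A : set T) (P : T -> X -> Prop) :
  countable A -> (forall i, A i -> {ae m, forall x, P i x}) ->
  {ae m, forall x, forall i, A i -> P i x}.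
Proof.
move=> /countable_enum[e [e1 e2 _]] AP.
have H (k : nat) : {ae m, forall x, forall i, e k = Some i -> P i x}.
  case E : (e k) => [i|]; last by apply: aeW.
  by apply: filterS (AP i (e1 _ _ E)) => x Px j [<-].
apply: filterS (ae_foralln H) => x Hx i /e2[k ek]; exact: Hx ek.
Qed.

End countable_ae.

Section cube_inclusions.
Context (R : realType) (n : nat).
Implicit Types (P Q : cube R n).

Lemma cube_sub_bounds P Q : cube_set P `<=` cube_set Q -> forall i,
  (tnth Q.1 i : R) - side Q / 2 <= (tnth P.1 i : R) - side P / 2 /\
  (tnth P.1 i : R) + side P / 2 <= (tnth Q.1 i : R) + side Q / 2.
Proof.
move=> PQ i; have lP := side_gt0 P.
pose pt (v : R) : Rn R n := [tuple if j == i then v else tnth P.1 j | j < n].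
have ptP (v : R) : (tnth P.1 i : R) - side P / 2 <= v < (tnth P.1 i : R) + side P / 2 ->
    cube_set P (pt v).
  move=> hv j; rewrite tnth_mktuple; case: eqP => [->//|_].
  exact: (cube_center P).
split.
  have hlo : (tnth P.1 i : R) - side P / 2 <= (tnth P.1 i : R) - side P / 2
      < (tnth P.1 i : R) + side P / 2 by apply/andP; split; lra.
  by have := PQ _ (ptP _ hlo) i; rewrite tnth_mktuple eqxx => /andP[].
rewrite leNgt; apply/negP => lt.
pose v := Num.max ((tnth Q.1 i : R) + side Q / 2) ((tnth P.1 i : R) - side P / 2).
have hv : (tnth P.1 i : R) - side P / 2 <= v < (tnth P.1 i : R) + side P / 2.
  by rewrite /v le_max lexx orbT /= gt_max lt /=; lra.
have := PQ _ (ptP v hv) i; rewrite tnth_mktuple eqxx => /andP[_].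
by rewrite /v gt_max ltxx.
Qed.

Lemma dilate3_sub P Q : (0 < n)%N -> cube_set P `<=` cube_set Q ->
  cube_set (dilate 3%:pos%R P) `<=` cube_set (dilate 3%:pos%R Q).
Proof.
move=> n_gt0 PQ x Px i; have := Px i; have [h1 h2] := cube_sub_bounds PQ i.
have h3 := cube_set_side n_gt0 PQ.
have E T : side (dilate 3%:pos%R T) = 3 * side T :> R by [].
by rewrite !E /= => /andP[h4 h5]; apply/andP; split; lra.
Qed.

Lemma dilate3_center P : cube_set P `<=` cube_set (dilate 3%:pos%R P).
Proof.
move=> x Px i; have := Px i; have := side_gt0 P.
have E : side (dilate 3%:pos%R P) = 3 * side P :> R by [].
by rewrite !E /= => h /andP[h4 h5]; apply/andP; split; lra.
Qed.

Lemma half_cube_dilate3 P Q : cube_set P `<=` cube_set Q -> side Q = 2 * side P ->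
  cube_set Q `<=` cube_set (dilate 3%:pos%R P).
Proof.
move=> PQ sQ x Qx i; have := Qx i; have [h1 h2] := cube_sub_bounds PQ i.
have E : side (dilate 3%:pos%R P) = 3 * side P :> R by [].
have := side_gt0 P.
by rewrite sQ in h1 h2 *; rewrite !E /= => h /andP[h4 h5]; apply/andP; split; lra.
Qed.

End cube_inclusions.

Section initial_family.
Context (R : realType) (n : nat) (n_gt0 : (0 < n)%N).
Context (D : int -> set (cube R n)) (HD : dyadic_system D).
Local Notation dy := (dyadic_cubes D).

(** The dyadic ancestors of a cube that contains a bounded set exhaust the
space; that cube and the siblings of its ancestors partition the space, and
their threefold dilates contain the bounded set. *)
Lemma initial_cubes (M : R) : exists I : set (cube R n),
  [/\ I `<=` dy, trivIset I (@cube_set R n),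
      forall y, exists2 Q, I Q & cube_set Q y
    & forall Q, I Q -> M < side Q /\
        forall x, (forall i : 'I_n, `|tnth x i : R| <= M) ->
          cube_set (dilate 3%:pos%R Q) x].
Proof.
pose M' := Num.max M 0.
have [j0 boxj] := dyadic_contains_box n_gt0 HD M'.
pose N := Num.Def.archi_bound M'.
have MN : M' < 2 ^+ N by exact: upper_nthrootP.
pose j1 := Num.min j0 (- N%:Z).
have boxT (m : nat) : exists Q, D (j1 - m%:Z) Q /\
    forall x, (forall i : 'I_n, `|tnth x i : R| <= M') -> cube_set Q x.
  have [|Q DQ Qb] := boxj (j1 - m%:Z); last by exists Q.
  by rewrite /j1; lia.
have [Q QP] := choice boxT.
have DQ m : D (j1 - m%:Z) (Q m) by have [] := QP m.
have Qb m x : (forall i : 'I_n, `|tnth x i : R| <= M') -> cube_set (Q m) x.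
  by have [_] := QP m; apply.
pose z : Rn R n := [tuple 0 | _ < n].
have zM i : `|tnth z i : R| <= M' by rewrite tnth_mktuple normr0 le_max lexx orbT.
have Qz m : cube_set (Q m) z by exact: Qb.
have Qmono m m' : (m <= m')%N -> cube_set (Q m) `<=` cube_set (Q m').
  move=> mm; apply: (dyadic_nested n_gt0 HD (DQ m') (DQ m)); first by lia.
  by exists z.
have Qside m T : D (j1 - m%:Z) T -> M < side T.
  move=> DT; rewrite (dyadic_side HD DT); apply: (@le_lt_trans _ _ M').
    by rewrite le_max lexx.
  apply: (lt_le_trans MN); rewrite exprnP ler_weXz2l ?ler1n//.
  by rewrite /j1; lia.
have Qcov y : exists m, cube_set (Q m) y.
  pose My := \sum_(i < n) `|tnth y i : R|.
  have [j2 boxj2] := dyadic_contains_box n_gt0 HD My.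
  pose m := `|j1 - Num.min j1 j2|%N.
  have jm : j1 - m%:Z = Num.min j1 j2 by rewrite /m; lia.
  have [|T DT Tb] := boxj2 (j1 - m%:Z); first by rewrite jm; lia.
  have yM i : `|tnth y i : R| <= My by rewrite /My (bigD1 i)//= lerDl sumr_ge0.
  exists m; suff -> : Q m = T by exact: Tb.
  apply: (dyadic_unique HD (DQ m) DT (Qz m)); apply: Tb => i.
  by rewrite tnth_mktuple normr0 /My sumr_ge0.
pose sib m := [set T | [/\ D (j1 - m%:Z) T, cube_set T `<=` cube_set (Q m.+1) & T <> Q m]].
have sib_disj m T m' : sib m T -> (m' <= m)%N -> cube_set (Q m') `&` cube_set T = set0.
  move=> [DT _ nT] mm; apply/seteqP; split=> // x [Qx Tx]; apply: nT.
  by apply: (dyadic_unique HD DT (DQ m) Tx); exact: Qmono mm _ Qx.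
exists ([set Q 0%N] `|` \bigcup_m sib m); split.
- by move=> T [->|[m _ [DT _ _]]]; [exists (j1 - 0%:Z)|exists (j1 - m%:Z)].
- move=> T T' [->|[m _ sT]] [->|[m' _ sT']] // [x [Tx T'x]].
  + by have := sib_disj _ _ 0%N sT' isT => /seteqP[/(_ x (conj Tx T'x))].
  + by have := sib_disj _ _ 0%N sT isT => /seteqP[/(_ x (conj T'x Tx))].
  + have [DT TQ _] := sT; have [DT' TQ' _] := sT'.
    case: (ltngtP m m') => [mm|mm|mm].
    * by have := sib_disj _ _ _ sT' mm => /seteqP[/(_ x (conj (TQ _ Tx) T'x))].
    * by have := sib_disj _ _ _ sT mm => /seteqP[/(_ x (conj (TQ' _ T'x) Tx))].
    * by rewrite mm in DT; exact: (dyadic_unique HD DT DT' Tx).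
- move=> y; have ex : exists m, `[< cube_set (Q m) y >].
    by have [m hm] := Qcov y; exists m; apply/asboolP.
  case: (ex_minnP ex) => -[|m] /asboolP Qy mmin.
    by exists (Q 0%N) => //; left.
  have [T DT Ty] := dyadic_cover HD (j1 - m%:Z) y.
  exists T => //; right; exists m => //; split => //.
    apply: (dyadic_nested n_gt0 HD (DQ m.+1) DT); first by lia.
    by exists y.
  move=> TQ; have : (m.+1 <= m)%N by apply: mmin; apply/asboolP; rewrite -TQ.
  by rewrite ltnn.
- move=> T [->|[m _ [DT TQ nT]]].
    split; first exact: Qside (DQ 0%N).
    move=> x xM; apply: dilate3_center; apply: Qb => i.
    by rewrite (le_trans (xM i))// le_max lexx.
  split; first exact: Qside DT.
  move=> x xM; apply: (half_cube_dilate3 TQ).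
    rewrite (dyadic_side HD DT) (dyadic_side HD (DQ m.+1)).
    have -> : - (j1 - m.+1%:Z) = 1 - (j1 - m%:Z) by lia.
    by rewrite expfzDr ?pnatr_eq0.
  by apply: Qb => i; rewrite (le_trans (xM i))// le_max lexx.
Qed.

End initial_family.

(** * The sparse family *)

Section sparse_domination.
Context (R : realType) (n : nat) (n_gt0 : (0 < n)%N).
Context (D : int -> set (cube R n)) (HD : dyadic_system D).
Context (k : kernel_fun R n) (W A eta : R).
Context (W_ge0 : 0 <= W) (A_ge0 : 0 <= A) (eta_gt0 : 0 < eta) (eta_lt1 : eta < 1).
Local Notation mu := (lebesgue_Rn R n).
Local Notation nu := (lebesgue_R1n R n).
Local Notation H := (@halfspace R n).
Local Notation dy := (dyadic_cubes D).
Implicit Types (P Q T : cube R n) (x y : Rn R n).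
Let mH : measurable H := @measurable_halfspace R n.
Context (Vexists : forall h : R1n R n -> R, L1_halfspace h ->
  exists g, S_value k h g /\ forall l : R, 0 < l -> exists Om : set (Rn R n),
    [/\ open_Rn Om, (mu Om <= (13 * W * (fine (mass h H) / l))%:E)%E
      & forall y, ~ Om y -> `|g y| <= l]).
Context (Vosc : forall (h : R1n R n -> R) g P, L1_halfspace h ->
  (forall p, carleson_box (dilate 3%:pos P) p -> h p = 0) -> S_value k h g ->
  exists Z, mu.-negligible Z /\ forall y y' w (c : R), ~ Z y -> ~ Z y' ->
    cube_set P y -> cube_set P y' -> cube_set P w -> (carleson h w <= c%:E)%E ->
    `|g y - g y'| <= A * c).
Context (Vunique : forall (h : R1n R n -> R) g g', L1_halfspace h ->
  S_value k h g -> S_value k h g' -> {ae mu, forall y, g y = g' y}).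

(** The level at which the weak type bounds of S and of the Carleson functional,
added up, give a set of measure eps times v. *)
Definition level (eps : R) : R := (13 * W + 20 ^+ n) / eps.

Lemma level_gt0 eps : 0 < eps -> 0 < level eps.
Proof. by move=> e0; rewrite divr_gt0// ltr_wpDl ?mulr_ge0 ?exprn_gt0. Qed.

(** The two weak type bounds combined: the set is the union of the exceptional
set for S and of the open neighbourhood of the heavy cubes. *)
Lemma exceptional_set (h : R1n R n -> R) (v eps : R) :
  L1_halfspace h -> 0 < v -> 0 < eps ->
  exists (g : Rn R n -> R) (Om : set (Rn R n)),
    [/\ S_value k h g, open_Rn Om, (mu Om <= (eps * v)%:E)%E
      & forall y, ~ Om y -> `|g y| <= level eps * (fine (mass h H) / v) /\
          (carleson h y <= (level eps * (fine (mass h H) / v))%:E)%E].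
Proof.
move=> h1 v0 e0; have [mh _] := (L1_halfspaceP h).1 h1.
have [g [hg gO]] := Vexists h1.
set m := fine (mass h H) in gO *; have m0 : 0 <= m by exact: L1_mass_ge0.
have hm : (mass h H <= m%:E)%E by rewrite mass_fine.
have E0 := level_gt0 e0.
have [mz|mnz] := eqVneq m 0.
  (* Without mass, the bounds at the levels 1/(j+1) all hold off null sets. *)
  have inv0 (j : nat) : 0 < j.+1%:R^-1 :> R by rewrite invr_gt0.
  have [Om OP] := choice (fun j => gO _ (inv0 j)).
  exists g, (\bigcup_j Om j); split => //.
  - by apply: open_bigcup => j _; have [] := OP j.
  - have mO j : measurable (Om j) by have [oj _ _] := OP j; exact: measurable_open_Rn.
    have O0 j : mu (Om j) = 0%E.
      apply/eqP; rewrite eq_le measure_ge0 andbT.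
      by have [_ + _] := OP j; rewrite mz mul0r mulr0.
    have mU : measurable (\bigcup_j Om j) by exact: bigcupT_measurable.
    have -> : mu (\bigcup_j Om j) = 0%E.
      apply: (measure_negligible mU).
      by apply: negligible_bigcup => j; exists (Om j); split; [exact: mO|exact: O0|].
    by rewrite lee_fin mulr_ge0// ltW.
  - move=> y nO; rewrite mz mul0r mulr0.
    have -> : g y = 0.
      apply/eqP; rewrite -normr_eq0; apply/eqP/EFin_inj.
      apply: (ge0_small_eq0 (C := 1)) => [|j]; first by rewrite lee_fin.
      rewrite lee_fin mul1r; have [_ _] := OP j; apply => Oy; apply: nO.
      by exists j.
    split; first by rewrite normr0.
    apply: ge_ereal_sup => _ [Q _ <-]; rewrite /box_mean.
    have -> : (\int[nu]_(p in carleson_box Q) `|h p|%:E = 0)%E; last by rewrite mule0.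
    apply/eqP; rewrite eq_le integral_ge0 ?andbT; last by move=> p _; rewrite lee_fin.
    rewrite -/(mass h (carleson_box Q)) -[leRHS]/(0%:E) -mz.
    apply: le_trans hm; apply: le_mass => //; first exact: measurable_carleson_box.
    exact: carleson_box_halfspace.
have {}m0 : 0 < m by rewrite lt_def mnz.
pose l := level eps * (m / v).
have l0 : 0 < l by rewrite mulr_gt0// divr_gt0.
have p5 : 0 < 5 ^+ n :> R by rewrite exprn_gt0.
have s0 : 0 < l / 5 ^+ n by rewrite divr_gt0.
have [Om [oO mO OP]] := gO l l0.
have oH := @open_heavy_set _ _ D h (l / 5 ^+ n).
exists g, (Om `|` heavy_set D h (l / 5 ^+ n)); split => //.
- exact: open_setU.
- apply: (le_trans (measureU2 _ _ _)); try exact: measurable_open_Rn.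
  apply: (le_trans (leeD mO (heavy_set_le n_gt0 HD mh s0 hm))).
  rewrite -EFinD lee_fin le_eqVlt; apply/orP; left; apply/eqP.
  have -> : 4 ^+ n * (m / (l / 5 ^+ n)) = 20 ^+ n * (m / l).
    have -> : (20 : R) ^+ n = 4 ^+ n * 5 ^+ n by rewrite -exprMn; congr (_ ^+ _); lra.
    by field; rewrite (gt_eqF l0) (gt_eqF p5).
  rewrite -mulrDl /l /level.
  have Wn0 : 13 * W + 20 ^+ n != 0 by rewrite gt_eqF// ltr_wpDl ?mulr_ge0 ?exprn_gt0.
  by field; rewrite (gt_eqF m0) (gt_eqF v0) (gt_eqF e0) Wn0.
- move=> y /not_orP[yO yH]; split; first exact: OP.
  apply: (le_trans (carleson_le_heavy HD mh (ltW s0) yH)).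
  by rewrite lee_fin mulrC divfK// gt_eqF.
Qed.

Section fixed_function.
Context (f : R1n R n -> R) (f1 : L1_halfspace f).
Let mf : measurable_fun H f. Proof. exact: ((L1_halfspaceP f).1 f1).1. Qed.

Definition box3 Q := carleson_box (dilate 3%:pos%R Q).
Definition localize Q : R1n R n -> R := fun p => f p * \1_(box3 Q) p.
Definition mean3 Q : R := fine (mass f (box3 Q)) / side Q ^+ n.

Let sideX Q : 0 < side Q ^+ n. Proof. by rewrite exprn_gt0// side_gt0. Qed.

Lemma mean3_ge0 Q : 0 <= mean3 Q.
Proof. by rewrite divr_ge0 ?fine_ge0 ?mass_ge0// ltW. Qed.

Lemma mass_fin Q : mass f (carleson_box Q) = (fine (mass f (carleson_box Q)))%:E.
Proof.
rewrite fineK// ge0_fin_numE ?mass_ge0//.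
apply: (@le_lt_trans _ _ (mass f H)); last by rewrite mass_fine// ltry.
apply: le_mass => //; first exact: measurable_carleson_box.
exact: carleson_box_halfspace.
Qed.

Lemma box_mean3 Q : box_mean f Q (dilate 3%:pos%R Q) = (mean3 Q)%:E.
Proof.
rewrite /box_mean cube_volumeE -/(mass f (box3 Q)) mass_fin -EFinM /mean3.
by rewrite mulrC.
Qed.

Lemma measurable_localize Q : measurable_fun H (localize Q).
Proof.
apply: measurable_funM => //; apply: measurable_funTS.
by apply: measurable_indic; exact: measurable_carleson_box.
Qed.

Lemma localize_norm_le Q p : `|localize Q p| <= `|f p|.
Proof.
rewrite normrM ler_piMr// indicE; case: (_ \in _); rewrite ?normr1 ?normr0//.
Qed.

Lemma localize_L1 Q : L1_halfspace (localize Q).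
Proof.
apply: L1_halfspaceS f1; first exact: measurable_localize.
by move=> p _; exact: localize_norm_le.
Qed.

Lemma localize_in Q p : box3 Q p -> localize Q p = f p.
Proof. by move=> Qp; rewrite /localize indicE mem_set// mulr1. Qed.

Lemma localize_out Q p : ~ box3 Q p -> localize Q p = 0.
Proof. by move=> Qp; rewrite /localize indicE memNset// mulr0. Qed.

Lemma mass_localize Q : mass (localize Q) H = mass f (box3 Q).
Proof.
transitivity (mass f (H `&` box3 Q)); last first.
  by congr (mass f _); rewrite setIidr//; exact: carleson_box_halfspace.
rewrite /mass integral_mkcondr; apply: eq_integral => p _.
rewrite patchE; case: ifPn => [/set_mem h|/negP h]; first by rewrite localize_in.
by rewrite localize_out ?normr0// => h'; apply: h; exact/mem_set.
Qed.

(** The density threshold that selects cubes, chosen so that a selected cube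
has density at most 1/4, and the measure of the exceptional sets. *)
Definition theta : R := 2 ^- n / 4.
Definition eps0 : R := theta * (1 - eta).

Lemma theta_gt0 : 0 < theta.
Proof. by rewrite divr_gt0// invr_gt0 exprn_gt0. Qed.

Lemma theta_le : theta <= 1 / 4.
Proof.
by rewrite ler_pM2r// invf_le1 ?exprn_gt0// exprn_ege1// ler1n.
Qed.

Lemma eps0_gt0 : 0 < eps0.
Proof. by rewrite mulr_gt0 ?theta_gt0// subr_gt0. Qed.

Lemma eps0_le : eps0 <= theta.
Proof. by rewrite ler_piMr ?(ltW theta_gt0)//; have := eta_gt0; lra. Qed.

Section exceptional_data.
Context (g_ : cube R n -> Rn R n -> R) (O_ : cube R n -> set (Rn R n)).
Context (gP : forall Q, S_value k (localize Q) (g_ Q)) (oO : forall Q, open_Rn (O_ Q)).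
Context (mO : forall Q, (mu (O_ Q) <= (eps0 * side Q ^+ n)%:E)%E).
Context (gle : forall Q y, ~ O_ Q y -> `|g_ Q y| <= level eps0 * mean3 Q).
Context (cle : forall Q y, ~ O_ Q y ->
  (carleson (localize Q) y <= (level eps0 * mean3 Q)%:E)%E).

Let mOm Q : measurable (O_ Q). Proof. exact: measurable_open_Rn. Qed.

Definition dense_cubes Q : set (cube R n) :=
  [set P | [/\ dy P, cube_set P `<=` cube_set Q
             & ((theta * side P ^+ n)%:E < mu (cube_set P `&` O_ Q))%E]].

Definition children Q := maximal_cube (dense_cubes Q).

Lemma dense_dy Q : dense_cubes Q `<=` dy. Proof. by move=> P []. Qed.

Lemma children_dy Q P : children Q P -> dy P.
Proof. by move=> [[]]. Qed.

Lemma children_sub Q P : children Q P -> cube_set P `<=` cube_set Q.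
Proof. by move=> [[]]. Qed.

Lemma countable_children Q : countable (children Q).
Proof. exact: (countable_maximal_cube HD (@dense_dy Q)). Qed.

Lemma trivIset_children Q : trivIset (children Q) (@cube_set R n).
Proof. exact: (trivIset_maximal_cube n_gt0 HD (@dense_dy Q)). Qed.

Lemma children_proper Q P : children Q P -> P <> Q.
Proof.
move=> [[_ _ hP] _] PQ; move: hP; rewrite PQ ltNge => /negP; apply.
apply: (@le_trans _ _ (mu (O_ Q))).
  apply: le_measure; rewrite ?inE//.
  by apply: measurableI => //; exact: measurable_cube.
apply: (le_trans (mO Q)); rewrite lee_fin ler_pM2r//; exact: eps0_le.
Qed.

Definition children_set Q := \bigcup_(P in children Q) cube_set P.

(** The children are disjoint, and each has the proportion theta of its measure
in the exceptional set. *)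
Lemma children_measure Q :
  (mu (children_set Q) <= (1 - eta)%:E * mu (cube_set Q))%E.
Proof.
have cc := countable_children Q.
have t0 := theta_gt0.
have mPO P : measurable (cube_set P `&` O_ Q).
  by apply: measurableI => //; exact: measurable_cube.
rewrite measure_countable_bigcup//; last 2 first.
- by move=> P _; exact: measurable_cube.
- exact: trivIset_children.
rewrite -(@lee_pmul2l _ theta%:E)// ?lte_fin//.
rewrite -esumZl//; last exact: ltW.
apply: (@le_trans _ _ (\esum_(P in children Q) mu (cube_set P `&` O_ Q))).
  apply: le_esum => P [[_ _ /ltW hP] _].
  rewrite [X in (_ * X)%E](_ : _ = (side P ^+ n)%:E); last exact: lebesgue_cube.
  by rewrite -EFinM.
rewrite -measure_countable_bigcup//; last first.
  move=> P P' cP cP' [x [[Px _] [P'x _]]]; apply: trivIset_children cP cP' _.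
  by exists x.
apply: (@le_trans _ _ (mu (O_ Q))).
  apply: le_measure; rewrite ?inE//; first exact: countable_bigcup_measurable.
  by move=> x [P _ []].
by rewrite lebesgue_cube -!EFinM mulrA; exact: mO.
Qed.

(** The dyadic parent of a child is not dense, by maximality, and has 2^n times
the measure of the child. *)
Lemma child_density Q P : dy Q -> children Q P ->
  (mu (cube_set P `&` O_ Q) <= (side P ^+ n / 4)%:E)%E.
Proof.
move=> [i _ DQ] cP; have [j _ DP] := children_dy cP.
have PQ := children_sub cP; have PnQ := children_proper cP.
have [T DT PT] := dyadic_ancestor n_gt0 HD 1 DP.
have sT : side T = 2 * side P.
  by rewrite (dyadic_side HD DP) (dyadic_side HD DT) opprB expfzDr ?pnatr_eq0.
have TQ : cube_set T `<=` cube_set Q.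
  apply: (dyadic_nested n_gt0 HD DQ DT).
    rewrite -(dyadic_side_le HD DQ DT) sT.
    by apply: (dyadic_proper_side n_gt0 HD) => //; [exists i|exists j].
  by exists P.1; split; [exact/PQ/cube_center|exact/PT/cube_center].
have nT : ~ dense_cubes Q T.
  move=> dT; have [_ /(_ T dT)] := cP.
  have PTne : cube_set P `&` cube_set T !=set0.
    by exists P.1; split; [exact: cube_center|exact/PT/cube_center].
  move=> /(_ PTne) TP; have := cube_set_side n_gt0 TP.
  by rewrite sT; have := side_gt0 P; lra.
apply: (@le_trans _ _ (mu (cube_set T `&` O_ Q))).
  apply: le_measure; rewrite ?inE; try
    by apply: measurableI => //; exact: measurable_cube.
  by apply: setSI.
rewrite leNgt; apply/negP => h; apply: nT; split => //; first by exists (j - 1%:Z).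
apply: le_lt_trans h; rewrite lee_fin sT exprMn /theta le_eqVlt.
apply/orP; left; apply/eqP.
by field; rewrite expf_neq0// pnatr_eq0.
Qed.

(** The exceptional set is open: each of its points lies in a dyadic cube that
it contains, and such a cube is dense. *)
Lemma not_child_good Q y : dy Q -> cube_set Q y -> ~ children_set Q y -> ~ O_ Q y.
Proof.
move=> [i _ DQ] Qy ny Oy.
have [j [P [ij DP Py PO]]] := dyadic_small HD i (oO (Q := Q)) Oy.
have PQ : cube_set P `<=` cube_set Q.
  by apply: (dyadic_nested n_gt0 HD DQ DP ij); exists y.
have dP : dense_cubes Q P.
  split => //; first by exists j.
  rewrite (setIidl PO) lebesgue_cube lte_fin -[ltRHS]mul1r ltr_pM2r//.
  by have := theta_le; lra.
have [T cT PT] := maximal_cube_exists n_gt0 HD (@dense_dy Q)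
  (fun P' h => cube_set_side n_gt0 (let: And3 _ h' _ := h in h')) dP.
by apply: ny; exists T => //; exact: PT.
Qed.

Definition step_const : R :=
  level eps0 * (A + 1 + 3 ^+ n * level eps0).

Let E0 : 0 < level eps0. Proof. exact: level_gt0 eps0_gt0. Qed.

Lemma step_const_ge : level eps0 <= step_const.
Proof.
rewrite /step_const ler_peMr ?(ltW E0)//.
have : 0 <= 3 ^+ n * level eps0 by rewrite mulr_ge0 ?exprn_ge0// ltW.
by have := A_ge0; lra.
Qed.

(** One step of the recursion: on a child, the values of S on the two
localizations differ by an almost constant function, which is controlled at
a point that is exceptional for neither cube. *)
Lemma child_step Q P : dy Q -> children Q P ->
  {ae mu, forall y, cube_set P y ->
    `|g_ Q y| <= `|g_ P y| + step_const * mean3 Q}.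
Proof.
move=> dQ cP; have PQ := children_sub cP.
have P3Q : box3 P `<=` box3 Q.
  by apply: (carleson_boxS n_gt0); exact: dilate3_sub.
pose h p := localize Q p - localize P p.
have h1 : L1_halfspace h by apply: L1_halfspaceB; exact: localize_L1.
have h0 p : box3 P p -> h p = 0.
  by move=> Pp; rewrite /h !localize_in ?subrr//; exact: P3Q.
have hV := S_valueB (localize_L1 Q) (localize_L1 P) (gP Q) (gP P).
have [Z [[Z' [mZ' Z'0 ZZ']] Zosc]] := Vosc h1 h0 hV.
have [x [Px xOQ xOP xZ]] : exists x, [/\ cube_set P x, ~ O_ Q x, ~ O_ P x & ~ Z' x].
  apply: contrapT => /forallNP nx.
  have mP := measurable_cube P.
  have : ((side P ^+ n)%:E <= (side P ^+ n / 2)%:E)%E.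
    rewrite -(lebesgue_cube P); apply: (@le_trans _ _ (mu ((cube_set P `&` O_ Q) `|` (O_ P `|` Z')))).
      apply: le_measure; rewrite ?inE//.
        by apply: measurableU; [exact: measurableI|exact: measurableU].
      move=> x Px; apply: contrapT => /not_orP[h2 /not_orP[h3 h4]].
      by apply: (nx x); split => // h5; apply: h2.
    apply: (le_trans (measureU2 _ _ _)); [exact: measurableI|exact: measurableU|].
    have -> : side P ^+ n / 2 = side P ^+ n / 4 + side P ^+ n / 4 by lra.
    rewrite EFinD; apply: leeD; first exact: child_density.
    apply: (le_trans (measureU2 _ _ _)) => //; rewrite [X in (_ + X)%E](_ : _ = 0%E) ; last exact: Z'0.
    rewrite adde0.
    apply: (le_trans (mO P)); rewrite lee_fin mulrC ler_pM2l//.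
    by have := eps0_le; have := theta_le; lra.
  rewrite lee_fin; have := sideX P; lra.
have mQ0 := mean3_ge0 Q.
have hc : (carleson h x <= (level eps0 * mean3 Q)%:E)%E.
  apply: le_trans (cle xOQ); apply: carleson_mono.
  - exact: ((L1_halfspaceP h).1 h1).1.
  - exact: measurable_localize.
  - move=> p _; rewrite /h; have [Pp|nPp] := pselect (box3 P p).
      by rewrite !localize_in ?subrr ?normr0//; exact: P3Q.
    by rewrite (localize_out nPp) subr0.
have mPQ : mean3 P <= 3 ^+ n * (level eps0 * mean3 Q).
  rewrite [mean3 P]/mean3 ler_pdivrMr//.
  have := mass_le_carleson (localize Q) (dilate3_center Px).
  have -> : mass (localize Q) (carleson_box (dilate 3%:pos%R P)) = mass f (box3 P).
    by apply: eq_mass => p /set_mem Pp; rewrite localize_in//; exact: P3Q.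
  have -> : side (dilate 3%:pos%R P) = 3 * side P :> R by [].
  move=> /le_trans/(_ (lee_wpmul2l _ (cle xOQ))).
  rewrite lee_fin exprn_ge0 ?mulr_ge0 ?(ltW (side_gt0 P))// => /(_ isT).
  rewrite /box3 mass_fin -EFinM lee_fin exprMn => hm; apply: (le_trans hm); rewrite le_eqVlt; apply/orP; left; apply/eqP. by ring.
have gQx := gle xOQ; have gPx := gle xOP.
exists Z'; split => // y ny; apply: contrapT => nZ; apply: ny => Py.
have nZZ w : ~ Z' w -> ~ Z w by move=> a b; apply: a; exact: ZZ'.
have := Zosc y x x _ (nZZ _ nZ) (nZZ _ xZ) Py Px Px hc.
set a := level eps0 * mean3 Q in gQx mPQ *.
have gPx' : `|g_ P x| <= level eps0 * (3 ^+ n * a).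
  by apply: (le_trans gPx); rewrite ler_pM2l.
have -> : step_const * mean3 Q = A * a + a + level eps0 * (3 ^+ n * a).
  by rewrite /step_const /a; lra.
move=> hosc.
have -> : g_ Q y = (g_ Q y - g_ P y - (g_ Q x - g_ P x)) + (g_ P y + (g_ Q x - g_ P x)) by lra.
rewrite (le_trans (ler_normD _ _))//.
have h2 := ler_normD (g_ P y) (g_ Q x - g_ P x).
have h3 := ler_normB (g_ Q x) (g_ P x).
lra.
Qed.

End exceptional_data.
End fixed_function.
End sparse_domination.

(** * Iterated selection of subcubes *)

Section selection.
Context (R : realType) (n : nat) (n_gt0 : (0 < n)%N).
Context (D : int -> set (cube R n)) (HD : dyadic_system D).
Local Notation mu := (lebesgue_Rn R n).
Local Notation dy := (dyadic_cubes D).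
Implicit Types (P Q T : cube R n) (x y : Rn R n) (I J : set (cube R n)).
Context (eta : R) (eta_gt0 : 0 < eta) (eta_lt1 : eta < 1).
Context (ch : cube R n -> set (cube R n)).
Context (ch_dy : forall Q P, ch Q P -> dy P).
Context (ch_sub : forall Q P, ch Q P -> cube_set P `<=` cube_set Q).
Context (ch_proper : forall Q P, ch Q P -> P <> Q).
Context (ch_triv : forall Q, trivIset (ch Q) (@cube_set R n)).

Let region I : set (Rn R n) := \bigcup_(Q in I) cube_set Q.

Context (ch_measure : forall Q,
  (mu (region (ch Q)) <= (1 - eta)%:E * mu (cube_set Q))%E).

Definition next_gen I : set (cube R n) := [set P | exists2 Q, I Q & ch Q P].
Definition gen I m : set (cube R n) := iter m next_gen I.

Let countable_dy I : I `<=` dy -> countable I.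
Proof.
by move=> Idy; apply: (@sub_countable _ _ _ dy);
  [exact: subset_card_le|exact: countable_dyadic].
Qed.

Let measurable_region I : I `<=` dy -> measurable (region I).
Proof.
move=> Idy; apply: countable_bigcup_measurable; first exact: countable_dy.
by move=> P _; exact: measurable_cube.
Qed.

Lemma gen_dy I m : I `<=` dy -> gen I m `<=` dy.
Proof. by move=> Idy; case: m => [|m] P; [exact: Idy|move=> [Q _ /ch_dy]]. Qed.

Lemma gen_mono I J m : I `<=` J -> gen I m `<=` gen J m.
Proof.
move=> IJ; elim: m => [|m IH] P /=; first exact: IJ.
by move=> [Q /IH JQ QP]; exists Q.
Qed.

Lemma gen_add I m l P : gen I (m + l) P ->
  exists2 Q, gen I m Q & cube_set P `<=` cube_set Q.
Proof.
elim: l P => [|l IH] P; first by rewrite addn0; exists P.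
rewrite addnS => -[Q /IH[T IT QT] /ch_sub PQ].
by exists T => //; exact: subset_trans QT.
Qed.

Lemma trivIset_gen I m : trivIset I (@cube_set R n) ->
  trivIset (gen I m) (@cube_set R n).
Proof.
move=> tI; elim: m => [//|m IH] P P' [Q gQ QP] [Q' gQ' QP'] [x [Px P'x]].
have QQ' : Q = Q'.
  by apply: IH => //; exists x; split; [exact: ch_sub Px|exact: ch_sub P'x].
by apply: (ch_triv QP) => //; [rewrite QQ'|exists x].
Qed.

(** The points of a selected cube that lie in none of its children lie in no
cube selected later, so the sets they form are disjoint. *)
Lemma gen_sparse I : I `<=` dy -> trivIset I (@cube_set R n) ->
  sparse eta (\bigcup_m gen I m).
Proof.
move=> Idy tI; exists (fun Q => cube_set Q `\` region (ch Q)); split.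
  move=> Q _; have mQ := measurable_cube Q.
  have mr : measurable (region (ch Q)) by apply: measurable_region => P /ch_dy.
  split; [exact: measurableD|exact: subDsetl|].
  have rQ : region (ch Q) `<=` cube_set Q by move=> x [P /ch_sub PQ /PQ].
  have Qoo : (mu (cube_set Q) < +oo)%E by rewrite lebesgue_cube ltry.
  have -> : mu (cube_set Q `\` region (ch Q)) =
      (mu (cube_set Q) - mu (cube_set Q `&` region (ch Q)))%E by exact: measureD.
  rewrite setIidr//; move: (ch_measure Q); rewrite lebesgue_cube -!EFinM.
  have : (0 <= mu (region (ch Q)))%E by exact: measure_ge0.
  case: (mu (region (ch Q))) => [r| |] //; rewrite !lee_fin => _ h; lra.
move=> Q P [m _ gQ] [l _ gP] PQ; apply: contrapT => /eqP/set0P.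
have key m' l' Q' P' x : (m' < l')%N -> gen I m' Q' -> gen I l' P' ->
    cube_set Q' x -> cube_set P' x -> region (ch Q') x.
  move=> /subnKC <- gQ' /gen_add[T [Q2 gQ2 chT] P'T] Q'x P'x.
  have <- : Q2 = Q'.
    apply: (trivIset_gen tI gQ2 gQ'); exists x; split => //.
    by apply: ch_sub chT _ _; exact: P'T.
  by exists T => //; exact: P'T.
move=> [x [[Px nP] [Qx nQ]]].
have [ml|lm|ml] := ltngtP m l.
- by apply: nQ; exact: key ml gQ gP Qx Px.
- by apply: nP; exact: key lm gP gQ Px Qx.
- by apply: PQ; rewrite ml in gQ; apply: (trivIset_gen tI gP gQ); exists x.
Qed.

Lemma region_next I : I `<=` dy -> trivIset I (@cube_set R n) ->
  (mu (region (next_gen I)) <= (1 - eta)%:E * mu (region I))%E.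
Proof.
move=> Idy tI; have cI := countable_dy Idy.
have mch Q : measurable (region (ch Q)) by apply: measurable_region => P /ch_dy.
have -> : region (next_gen I) = \bigcup_(Q in I) region (ch Q).
  apply/seteqP; split=> x.
    by move=> [P [Q IQ QP] Px]; exists Q => //; exists P.
  by move=> [Q IQ [P QP Px]]; exists P => //; exists Q.
apply: (le_trans (measure_countable_le _ cI _)) => //.
rewrite measure_countable_bigcup//; last by move=> Q _; exact: measurable_cube.
rewrite -esumZl//; last by have := eta_lt1; lra.
by apply: le_esum => Q _; exact: ch_measure.
Qed.

(** The generations below a cube shrink geometrically in measure, so almost
every point belongs to finitely many of them. *)
Lemma gen_terminates Q : dy Q ->
  {ae mu, forall y, exists m, ~ region (gen [set Q] m) y}.
Proof.
move=> dQ.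
have Idy : [set Q] `<=` dy by move=> P ->.
have tI : trivIset [set Q] (@cube_set R n) by move=> P P' -> ->.
have gI m : gen [set Q] m `<=` dy by exact: gen_dy.
have hm m : (mu (region (gen [set Q] m)) <= ((1 - eta) ^+ m * side Q ^+ n)%:E)%E.
  elim: m => [|m IH].
    have -> : region (gen [set Q] 0) = cube_set Q by rewrite /region bigcup_set1.
    by rewrite expr0 mul1r lebesgue_cube.
  have tm : trivIset (gen [set Q] m) (@cube_set R n) by exact: trivIset_gen.
  have hn : (mu (region (gen [set Q] m.+1)) <=
    (1 - eta)%:E * mu (region (gen [set Q] m)))%E by exact: region_next.
  apply: (le_trans hn).
  rewrite exprS -mulrA EFinM lee_wpmul2l// lee_fin.
  by have := eta_lt1; lra.
have bern m : (1 - eta) ^+ m * (1 + m%:R * eta) <= 1.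
  elim: m => [|m]; first by rewrite expr0 mul1r mul0r addr0.
  apply: le_trans; rewrite exprSr -mulrA ler_wpM2l//.
    by rewrite exprn_ge0//; have := eta_lt1; lra.
  have h := sqr_ge0 eta; have h2 : 0 <= m%:R * eta ^+ 2 by rewrite mulr_ge0.
  have -> : (1 - eta) * (1 + m.+1%:R * eta) =
    1 + m%:R * eta - eta ^+ 2 - m%:R * eta ^+ 2.
    by rewrite -natr1; ring.
  lra.
apply: (negligible_small (O := fun m => region (gen [set Q] m))
   (C := side Q ^+ n / eta)).
- by move=> m; exact: measurable_region.
- move=> m y ny; apply: contrapT => h; apply: ny; by exists m.
- move=> m; apply: (le_trans (hm m)); rewrite lee_fin.
  rewrite ler_pdivlMr ?ltr0Sn// ler_pdivlMr//.
  rewrite [leLHS](_ : _ = side Q ^+ n * ((1 - eta) ^+ m * (m.+1%:R * eta))); last ring.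
  rewrite ler_piMr ?exprn_ge0 ?(ltW (side_gt0 Q))//.
  apply: le_trans (bern m); apply: ler_wpM2l.
    by rewrite exprn_ge0//; have := eta_lt1; lra.
  by rewrite -natr1 mulrDl mul1r addrC lerD2r ltW.
Qed.

Section pointwise.
Context (G : cube R n -> Rn R n -> R) (a : cube R n -> R) (c : R).
Context (a_ge0 : forall Q, 0 <= a Q) (c_ge0 : 0 <= c).
Context (G_step : forall Q P, dy Q -> ch Q P -> {ae mu, forall y, cube_set P y ->
  `|G Q y| <= `|G P y| + c * a Q}).
Context (G_leaf : forall Q y, dy Q -> cube_set Q y -> ~ region (ch Q) y ->
  `|G Q y| <= c * a Q).

(** Induction on the number of generations below Q that contain y: a step to the
child containing y costs the term of Q, and the recursion stops at a cube none
of whose children contains y. *)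
Lemma gen_pointwise I : I `<=` dy -> {ae mu, forall y Q, I Q -> cube_set Q y ->
  (`|G Q y|%:E <= c%:E * \esum_(P in [set P | (\bigcup_m gen I m) P /\ cube_set P y])
                            (a P)%:E)%E}.
Proof.
move=> Idy; have cI := countable_dy Idy.
have h1 : {ae mu, forall y, forall Q, I Q -> exists m, ~ region (gen [set Q] m) y}.
  by apply: ae_countable => // Q /Idy; exact: gen_terminates.
have h2 : {ae mu, forall y, forall Q, dy Q -> forall P, ch Q P ->
    cube_set P y -> `|G Q y| <= `|G P y| + c * a Q}.
  apply: ae_countable; first exact: countable_dy.
  move=> Q dQ; apply: ae_countable; first by apply: countable_dy => P /ch_dy.
  by move=> P; exact: G_step.
apply: filterS2 h1 h2 => y h1 h2 Q IQ Qy.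
pose S Q := [set P | [/\ (\bigcup_m gen I m) P, cube_set P y
                       & cube_set P `<=` cube_set Q]].
apply: (@le_trans _ _ (c%:E * \esum_(P in S Q) (a P)%:E)%E); last first.
  rewrite lee_wpmul2l ?lee_fin//; apply: esum_subset.
  by move=> P [h Py _]; split.
have [m hm] := h1 Q IQ.
have gQ : (\bigcup_m gen I m) Q by exists 0%N.
elim: m Q {IQ} gQ Qy hm => [|m IH] Q gQ Qy hm.
  by exfalso; apply: hm; exists Q.
have dQ : dy Q by case: gQ => l _; exact: gen_dy.
have SQ : S Q Q by split.
have aE P : (0 <= (a P)%:E)%E by rewrite lee_fin.
have [[P QP Py]|nch] := pselect (region (ch Q) y); last first.
  apply: (le_trans (y := (c%:E * (a Q)%:E)%E)); first exact: G_leaf.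
  rewrite lee_wpmul2l ?lee_fin// -[leLHS](esum_set1 (t := Q)(a := fun P => (a P)%:E))//.
  by apply: esum_subset => P ->.
have gP : (\bigcup_m gen I m) P.
  by case: gQ => l _ gQ; exists l.+1 => //; exists Q.
have hP : ~ region (gen [set P] m) y.
  move=> [T gT Ty]; apply: hm; exists T => //; rewrite /gen iterSr.
  by apply: gen_mono gT => _ ->; exists Q.
have := IH P gP Py hP; set s := (\esum_(_ in S P) _)%E => Gs.
apply: (@le_trans _ _ (c%:E * (s + (a Q)%:E))%E).
  rewrite ge0_muleDr//; last exact: esum_ge0.
  apply: (@le_trans _ _ ((`|G P y|)%:E + (c * a Q)%:E)%E).
    by rewrite -EFinD lee_fin; exact: h2.
  by rewrite EFinM leeD2r.
rewrite lee_wpmul2l ?lee_fin//.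
rewrite [leRHS](esumID [set Q])//.
rewrite addeC leeD//.
  by rewrite setIC setIidl ?esum_set1// => _ ->.
apply: esum_subset => T [gT Ty TP]; split.
  by split => //; apply: subset_trans TP _; exact: ch_sub QP.
move=> TQ; apply: (ch_proper QP); apply: (dyadic_eq n_gt0 HD) => //.
  exact: ch_dy QP.
by apply/seteqP; split; [exact: ch_sub QP|rewrite -TQ].
Qed.

End pointwise.
End selection.

(** * Sparse domination *)

Section domination.
Context (R : realType) (n : nat) (n_gt0 : (0 < n)%N).
Context (D : int -> set (cube R n)) (HD : dyadic_system D).
Context (k : kernel_fun R n) (W A eta : R).
Context (W_ge0 : 0 <= W) (A_ge0 : 0 <= A) (eta_gt0 : 0 < eta) (eta_lt1 : eta < 1).
Local Notation mu := (lebesgue_Rn R n).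
Local Notation H := (@halfspace R n).
Context (Vexists : forall h : R1n R n -> R, L1_halfspace h ->
  exists g, S_value k h g /\ forall l : R, 0 < l -> exists Om : set (Rn R n),
    [/\ open_Rn Om, (mu Om <= (13 * W * (fine (mass h H) / l))%:E)%E
      & forall y, ~ Om y -> `|g y| <= l]).
Context (Vosc : forall (h : R1n R n -> R) g P, L1_halfspace h ->
  (forall p, carleson_box (dilate 3%:pos P) p -> h p = 0) -> S_value k h g ->
  exists Z, mu.-negligible Z /\ forall y y' w (c : R), ~ Z y -> ~ Z y' ->
    cube_set P y -> cube_set P y' -> cube_set P w -> (carleson h w <= c%:E)%E ->
    `|g y - g y'| <= A * c).
Context (Vunique : forall (h : R1n R n -> R) g g', L1_halfspace h ->
  S_value k h g -> S_value k h g' -> {ae mu, forall y, g y = g' y}).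

(** The stopping construction is run on the initial cubes Q. Off the box of 3Q
the function f vanishes in the half-space, so f agrees there with its
localization and g_ Q is a value of S at f. *)
Lemma sparse_domination (f : R1n R n -> R) :
  L1_halfspace f -> bounded_support f ->
  exists Df : set (cube R n), [/\ Df `<=` dyadic_cubes D, sparse eta Df &
    forall g, S_value k f g -> {ae mu, forall y, (`|g y|%:E <=
      (step_const n W A eta)%:E * \esum_(Q in [set Q | Df Q /\ cube_set Q y])
        box_mean f Q (dilate 3%:pos%R Q))%E}].
Proof.
move=> f1 [M fM].
pose e0 := eps0 n eta; have e00 : 0 < e0 by exact: eps0_gt0.
have sQ (Q : cube R n) : 0 < side Q ^+ n by rewrite exprn_gt0// side_gt0.
have hg Q := exceptional_set n_gt0 HD W_ge0 Vexists (localize_L1 f1 Q) (sQ Q) e00.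
have [g_ /choice[Om gO]] := choice hg.
have gP Q : S_value k (localize f Q) (g_ Q) by have [] := gO Q.
have oO Q : open_Rn (Om Q) by have [] := gO Q.
have mO Q : (mu (Om Q) <= (e0 * side Q ^+ n)%:E)%E by have [] := gO Q.
have gle Q y : ~ Om Q y -> `|g_ Q y| <= level n W e0 * mean3 f Q.
  by have [_ _ _ h] := gO Q; move=> /h[]; rewrite mass_localize.
have cle Q y : ~ Om Q y ->
    (carleson (localize f Q) y <= (level n W e0 * mean3 f Q)%:E)%E.
  by have [_ _ _ h] := gO Q; move=> /h[_]; rewrite mass_localize.
pose ch := children D Om.
have ch_dy Q P : ch Q P -> dyadic_cubes D P by exact: children_dy.
have ch_sub Q P : ch Q P -> cube_set P `<=` cube_set Q by exact: children_sub.
have ch_proper Q P : ch Q P -> P <> Q by exact: (children_proper eta_gt0 oO mO).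
have ch_triv Q : trivIset (ch Q) (@cube_set R n).
  by move=> P P'; exact: (trivIset_children n_gt0 HD).
have ch_meas := children_measure n_gt0 HD oO mO.
have [I [Idy tI Icov Ibig]] := initial_cubes n_gt0 HD M.
have level0 : 0 <= level n W e0 by apply/ltW; exact: level_gt0.
have c0 : 0 <= step_const n W A eta.
  by apply: le_trans level0 _; exact: step_const_ge.
have leaf Q y : dyadic_cubes D Q -> cube_set Q y -> ~ children_set D Om Q y ->
    `|g_ Q y| <= step_const n W A eta * mean3 f Q.
  move=> dQ Qy ny; apply: (le_trans (gle Q y (not_child_good n_gt0 HD oO dQ Qy ny))).
  by rewrite ler_wpM2r ?mean3_ge0//; exact: step_const_ge.
have hpt := gen_pointwise n_gt0 HD eta_gt0 eta_lt1 ch_dy ch_sub ch_proper ch_triv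
  ch_meas (mean3_ge0 f) c0
  (child_step n_gt0 HD W_ge0 eta_gt0 eta_lt1 Vosc f1 gP oO mO gle cle) leaf Idy.
exists (\bigcup_m gen ch I m); split.
- by move=> P [m _]; exact: gen_dy.
- exact: (gen_sparse HD ch_dy ch_sub ch_triv ch_meas Idy tI).
move=> g fg.
have fgI Q : I Q -> {ae mu, forall y, g y = g_ Q y}.
  move=> IQ; apply: (Vunique f1 fg); apply: S_value_eq (gP Q) => p /set_mem Hp.
  have [[MQ bQ] p0] := (Ibig Q IQ, Hp : 0 < p.1).
  have [fp|fp] := eqVneq (f p) 0; first by rewrite /localize fp mul0r.
  have pM := fM p Hp fp; rewrite localize_in//; split.
    rewrite p0/=; have t1 := norm_R1n_ge_t p.1 p.2.
    have -> : side (dilate 3%:pos%R Q) = 3 * side Q :> R by [].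
    by have := side_gt0 Q; lra.
  by apply: bQ => i; apply: le_trans pM; exact: norm_R1n_ge_coord.
have cI : countable I.
  by apply: (@sub_countable _ _ _ (dyadic_cubes D));
    [exact: subset_card_le|exact: countable_dyadic].
have h2 := ae_countable cI fgI.
apply: filterS2 h2 hpt => y h2 hy.
have [Q IQ Qy] := Icov y.
rewrite (h2 Q IQ); apply: (le_trans (hy Q IQ Qy)).
by rewrite lee_wpmul2l ?lee_fin//; apply: le_esum => P _; rewrite box_mean3.
Qed.

End domination.

Theorem theorem4p1 (R : realType) (n : nat) (n_gt0 : (0 < n)%N)
    (delta eta C1 C2 C3 : R) (delta_gt0 : 0 < delta)
    (eta_gt0 : 0 < eta) (eta_lt1 : eta < 1) :
  exists c : R, forall (D : int -> set (cube R n)) (k : kernel_fun R n),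
    dyadic_system D ->
    L2_carleson_estimate k C1 ->
    x_regularity k delta C2 ->
    y_regularity k delta C3 ->
    forall f : R1n R n -> R, L1_halfspace f -> bounded_support f ->
    exists Df : set (cube R n),
      [/\ Df `<=` dyadic_cubes D,
          sparse eta Df,
          exists g : Rn R n -> R, S_value k f g
        & forall g : Rn R n -> R, S_value k f g ->
          {ae lebesgue_Rn R n, forall y,
            (`|g y|%:E <=
             c%:E * \esum_(Q in [set Q | Df Q /\ cube_set Q y])
                      box_mean f Q (dilate 3%:pos%R Q))%E}].
Proof.
pose K2 := Num.max C2 0; pose K3 := Num.max C3 0.
have K2_ge0 : 0 <= K2 by rewrite le_max lexx orbT.
have K3_ge0 : 0 <= K3 by rewrite le_max lexx orbT.
pose B := K2 + (2 * (K2 + K3) * 2 ^+ n + (1 + 16 * C1 ^+ 2 * (400 * (n%:R + 1)) ^+ n)).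
have B_ge0 : 0 <= B.
  apply: addr_ge0 => //; apply: addr_ge0.
    by rewrite mulr_ge0 ?exprn_ge0// mulr_ge0// addr_ge0.
  apply: addr_ge0 => //; apply: mulr_ge0; first by rewrite mulr_ge0 ?sqr_ge0.
  by rewrite exprn_ge0// mulr_ge0// addr_ge0.
pose W := weak_const n delta C1 K2; have W_ge0 : 0 <= W by exact: weak_const_ge0.
pose A := osc_const n delta K3 B; have A_ge0 : 0 <= A by exact: osc_const_ge0.
exists (step_const n W A eta) => D k HD kL2 /(x_regularity_mono (C' := K2)) kx
  /(y_regularity_mono (C' := K3)) ky f f1 fM.
have {}kx : x_regularity k delta K2 by apply: kx; rewrite le_max lexx.
have {}ky : y_regularity k delta K3 by apply: ky; rewrite le_max lexx.
have ksize (t : R) x y : 0 < t -> `|k t x y| <= B / norm_R1n t (subRn x y) ^+ n.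
  exact: (kernel_size n_gt0 delta_gt0 K2_ge0 K3_ge0 HD kL2 kx ky).
have kmeas y := measurable_kernel delta_gt0 K2_ge0 y kx.
have Sconv := lifted_converges n_gt0 delta_gt0 K2_ge0 B_ge0 kx ksize.
have Sopen (e l : R) (u : R1n R n -> R) (e0 : 0 < e) (ue : lifted e u) :=
  open_S_op n_gt0 delta_gt0 K2_ge0 K3_ge0 B_ge0 kx ky ksize (l := l) e0 ue.
have Sweak (e l N : R) (u : R1n R n -> R) (e0 : 0 < e) (ue : lifted e u) :=
  weak_type n_gt0 delta_gt0 K2_ge0 K3_ge0 B_ge0 HD kL2 kx ky ksize
    (l := l) (N := N) e0 ue.
have Sosc (e c : R) (u : R1n R n -> R) P y y' w (e0 : 0 < e) (ue : lifted e u) :=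
  oscillation n_gt0 delta_gt0 K2_ge0 K3_ge0 B_ge0 kx ky ksize
    (P := P) (y := y) (y' := y') (w := w) (c := c) e0 ue.
have Vunique := S_value_unique W_ge0 kmeas Sconv Sopen Sweak.
have Vexists h : L1_halfspace h -> exists g, S_value k h g /\
    forall l : R, 0 < l -> exists Om : set (Rn R n),
    [/\ open_Rn Om, (lebesgue_Rn R n Om <=
        (13 * W * (fine (mass h (@halfspace R n)) / l))%:E)%E
      & forall y, ~ Om y -> `|g y| <= l].
  move=> h1; have [_ [g [_ hg _ gO]]] := S_value_exists W_ge0 Sconv Sopen Sweak h1.
  by exists g.
have Vosc := S_value_osc W_ge0 kmeas Sconv Sopen Sweak Sosc.
have [Df [Dfdy Dfs DfP]] :=
  sparse_domination n_gt0 HD W_ge0 A_ge0 eta_gt0 eta_lt1 Vexists Vosc Vunique f1 fM.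
have [g [fg _]] := Vexists f f1.
by exists Df; split => //; exists g.
Qed.
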